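(* Let $K\subset\mathbb{R}^2$ be a convex body with $\mathrm{G}^\circ(K)\le 1$, i.e. with at most one lattice point of $\mathbb{Z}^2$ in its interior. Then $\mathrm{w}(K)\le 3$. Equality holds if and only if $K$ is unimodularly equivalent to $3\Delta_2$.
   Context: A convex body in $\mathbb{R}^d$ is a non-empty compact convex subset of $\mathbb{R}^d$. $\mathrm{G}^\circ(K)$ denotes the number of points of $\mathbb{Z}^d$ in the interior of $K$. For $u\in\mathbb{R}^d\setminus\{0\}$, $\mathrm{w}(K,u)=\max_{x\in K}\langle u,x\rangle-\min_{x\in K}\langle u,x\rangle$; the lattice width of $K$ is $\mathrm{w}(K)=\inf_{u\in\mathbb{Z}^d\setminus\{0\}}\mathrm{w}(K,u)$. Two sets $A,B\subset\mathbb{R}^d$ are unimodularly equivalent if $A=g(B)$ for some map $g(x)=Ux+t$ with $U\in\mathrm{GL}_d(\mathbb{Z})$ and $t\in\mathbb{Z}^d$. $\Delta_2=\mathrm{conv}\{(0,0),(0,1),(1,0)\}$. *)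

(* Defs.v *)
From HB Require Import structures.
From mathcomp Require Import all_boot all_order all_algebra.
From mathcomp Require Import all_classical all_reals all_analysis.

Set Implicit Arguments.
Unset Strict Implicit.
Unset Printing Implicit Defensive.

Import Order.TTheory GRing.Theory Num.Theory numFieldNormedType.Exports.

Local Open Scope classical_set_scope.
Local Open Scope ring_scope.

(* Points of R^d are row vectors, so the linear map x |-> U x reads x *m U^T. *)

Definition convex_body (R : realType) (d : nat) (K : set 'rV[R]_d) : Prop :=
  [/\ K !=set0, compact K & convex_set K].

Definition lattice_vec (R : realType) (d : nat) (z : 'rV[int]_d) : 'rV[R]_d :=
  map_mx intr z.

Definition lattice (R : realType) (d : nat) : set 'rV[R]_d :=
  range (@lattice_vec R d).
Arguments lattice R d : clear implicits.

(* [counting] is +oo on infinite sets. *)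
Definition interior_lattice_count (R : realType) (d : nat) (K : set 'rV[R]_d) :
    \bar R :=
  counting (interior K `&` lattice R d).

Definition dotv (R : realType) (d : nat) (u x : 'rV[R]_d) : R :=
  \sum_(i < d) u 0 i * x 0 i.

(* [sup] and [inf] are attained, hence are a max and a min, when K is compact
   and nonempty. *)
Definition width_along (R : realType) (d : nat) (K : set 'rV[R]_d)
    (u : 'rV[R]_d) : R :=
  sup (dotv u @` K) - inf (dotv u @` K).

Definition lattice_width (R : realType) (d : nat) (K : set 'rV[R]_d) : R :=
  inf [set width_along K (lattice_vec R u) | u in [set u : 'rV[int]_d | u != 0]].

Definition unimodularly_equivalent (R : realType) (d : nat)
    (A B : set 'rV[R]_d) : Prop :=
  exists (U : 'M[int]_d) (t : 'rV[int]_d),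
    U \in unitmx /\
    A = (fun x => x *m (map_mx intr U)^T + lattice_vec R t) @` B.

Definition conv_hull (R : realType) (d : nat) (A : set 'rV[R]_d) :
    set 'rV[R]_d :=
  smallest (fun C : set 'rV[R]_d => convex_set C) A.

Definition Delta2 (R : realType) : set 'rV[R]_2 :=
  conv_hull [set 0; delta_mx 0 1; delta_mx 0 0].
Arguments Delta2 R : clear implicits.

Definition dilate (R : realType) (d : nat) (c : R) (A : set 'rV[R]_d) :
    set 'rV[R]_d :=
  (fun x => c *: x) @` A.

(* Main.v *)
Require Import Defs.
From mathcomp Require Import all_boot all_order all_algebra.
From mathcomp Require Import all_classical all_reals all_analysis.
From mathcomp Require Import finmap ring lra zify.

Set Implicit Arguments.
Unset Strict Implicit.
Unset Printing Implicit Defensive.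

Import Order.TTheory GRing.Theory Num.Theory numFieldNormedType.Exports.

Local Open Scope classical_set_scope.
Local Open Scope ring_scope.

(** A point of a convex planar set that is not interior lies on a weakly
    separating line ([separated]), so one may adjoin lattice points to K as long
    as the lattice points other than a chosen origin remain separated
    ([extend_separated]). Hence K can be taken to contain the origin and to be
    saturated near it: a lattice point close to 0 is missing only if adjoining it
    would make a nonzero lattice point of K interior ([blocks]). A wide convex
    subset of 3 Delta_2 is all of it ([big_triangle_sub]), so the enlargement is
    harmless.

    If K has three consecutive collinear lattice points next to the origin, it
    is 3 Delta_2 ([edge_case]). Otherwise, in a suitable basis, its nonzero
    lattice points are among (1,0), (1,1), (0,1) and their antipodes. The blocking
    relations then prescribe how the supporting lines at these points are tilted,
    and the polygon cut out by those lines has width less than 3 in one of the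
    directions (1,0), (0,1), (1,-1), unless again K contains three consecutive
    collinear lattice points. *)

(** The equality case shapes the proof. Everything is derived from width at least 3, not more than
    3, so each configuration is refuted at the sharp threshold. In two of them ([two_tilts],
    [no_tilt]) the estimates only collapse to equalities, which place a vertex of K at a lattice
    point excluded by the classification. Both claims of the theorem then come from one implication:
    width at least 3 makes K a copy of the triangle, whose width is exactly 3.

    Blocking enters through coefficients. One supporting functional (p, q) is fixed at each relevant
    lattice point (x, y) of K. That (x, y) blocks (a, b) gives p x + q y < p a + q b, and after
    normalisation this bounds the tilt of the line at (x, y).

    The obstacle to enlarging K is that adjoining one lattice point can make another missing one
    interior. Hence the point finally adjoined is not the one aimed at, and all that is known of its
    place is a convex region containing it; these regions are chosen accordingly.

    Zero and one interior lattice points are treated alike: the origin has to lie in K, in its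
    interior or not. *)

(* A faster [lra], which first tries without the hypotheses containing products. *)
Ltac bound_lra := first
  [ assumption
  | solve [apply: ltW; assumption]
  | solve [rewrite subr_ge0; first [assumption | apply: ltW; assumption]]
  | solve [repeat match goal with H : context [GRing.mul _ _] |- _ => clear H end; lra]
  | lra ].

(** * Width estimates for polygons cut out by tilted lines *)

(* In [mutual_tilts], up to exchanging x and y, u and v are the maxima of y - x and
   x - y over K, and w and n those of y and - y. *)
Lemma mutual_tilts_false (R : realFieldType) (p B C u v w n : R) :
  0 <= p <= 1 -> 0 <= B < 1 -> 0 <= C < 1 ->
  (1 + C * p) * u <= 1 + p -> (p + B) * v <= 1 + p -> 3 <= u + v ->
  (1 + p * C) * w <= 1 + p + p * C -> (1 - B * C) * n <= B + B * C ->
  3 <= w + n -> False.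
Proof.
move=> /andP[p0 p1] /andP[B0 B1] /andP[C0 C1] hu hv huv hw hn hwn.
have Cp : 0 <= C * p by apply: mulr_ge0.
have BC1 : 0 <= 1 - B * C by nra.
(* [i1] bounds [B] from above by eliminating [u] and [v]; [i2] bounds it from below by eliminating
   [w] and [n]. *)
have i1 : B * (2 + 3 * C * p - p) <= 1 - p + p ^+ 2 + C * p - 2 * C * p ^+ 2.
  have : (p + B) * (3 * (1 + C * p) - (1 + p)) <= (1 + p) * (1 + C * p).
    have h1 : 3 * (1 + C * p) - (1 + p) <= (1 + C * p) * v by nra.
    have h2 : (p + B) * (3 * (1 + C * p) - (1 + p)) <= (p + B) * ((1 + C * p) * v).
      by apply: ler_wpM2l => //; lra.
    have h3 : (1 + C * p) * ((p + B) * v) <= (1 + C * p) * (1 + p).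
      by apply: ler_wpM2l => //; lra.
    lra.
  lra.
have i2 : 2 - p + 2 * C * p <= B * (1 + 3 * C + 3 * C ^+ 2 * p).
  have h1 : 2 + 2 * p * C - p <= (1 + p * C) * n by nra.
  have h2 := ler_wpM2l BC1 h1.
  have h3 : (1 + p * C) * ((1 - B * C) * n) <= (1 + p * C) * (B + B * C).
    by apply: ler_wpM2l => //; lra.
  lra.
(* Eliminating [B] between [i1] and [i2] leaves 3 ((1 - p) (1 - C) + C p f) <= 0, where f is the
   expression below. As f is positive, both terms vanish, so p = 1 and C = 0, and then [i2] says 1
   <= B. *)
have f0 : 0 < (3 - 2 * p) + C * (5 * p - 2 - p ^+ 2) + C ^+ 2 * (p * (2 * p - 1)).
  have [ph|ph] := lerP p (1 / 2).
    have : 0 <= p * (1 - 2 * p) * (C * (1 - C)) by do !apply: mulr_ge0; bound_lra.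
    have : 0 <= (1 - C) * (3 - 2 * p) by apply: mulr_ge0; bound_lra.
    have : 0 <= C * (1 + p) ^+ 2 by apply: mulr_ge0 => //; exact: sqr_ge0.
    have [->|Cn] := eqVneq C 0; first by lra.
    have : 0 < C * (1 + p) ^+ 2 by apply: mulr_gt0; rewrite ?exprn_gt0 ?lt_def ?Cn //; lra.
    lra.
  have : 0 <= C * (5 * p - 2 - p ^+ 2) by apply: mulr_ge0 => //; nra.
  have : 0 <= C ^+ 2 * (p * (2 * p - 1)) by do !apply: mulr_ge0 => //; lra.
  lra.
have pos1 : 0 <= 2 + 3 * C * p - p by lra.
have pos2 : 0 <= 1 + 3 * C + 3 * C ^+ 2 * p.
  have : 0 <= C ^+ 2 * p by apply: mulr_ge0 => //; exact: sqr_ge0.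
  lra.
have j1 := ler_wpM2r pos1 i2.
have j2 := ler_wpM2l pos2 i1.
have k1 : 0 <= (1 - p) * (1 - C) by apply: mulr_ge0; bound_lra.
have k2 := mulr_ge0 Cp (ltW f0).
have e1 : (1 - p) * (1 - C) = 0 by lra.
have e2 : C * p = 0.
  have : C * p * ((3 - 2 * p) + C * (5 * p - 2 - p ^+ 2) + C ^+ 2 * (p * (2 * p - 1))) = 0 by lra.
  by move/eqP; rewrite mulf_eq0 (gt_eqF f0) orbF => /eqP.
have p1' : p = 1 by move/eqP: e1; rewrite mulf_eq0 => /orP[] /eqP; lra.
have C0' : C = 0 by rewrite p1' mulr1 in e2.
by move: i2; rewrite p1' C0'; lra.
Qed.

(** The width is witnessed by points of K rather than by a supremum, so the property passes to every
    larger set. *)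
Definition wide3 (R : realFieldType) (K : R -> R -> Prop) : Prop :=
  forall u v : int, (u != 0) || (v != 0) ->
  exists x1 y1 x2 y2, [/\ K x1 y1, K x2 y2 &
    3 <= (u%:~R * x1 + v%:~R * y1) - (u%:~R * x2 + v%:~R * y2)].

Definition below (R : realFieldType) (K : R -> R -> Prop) (a b c : R) : Prop :=
  forall x y, K x y -> a * x + b * y <= c.

Lemma wide3_x (R : realFieldType) (K : R -> R -> Prop) : wide3 K ->
  exists x1 y1 x2 y2, [/\ K x1 y1, K x2 y2 & 3 <= x1 - x2].
Proof.
move=> /(_ 1 0 isT) [x1 [y1 [x2 [y2 [h1 h2 h]]]]].
by exists x1, y1, x2, y2; split=> //; move: h; rewrite !mul0r !addr0 !mul1r.
Qed.

Lemma wide3_y (R : realFieldType) (K : R -> R -> Prop) : wide3 K ->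
  exists x1 y1 x2 y2, [/\ K x1 y1, K x2 y2 & 3 <= y1 - y2].
Proof.
move=> /(_ 0 1 isT) [x1 [y1 [x2 [y2 [h1 h2 h]]]]].
by exists x1, y1, x2, y2; split=> //; move: h; rewrite !mul0r !add0r !mul1r.
Qed.

Lemma wide3_diff (R : realFieldType) (K : R -> R -> Prop) : wide3 K ->
  exists x1 y1 x2 y2, [/\ K x1 y1, K x2 y2 & 3 <= (x1 - y1) - (x2 - y2)].
Proof.
move=> /(_ 1 (-1) isT) [x1 [y1 [x2 [y2 [h1 h2 h]]]]].
exists x1, y1, x2, y2; split=> //; move: h.
by rewrite mulrN1z !mulN1r !mul1r.
Qed.

(** The lines pass through (1,1), (1,0) and (0,1). The conditions B < 1 and C < 1 say that the last
    two leave out (0,-1) and (-1,0) respectively. *)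
Lemma mutual_tilts (R : realFieldType) (K : R -> R -> Prop) (al B C : R) :
  wide3 K -> 0 <= al <= 1 -> 0 <= B < 1 -> 0 <= C < 1 ->
  below K al (1 - al) 1 -> below K B (-1) B -> below K (-1) C C -> False.
Proof.
move=> W /andP[a0 a1] hB hC L1 L0 L2.
have [/andP[B0 B1] /andP[C0 C1]] := (hB, hC).
have B1' : 0 <= 1 - B by bound_lra.
have C1' : 0 <= 1 - C by bound_lra.
have [xa [ya [xb [yb [k1 k2 h1]]]]] := wide3_x W.
have [xc [yc [xd [yd [k3 k4 h2]]]]] := wide3_y W.
have [xe [ye [xf [yf [k5 k6 h3]]]]] := wide3_diff W.
(* Reflection in the diagonal exchanges [B] and [C], so the ratio [p] of the coefficients of the
   line at (1,1) can be kept at most 1. *)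
have [ah|ah] := lerP al (1 / 2).
- pose p := al / (1 - al).
  have p0 : 0 <= p <= 1.
    by rewrite divr_ge0 /= ?ler_pdivrMr; lra.
  have Lp x y : K x y -> p * x + y <= 1 + p.
    move=> /L1 h.
    have -> : 1 + p = 1 / (1 - al) by rewrite /p; field; lra.
    rewrite ler_pdivlMr; last lra.
    have -> : (p * x + y) * (1 - al) = al * x + (1 - al) * y by rewrite /p; field; lra.
    exact: h.
  have /andP[p0' p1'] := p0.
  have p2 : 0 <= 1 + p by bound_lra.
  apply: (@mutual_tilts_false R p B C (yf - xf) (xe - ye) yc (- yd)) => //.
  + have g1 := Lp _ _ k6; have g2 := L2 _ _ k6.
    have := ler_wpM2l C1' g1; have := ler_wpM2l p2 g2; lra.
  + have g1 := Lp _ _ k5; have g2 := L0 _ _ k5.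
    have := ler_wpM2l B1' g1; have := ler_wpM2l p2 g2; lra.
  + lra.
  + have g1 := Lp _ _ k3; have g2 := L2 _ _ k3.
    have := ler_wpM2l p0' g2; lra.
  + have g1 := L0 _ _ k4; have g2 := L2 _ _ k4.
    have := ler_wpM2l B0 g2; lra.
- pose p := (1 - al) / al.
  have p0 : 0 <= p <= 1.
    by rewrite divr_ge0 /= ?ler_pdivrMr; lra.
  have Lp x y : K x y -> x + p * y <= 1 + p.
    move=> /L1 h.
    have -> : 1 + p = 1 / al by rewrite /p; field; lra.
    rewrite ler_pdivlMr; last lra.
    have -> : (x + p * y) * al = al * x + (1 - al) * y by rewrite /p; field; lra.
    exact: h.
  have /andP[p0' p1'] := p0.
  have p2 : 0 <= 1 + p by bound_lra.
  apply: (@mutual_tilts_false R p C B (xe - ye) (yf - xf) xa (- xb)) => //.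
  + have g1 := Lp _ _ k5; have g2 := L0 _ _ k5.
    have := ler_wpM2l B1' g1; have := ler_wpM2l p2 g2; lra.
  + have g1 := Lp _ _ k6; have g2 := L2 _ _ k6.
    have := ler_wpM2l C1' g1; have := ler_wpM2l p2 g2; lra.
  + lra.
  + have g1 := Lp _ _ k1; have g2 := L0 _ _ k1.
    have := ler_wpM2l p0' g2; lra.
  + have g1 := L0 _ _ k2; have g2 := L2 _ _ k2.
    have := ler_wpM2l C0 g1; lra.
Qed.

(** The lines through (1,1) and (0,1) meet at height 1 + al ga / (al + ga - al ga), unless both
    tilts vanish, and the fraction is at most each of al and ga. These linear bounds replace the
    rational one in the estimates below. *)
Lemma top_le_vertex (R : realFieldType) (al ga x y : R) : 0 <= al <= 1 -> 0 <= ga <= 1 ->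
  al * x + (1 - al) * y <= 1 -> y - ga * x <= 1 -> y <= 1 + al /\ y <= 1 + ga.
Proof.
move=> /andP[a0 a1] /andP[g0 g1] h1 h2; have [x0|x0] := lerP x 0.
  have : 0 <= ga * - x by apply: mulr_ge0; bound_lra.
  by split; lra.
have h3 : (1 - ga) * x >= 0 by apply: mulr_ge0; bound_lra.
split; first by have : 0 <= al * (x - y + 1); [apply: mulr_ge0; bound_lra|lra].
have [//|y1] := lerP y (1 + ga).
have x1 : 1 < x by rewrite ltNge; apply/negP => x1; have : 0 <= ga * (1 - x); [apply: mulr_ge0; bound_lra|lra].
have : 0 <= al * (x - 1) by apply: mulr_ge0; bound_lra.
have [e|an] := eqVneq al 1; first by rewrite e in h1; lra.
have : 0 < (1 - al) * (y - 1) by apply: mulr_gt0; [rewrite subr_gt0 lt_neqAle an|lra].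
lra.
Qed.

(** The maximum of y - x is at the intersection of the lines through (-1,0) and (0,1). Its value is
    1 + (1 - ga) (1 - si) / (1 - ga si) unless ga = si = 1, and it is again bounded linearly. *)
Lemma diag_le_vertex (R : realFieldType) (si ga x y : R) : 0 <= si <= 1 -> 0 <= ga <= 1 ->
  - x + si * y <= 1 -> y - ga * x <= 1 -> y - x <= 2 - si /\ y - x <= 2 - ga.
Proof.
move=> /andP[a0 a1] /andP[g0 g1] h1 h2; split.
- have [x0|x0] := lerP x 0.
    have : 0 <= ga * - x by apply: mulr_ge0; bound_lra.
    have : y <= 1 -> 0 <= (1 - si) * (1 - y) by move=> ?; apply: mulr_ge0; bound_lra.
    lra.
  have : 0 <= (1 - ga) * x by apply: mulr_ge0; bound_lra.
  lra.
- have [x0|x0] := lerP (-1) x.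
    have : 0 <= (1 - ga) * (1 + x) by apply: mulr_ge0; bound_lra.
    lra.
  have [y0|y0] := lerP y 0.
    have : 0 <= (1 - si) * - y by apply: mulr_ge0; bound_lra.
    lra.
  have : 0 <= si * y by apply: mulr_ge0; bound_lra.
  lra.
Qed.

(** The line at (1,0) leaves out (0,-1) and the one at (-1,0) leaves out (-1,-1), so K narrows
    downwards from both sides. The widths along x and y suffice. *)
Lemma tilts_apart (R : realFieldType) (K : R -> R -> Prop) (al B ga d : R) :
  wide3 K -> 0 <= al <= 1 -> 0 <= B < 1 -> 0 <= ga <= 1 -> 0 < d <= 1 ->
  below K al (1 - al) 1 -> below K B (-1) B -> below K (- ga) 1 1 ->
  below K (- (1 - d)) (- d) (1 - d) -> False.
Proof.
move=> W hal /andP[B0 B1] hga /andP[d0 d1] L1 L0 L2 L3.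
have [/andP[a0 a1] /andP[g0 g1]] := (hal, hga).
have [xa [ya [xb [yb [k1 k2 h1]]]]] := wide3_x W.
have [xc [yc [xd [yd [k3 k4 h2]]]]] := wide3_y W.
have [ya1 yg1] : yc <= 1 + al /\ yc <= 1 + ga.
  by apply: (@top_le_vertex _ al ga xc) => //; [exact: L1|have := L2 _ _ k3; lra].
pose de := 1 - B; have [de0 de1] : 0 < de /\ de <= 1 by rewrite /de; lra.
have dd0 : 0 < de * d by apply: mulr_gt0.
have dd1 : 0 <= 1 - de * d.
  have : 0 <= de * (1 - d) by apply: mulr_ge0; bound_lra.
  lra.
have dd2 : 0 < 1 - de * d.
  rewrite lt_def dd1 andbT; apply/negP => /eqP dd.
  have dem : 0 <= de * (1 - d) by apply: mulr_ge0; bound_lra.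
  have deE : de = 1 by lra.
  have BE : B = 0 by move: deE; rewrite /de; lra.
  by have := L0 _ _ k4; rewrite BE; lra.
have hn : (1 - de * d) * - yd <= 2 * (1 - de) * (1 - d).
  have d1' : 0 <= 1 - d by bound_lra.
  have := ler_wpM2l d1' (L0 _ _ k4); have := ler_wpM2l B0 (L3 _ _ k4).
  rewrite /de; lra.
(* Enough height forces the complements [a] and [g] of the tilts at (1,1) and (0,1) to be small
   ([ha], [hg]), while enough width along x forces them to be large ([key]). *)
pose a := 1 - al; pose g := 1 - ga; pose rho := 1 - 2 * de - 2 * d + 3 * de * d.
have ha : (1 - de * d) * a <= rho.
  have e : 2 - al <= - yd by lra.
  by have := ler_wpM2l dd1 e; rewrite /a /rho; lra.
have hg : (1 - de * d) * g <= rho.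
  have e : 2 - ga <= - yd by lra.
  by have := ler_wpM2l dd1 e; rewrite /g /rho; lra.
have hx : (1 - de * a) * (xa - 1) <= a.
  have a' : 0 <= 1 - al by bound_lra.
  have := ler_wpM2l a' (L0 _ _ k1); have := L1 _ _ k1; rewrite /de /a; lra.
have hm : (1 - d * g) * (- xb - 1) <= d * g.
  have := ler_wpM2l (ltW d0) (L2 _ _ k2); have := L3 _ _ k2; rewrite /g; lra.
have [a'0 a'1] : 0 <= a /\ a <= 1 by rewrite /a; lra.
have [g'0 g'1] : 0 <= g /\ g <= 1 by rewrite /g; lra.
have ea : 0 <= 1 - de * a by rewrite subr_ge0 mulr_ile1 // ltW.
have eg : 0 <= 1 - d * g by rewrite subr_ge0 mulr_ile1 // ltW.
have key : 1 <= a * (1 + de) + 2 * d * g.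
  have k := ler_wpM2l eg hx; have k' := ler_wpM2l ea hm.
  have k'' : 1 <= (xa - 1) + (- xb - 1) by lra.
  have := ler_wpM2l (mulr_ge0 ea eg) k''.
  have adg := mulr_ge0 a'0 (mulr_ge0 (ltW d0) g'0).
  have := mulr_ge0 (ltW de0) adg.
  lra.
have key2 : 1 - de * d <= (1 + de + 2 * d) * rho.
  have := ler_wpM2l dd1 key.
  have k1' : 0 <= 1 + de by bound_lra.
  have k2' : 0 <= 2 * d by lra.
  by have := ler_wpM2l k1' ha; have := ler_wpM2l k2' hg; lra.
clear -key2 de0 de1 d0 d1 dd0 dd1 dd2.
have : 0 <= de ^+ 2 * (1 - d) by apply: mulr_ge0; [exact: sqr_ge0|lra].
have : 0 < de * (1 - de * d) by apply: mulr_gt0; bound_lra.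
have : 0 <= d ^+ 2 * (1 - de) by apply: mulr_ge0; [exact: sqr_ge0|lra].
have : 0 <= (de * d) * (1 - d) by apply: mulr_ge0; bound_lra.
have : 0 <= (de * d) * (1 - de) by apply: mulr_ge0; bound_lra.
move: key2; rewrite /rho; lra.
Qed.

(** B < 1/2 says that the line at (1,0) leaves out (-1,-1). The height bounds [al] from below
    ([k1]), the width along x - y bounds it from above ([k2]), and the two bounds are
    incompatible. *)
Lemma steep_tilt (R : realFieldType) (K : R -> R -> Prop) (al B ga si : R) :
  wide3 K -> 0 <= al <= 1 -> 0 <= B < 1 / 2 -> 0 <= ga <= 1 -> 0 <= si <= 1 ->
  below K al (1 - al) 1 -> below K B (-1) B -> below K (- ga) 1 1 ->
  below K (-1) si 1 -> False.
Proof.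
move=> W hal /andP[B0 B1] hga hsi L1 L0 L2 L3.
have [/andP[a0 a1] /andP[g0 g1] /andP[s0 s1]] := And3 hal hga hsi.
have [xc [yc [xd [yd [k3 k4 h2]]]]] := wide3_y W.
have [xe [ye [xf [yf [k5 k6 h3]]]]] := wide3_diff W.
have [ya1 yg1] : yc <= 1 + al /\ yc <= 1 + ga.
  by apply: (@top_le_vertex _ al ga xc) => //; [exact: L1|have := L2 _ _ k3; lra].
have [d1 d2] : yf - xf <= 2 - si /\ yf - xf <= 2 - ga.
  by apply: (@diag_le_vertex _ si ga xf) => //; [have := L3 _ _ k6; lra|have := L2 _ _ k6; lra].
have Bs : 0 <= B * si <= B.
  by rewrite mulr_ge0 // ler_piMr.
have Bs1 : 0 <= 1 - B * si by lra.
have hn : (1 - B * si) * - yd <= 2 * B.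
  have := L0 _ _ k4; have := ler_wpM2l B0 (L3 _ _ k4); lra.
have hm : (al + (1 - al) * B) * (xe - ye) <= 1.
  have B1' : 0 <= 1 - B by bound_lra.
  have := L0 _ _ k5; have := ler_wpM2l B1' (L1 _ _ k5); lra.
have w0 : 0 < 1 - B - B * si by lra.
have k1 : 2 * (1 - B - B * si) <= (1 - B * si) * al.
  have e : 2 - al <= - yd by lra.
  by have := ler_wpM2l Bs1 e; lra.
have k2 : al * (1 - B) * (1 + si) <= 1 - B - B * si.
  have e : 1 + si <= xe - ye by lra.
  have e' : 0 <= al + (1 - al) * B by apply: addr_ge0 => //; apply: mulr_ge0; bound_lra.
  by have := ler_wpM2l e' e; lra.
have q0 : 0 <= (1 - B) * (1 + si) by apply: mulr_ge0; bound_lra.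
have := ler_wpM2r q0 k1; have := ler_wpM2l Bs1 k2.
have : (1 - B - B * si) * (1 - B * si) < (1 - B - B * si) * (2 * (1 - B) * (1 + si)).
  rewrite ltr_pM2l //.
  have : 0 <= (1 - B) * si by apply: mulr_ge0; bound_lra.
  lra.
lra.
Qed.

(** The line at (0,1) leaves out (-1,0), and the line at (-1,-1) leaves out (0,-1). All three widths
    are needed; each gives one inequality between [al], [de] and [et]. *)
Lemma opposite_tilts (R : realFieldType) (K : R -> R -> Prop) (al be de et : R) :
  wide3 K -> 0 <= al <= 1 -> 0 <= be <= 1 -> 0 < de <= 1 / 2 -> 0 < et <= 1 ->
  below K al (1 - al) 1 -> below K 1 (- be) 1 ->
  below K (-1) (1 - de) (1 - de) -> below K et (- (1 + et)) 1 -> False.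
Proof.
move=> W /andP[a0 a1] /andP[b0 b1] /andP[d0 d1] /andP[e0 e1] L1 L0 L2 L4.
have [xa [ya [xb [yb [k1 k2 h1]]]]] := wide3_x W.
have [xc [yc [xd [yd [k3 k4 h2]]]]] := wide3_y W.
have [xe [ye [xf [yf [k5 k6 h3]]]]] := wide3_diff W.
have d1' : 0 <= 1 - de by bound_lra.
have ed : 0 < et * de by apply: mulr_gt0.
have ad : 0 <= al * de <= de by rewrite mulr_ge0 ?ler_piMl //; lra.
have xa2 : xa <= 2 - al.
  have l0 := L0 _ _ k1; have l1 := L1 _ _ k1.
  have [y0|y0] := lerP ya 0.
    have : 0 <= be * - ya by apply: mulr_ge0; bound_lra.
    lra.
  have : 0 <= (1 - be) * ya by apply: mulr_ge0; bound_lra.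
  have : 0 <= (1 - al) * (ya - xa + 1) by apply: mulr_ge0; [lra|have : be * ya <= ya; [rewrite ler_piMl; lra|lra]].
  lra.
have hm : (1 + et * de) * - xb <= (1 - de) * (2 + et).
  have e2 : 0 <= 1 + et by bound_lra.
  have := ler_wpM2l e2 (L2 _ _ k2); have := ler_wpM2l d1' (L4 _ _ k2); lra.
have hy : (1 - al * de) * (yc - 1) <= al.
  have := ler_wpM2l a0 (L2 _ _ k3); have := L1 _ _ k3; lra.
have hn : (1 + et * de) * (- yd - 1) <= et * (1 - 2 * de).
  have := ler_wpM2l (ltW e0) (L2 _ _ k4); have := L4 _ _ k4; lra.
have hf : (1 - al * de) * (yf - xf) <= 1.
  have := ler_wpM2l (ltW d0) (L1 _ _ k6); have := L2 _ _ k6; lra.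
have he : (1 + et) * (xe - ye) <= 2.
  have [y0|y0] := lerP ye 0.
    have : 0 <= be * - ye by apply: mulr_ge0; bound_lra.
    have := L0 _ _ k5; have := L4 _ _ k5; lra.
  have : 0 <= (1 - be) * ye by apply: mulr_ge0; bound_lra.
  have l0 := L0 _ _ k5 => l.
  have e' : 0 <= 1 + et by bound_lra.
  have e'' : xe - ye <= 1 by lra.
  have := ler_wpM2l e' e''; lra.
have k3' : 2 * et <= (al * de) * (1 + 3 * et).
  have e : 3 - (xe - ye) <= yf - xf by lra.
  have e' : 0 <= 1 - al * de by lra.
  have e'' : 0 <= 1 + et by bound_lra.
  have := ler_wpM2l e'' (le_trans (ler_wpM2l e' e) hf).
  have := ler_wpM2l e' he; lra.
have k1' : al * (1 + et * de) <= (1 + et) * (1 - 2 * de).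
  have e : 1 + al <= - xb by lra.
  have e' : 0 <= 1 + et * de by lra.
  have := ler_wpM2l e' e; lra.
have k2' : (1 - al * de) * (1 + et * de) <= al * (1 + et * de) + et * (1 - 2 * de) * (1 - al * de).
  have e : 1 <= (yc - 1) + (- yd - 1) by lra.
  have e' : 0 <= 1 + et * de by lra.
  have e'' : 0 <= 1 - al * de by lra.
  have := ler_wpM2l (mulr_ge0 e' e'') e.
  have := ler_wpM2l e' hy; have := ler_wpM2l e'' hn; lra.
have k4' : de <= 2 * et * (1 - 2 * de).
  have : 0 <= (1 - 2 * de) * (et * (al * de)) by do !apply: mulr_ge0; bound_lra.
  have : 0 <= (1 - al * de) * (et * de) by apply: mulr_ge0; bound_lra.
  lra.
have k5' : et * (2 - 3 * de) <= de.
  have : 0 <= (de - al * de) * (1 + 3 * et) by apply: mulr_ge0; bound_lra.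
  lra.
clear -k4' k5' d0 d1 e0.
(* The two remaining inequalities read et (2 - 3 de) <= de <= et (2 - 4 de), impossible for positive
   [de] and [et]. *)
have e5 : 0 <= 2 * (1 - 2 * de) by lra.
have e6 : 0 <= 2 - 3 * de by lra.
have := ler_wpM2l e5 k5'; have := ler_wpM2l e6 k4'.
have : 0 < de * de by apply: mulr_gt0.
lra.
Qed.

Lemma right_le_vertex (R : realFieldType) (al be x y : R) : 0 <= al <= 1 -> 0 <= be <= 1 ->
  al * x + (1 - al) * y <= 1 -> x - be * y <= 1 -> x <= 2 - al /\ x <= 1 + be.
Proof.
move=> /andP[a0 a1] hb h1 h2.
have h3 : (1 - al) * y + (1 - (1 - al)) * x <= 1 by lra.
have ha : 0 <= 1 - al <= 1 by bound_lra.
have [] := @top_le_vertex _ (1 - al) be y x ha hb h3 h2; split; lra.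
Qed.

(** The tilt [d] at (-1,0) limits the depth of K to 2 (1 - d). The height then gives al >= 2 d and
    ga >= 2 d, hence K must extend at least 1 + 2 d to the left, but (1 - d + 2 d^2) (1 + 2 d) = 1 +
    d + 4 d^3 exceeds 1. *)
Lemma one_tilt (R : realFieldType) (K : R -> R -> Prop) (al be ga d ta : R) :
  wide3 K -> 0 <= al <= 1 -> 0 <= be <= 1 -> 0 <= ga <= 1 -> 0 < d <= 1 / 2 ->
  0 <= ta <= 1 ->
  below K al (1 - al) 1 -> below K 1 (- be) 1 -> below K (- ga) 1 1 ->
  below K (- (1 - d)) (- d) (1 - d) -> below K ta (-1) 1 -> False.
Proof.
move=> W ha hb hg /andP[d0 d1] /andP[t0 t1] L1 L0 L2 L3 L5.
have [xa [ya [xb [yb [k1 k2 h1]]]]] := wide3_x W.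
have [xc [yc [xd [yd [k3 k4 h2]]]]] := wide3_y W.
have [ya1 yg1] : yc <= 1 + al /\ yc <= 1 + ga.
  by apply: (@top_le_vertex _ al ga xc) => //; [exact: L1|have := L2 _ _ k3; lra].
have [xa1 _] : xa <= 2 - al /\ xa <= 1 + be.
  by apply: (@right_le_vertex _ al be xa ya) => //; [exact: L1|have := L0 _ _ k1; lra].
have hn : - yd <= 2 * (1 - d).
  have [x0|x0] := lerP 0 xd.
    have : 0 <= ta * xd by apply: mulr_ge0.
    have := L5 _ _ k4; lra.
  have l : - yd <= 1 - xd.
    have : 0 <= (1 - ta) * - xd by apply: mulr_ge0; bound_lra.
    have := L5 _ _ k4; lra.
  have d2 : 0 <= 1 - d by bound_lra.
  have := ler_wpM2l d2 l; have := L3 _ _ k4; lra.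
have hm : (1 - d + d * ga) * - xb <= 1.
  have := ler_wpM2l (ltW d0) (L2 _ _ k2); have := L3 _ _ k2; lra.
have m1 : 1 + 2 * d <= - xb by lra.
have g1 : 2 * d <= ga by lra.
have dg := ler_wpM2l (ltW d0) g1.
have dd := mulr_ge0 (ltW d0) (ltW d0).
have e : 0 <= 1 - d + d * ga by lra.
have k := le_trans (ler_wpM2l e m1) hm.
have d2 : 0 <= 1 + 2 * d by lra.
have := ler_wpM2l d2 dg.
have : 0 < d * (d * d) by do !apply: mulr_gt0.
lra.
Qed.

(** A sharp case: the extents 1 + be, 2 - ga along x and 1 + ga, 2 - be along y add up to 6, so all
    bounds are attained. This forces be = ga = 0 and d = 1/2, the lines of the triangle with
    vertices (1,1), (-2,1), (1,-2). *)
Lemma two_tilts (R : realFieldType) (K : R -> R -> Prop) (al be ga d d' : R) :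
  wide3 K -> 0 <= al <= 1 -> 0 <= be <= 1 -> 0 <= ga <= 1 -> 0 < d <= 1 / 2 ->
  0 < d' <= 1 / 2 ->
  below K al (1 - al) 1 -> below K 1 (- be) 1 -> below K (- ga) 1 1 ->
  below K (- (1 - d)) (- d) (1 - d) -> below K (- d') (- (1 - d')) (1 - d') ->
  K 1 (-2).
Proof.
move=> W ha hb hg /andP[d0 d1] /andP[t0 t1] L1 L0 L2 L3 L5.
have [/andP[a0 a1] /andP[b0 b1] /andP[g0 g1]] := And3 ha hb hg.
have [xa [ya [xb [yb [k1 k2 h1]]]]] := wide3_x W.
have [xc [yc [xd [yd [k3 k4 h2]]]]] := wide3_y W.
have [ya1 yg1] : yc <= 1 + al /\ yc <= 1 + ga.
  by apply: (@top_le_vertex _ al ga xc) => //; [exact: L1|have := L2 _ _ k3; lra].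
have [xa1 xb1] : xa <= 2 - al /\ xa <= 1 + be.
  by apply: (@right_le_vertex _ al be xa ya) => //; [exact: L1|have := L0 _ _ k1; lra].
(* For t <= 1/2 the bound 1 / (1 - t + t g) is largest at t = 1/2, where it equals 2 / (1 + g) <= 2
   - g. *)
have aux (t g m : R) : 0 <= g <= 1 -> 0 < t <= 1 / 2 -> (1 - t + t * g) * m <= 1 -> m <= 2 - g.
  move=> /andP[gg0 gg1] /andP[tt0 tt1] h; rewrite leNgt; apply/negP => hm.
  have tg0 : 0 <= t * g by apply: mulr_ge0; bound_lra.
  have e : 0 < 1 - t + t * g by lra.
  have e2 : (1 - t + t * g) * (2 - g) < (1 - t + t * g) * m by rewrite ltr_pM2l.
  have : 0 <= (1 - g) * (1 - 2 * t + t * g) by apply: mulr_ge0; bound_lra.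
  lra.
have hm : (1 - d + d * ga) * - xb <= 1.
  have := ler_wpM2l (ltW d0) (L2 _ _ k2); have := L3 _ _ k2; lra.
have hn : (1 - d' + d' * be) * - yd <= 1.
  have := ler_wpM2l (ltW t0) (L0 _ _ k4); have := L5 _ _ k4; lra.
have dh : 0 < d <= 1 / 2 by rewrite d0.
have th : 0 < d' <= 1 / 2 by rewrite t0.
have m2 := aux d ga _ hg dh hm; have n2 := aux d' be _ hb th hn.
have bg : be = ga by lra.
have xaE : xa = 1 + be by lra.
have be0 : be = 0.
  apply/eqP; rewrite eq_le b0 andbT leNgt; apply/negP => bp.
  have y1 : 1 <= ya.
    rewrite -subr_ge0 -(pmulr_rge0 _ bp); have := L0 _ _ k1; lra.
  have : 0 <= (1 - al) * (ya - 1) by apply: mulr_ge0; bound_lra.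
  have : 0 < al * be by apply: mulr_gt0; bound_lra.
  have := L1 _ _ k1; rewrite xaE; lra.
have dE : d = 1 / 2 by move: hm; rewrite -bg be0 => hm; have : (1 - d) * 2 <= (1 - d) * - xb; [apply: ler_wpM2l|]; lra.
have ydE : yd = -2 by lra.
have x1 : xd = 1.
  have := L3 _ _ k4; have := L0 _ _ k4; rewrite dE be0 ydE; lra.
by rewrite -ydE -x1.
Qed.

(** The other sharp case, with lines at all six points. The extents 2 - al, 2 - th along x and 1 +
    al, 1 + th along y add up to 6, so they are attained, and the width along x - y then forces ga =
    al and be = 1 - al. For 0 < al < 1 the highest point would lie beyond the line at (1,1); the
    values al = 0 and al = 1 give the two vertices of the conclusion. *)
Lemma no_tilt (R : realFieldType) (K : R -> R -> Prop) (al be ga si ta th : R) :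
  wide3 K -> 0 <= al <= 1 -> 0 <= be <= 1 -> 0 <= ga <= 1 -> 0 <= si <= 1 ->
  0 <= ta <= 1 -> 0 <= th <= 1 ->
  below K al (1 - al) 1 -> below K 1 (- be) 1 -> below K (- ga) 1 1 ->
  below K (-1) si 1 -> below K ta (-1) 1 -> below K (- th) (- (1 - th)) 1 ->
  K 2 1 \/ K 1 2.
Proof.
move=> W ha hb hg hs ht hth L1 L0 L2 L3 L5 L4.
have [/andP[a0 a1] /andP[b0 b1] /andP[g0 g1]] := And3 ha hb hg.
have [xa [ya [xb [yb [k1 k2 h1]]]]] := wide3_x W.
have [xc [yc [xd [yd [k3 k4 h2]]]]] := wide3_y W.
have [xe [ye [xf [yf [k5 k6 h3]]]]] := wide3_diff W.
have [p1 p2] : yc <= 1 + al /\ yc <= 1 + ga.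
  by apply: (@top_le_vertex _ al ga xc) => //; [exact: L1|have := L2 _ _ k3; lra].
have [p3 p4] : xa <= 2 - al /\ xa <= 1 + be.
  by apply: (@right_le_vertex _ al be xa ya) => //; [exact: L1|have := L0 _ _ k1; lra].
have [p5 p6] : yf - xf <= 2 - si /\ yf - xf <= 2 - ga.
  by apply: (@diag_le_vertex _ si ga xf) => //; [have := L3 _ _ k6; lra|have := L2 _ _ k6; lra].
have [p7 p8] : - yd <= 1 + th /\ - yd <= 1 + ta.
  by apply: (@top_le_vertex _ th ta (- xd)) => //; [have := L4 _ _ k4; lra|have := L5 _ _ k4; lra].
have [p9 p10] : - xb <= 2 - th /\ - xb <= 1 + si.
  by apply: (@right_le_vertex _ th si (- xb) (- yb)) => //; [have := L4 _ _ k2; lra|have := L3 _ _ k2; lra].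
have [p11 p12] : - ye - - xe <= 2 - be /\ - ye - - xe <= 2 - ta.
  by apply: (@diag_le_vertex _ be ta (- xe)) => //; [have := L0 _ _ k5; lra|have := L5 _ _ k5; lra].
have ycE : yc = 1 + al by lra.
have xaE : xa = 2 - al by lra.
have gaE : ga = al by lra.
have beE : be = 1 - al by lra.
clear p1 p2 p3 p4 p5 p6 p7 p8 p9 p10 p11 p12 h1 h2 h3.
have l3 := L1 _ _ k3; have l3' := L2 _ _ k3; have l1 := L1 _ _ k1; have l1' := L0 _ _ k1.
have [aE|an] := eqVneq al 0.
  left; have yE : ya = 1 by move: l1 l1'; rewrite beE xaE aE; lra.
  by move: k1; rewrite yE xaE aE subr0.
have ap : 0 < al by rewrite lt_def an.
have xc1 : 1 <= xc.
  rewrite -subr_ge0 -(pmulr_rge0 _ ap); move: l3'; rewrite ycE gaE; lra.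
have aE : al = 1.
  apply/eqP; rewrite eq_le a1 /= leNgt; apply/negP => a1'.
  have : 0 <= al * (xc - 1) by apply: mulr_ge0; bound_lra.
  have : 0 < (1 - al) * al by apply: mulr_gt0; bound_lra.
  move: l3; rewrite ycE; lra.
right; have xE : xc = 1 by move: l3; rewrite aE; lra.
by move: k3; rewrite ycE xE aE.
Qed.

(** The extents to the right and left are at most (1 + q4 + q0) / (1 + q4 + q0 q4) and (2 + q4) / (1
    + q2 + q2 q4). Having the largest tilt at (0,1) makes the single direction x sufficient. *)
Lemma cyclic_tilts (R : realFieldType) (K : R -> R -> Prop) (q0 q2 q4 : R) :
  wide3 K -> 0 < q0 <= q2 -> 0 < q4 <= q2 -> q2 <= 1 ->
  below K 1 q0 1 -> below K (- (1 + q2)) 1 1 -> below K q4 (- (1 + q4)) 1 -> False.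
Proof.
move=> W /andP[q00 q02] /andP[q40 q42] q21 L0 L2 L4.
have [xa [ya [xb [yb [k1 k2 h1]]]]] := wide3_x W.
have e1 : 0 <= 1 + q4 by bound_lra.
have hM : (1 + q4 + q0 * q4) * xa <= 1 + q4 + q0.
  have := ler_wpM2l e1 (L0 _ _ k1); have := ler_wpM2l (ltW q00) (L4 _ _ k1); lra.
have hm : (1 + q2 + q2 * q4) * - xb <= 2 + q4.
  have := ler_wpM2l e1 (L2 _ _ k2); have := L4 _ _ k2; lra.
have p04 : 0 < q0 * q4 by apply: mulr_gt0.
have p24 : 0 < q2 * q4 by apply: mulr_gt0; bound_lra.
have D0 : 0 <= 1 + q4 + q0 * q4 by lra.
have E0 : 0 <= 1 + q2 + q2 * q4 by lra.
have k := ler_wpM2l (mulr_ge0 D0 E0) (_ : 3 <= xa + - xb).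
have {}k := k ltac:(lra).
have k1' := ler_wpM2l E0 hM; have k2' := ler_wpM2l D0 hm.
have key : 0 <= (q0 + q4 - 2 * q2) + q0 * q2 - q0 * q4 + q4 ^+ 2 - 4 * (q2 * q4)
   + q0 * q4 ^+ 2 - 2 * (q0 * (q2 * q4)) - 2 * (q2 * q4 ^+ 2) - 3 * (q0 * (q2 * q4 ^+ 2)) by lra.
have m1 : 0 <= (1 - q0) * (q2 - q4) by apply: mulr_ge0; bound_lra.
have m2 : 0 <= q4 * (q2 - q4) by apply: mulr_ge0; bound_lra.
have m3 : 0 <= q0 * (q4 * (q2 - q4)) by apply: mulr_ge0; bound_lra.
have m4 : 0 <= q2 * q4 ^+ 2 by apply: mulr_ge0; rewrite ?sqr_ge0; lra.
have m5 : 0 <= q0 * (q2 * q4 ^+ 2) by apply: mulr_ge0; bound_lra.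
have m6 : 0 <= q0 * (q2 * q4) by apply: mulr_ge0; bound_lra.
lra.
Qed.

(** The four lines turn in the same sense. By [aux], the extents to the right and upwards add up to
    less than 3, and so do those to the left and downwards; hence the widths along x and y add up to
    less than 6. *)
Lemma pinwheel (R : realFieldType) (K : R -> R -> Prop) (p q p' q' : R) :
  wide3 K -> 0 < p <= 1 -> 0 < q <= 1 -> 0 < p' <= 1 -> 0 < q' <= 1 ->
  below K 1 q 1 -> below K (- p) 1 1 -> below K (-1) (- q') 1 -> below K p' (-1) 1 -> False.
Proof.
move=> W hp hq hp' hq' La Lb Lc Ld.
have aux (r s u v : R) : 0 < r <= 1 -> 0 < s <= 1 -> u < 1 + s -> (1 + r * s) * v <= 1 + r -> u + v < 3.
  move=> /andP[r0 r1] /andP[s0 s1] hu hv.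
  have rs : 0 < r * s by apply: mulr_gt0.
  have rs' : 0 <= r * (1 - s) by apply: mulr_ge0; bound_lra.
  have : 0 <= (1 - s) * (1 - r * (1 - s)) by apply: mulr_ge0; bound_lra.
  have : v <= 2 - s.
    rewrite leNgt; apply/negP => hv'.
    have : (1 + r * s) * (2 - s) < (1 + r * s) * v by rewrite ltr_pM2l; lra.
    have : 0 <= (1 - s) * (1 - r * (1 - s)) by apply: mulr_ge0; bound_lra.
    lra.
  lra.
have [xa [ya [xb [yb [k1 k2 h1]]]]] := wide3_x W.
have [xc [yc [xd [yd [k3 k4 h2]]]]] := wide3_y W.
have [/andP[p0 p1] /andP[q0 q1] /andP[p'0 p'1] /andP[q'0 q'1]] := And4 hp hq hp' hq'.
have aux2 (r s t : R) : 0 < r -> 0 < s -> (1 + r * s) * t <= 1 + r -> t < 1 + r.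
  move=> r0 s0 h; rewrite ltNge; apply/negP => ht.
  have rs : 0 < r * s by apply: mulr_gt0.
  have e : 0 <= 1 + r * s by lra.
  have := ler_wpM2l e ht.
  have : 0 < r * s * r by apply: mulr_gt0.
  lra.
have M1 : xa < 1 + q.
  apply: (aux2 q p') => //.
  have := ler_wpM2l (ltW q0) (Ld _ _ k1); have := La _ _ k1; lra.
have M2 : (1 + p * q) * yc <= 1 + p.
  have := ler_wpM2l (ltW p0) (La _ _ k3); have := Lb _ _ k3; lra.
have M4 : - xb < 1 + q'.
  apply: (aux2 q' p) => //.
  have := ler_wpM2l (ltW q'0) (Lb _ _ k2); have := Lc _ _ k2; lra.
have M5 : (1 + p' * q') * - yd <= 1 + p'.
  have := ler_wpM2l (ltW p'0) (Lc _ _ k4); have := Ld _ _ k4; lra.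
have := aux p q _ _ hp hq M1 M2; have := aux p' q' _ _ hp' hq' M4 M5; lra.
Qed.

(** The triangle reaches up to (1 + t) / (1 + t s) <= 2 / (1 + s) and down to 2 A / (1 - A s) < 2 /
    (2 - s), and 2 / (1 + s) + 2 / (2 - s) <= 3 for s in [0, 1]. *)
Lemma low_triangle (R : realFieldType) (K : R -> R -> Prop) (A s t : R) :
  wide3 K -> 0 <= A < 1 / 2 -> 0 < s <= 1 -> 0 < t <= 1 ->
  below K A (-1) A -> below K (-1) s 1 -> below K t 1 1 -> False.
Proof.
move=> W /andP[A0 A1] /andP[s0 s1] /andP[t0 t1] La Lc Lb.
have [xc [yc [xd [yd [k3 k4 h2]]]]] := wide3_y W.
have As : 0 <= A * s by apply: mulr_ge0 => //; lra.
have As' : 0 <= A * (1 - s) by apply: mulr_ge0 => //; lra.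
have ts : 0 < t * s by apply: mulr_gt0.
have hn : (1 - A * s) * - yd <= 2 * A.
  have := ler_wpM2l A0 (Lc _ _ k4); have := La _ _ k4; lra.
have hc : (1 + t * s) * yc <= 1 + t.
  have := ler_wpM2l (ltW t0) (Lc _ _ k3); have := Lb _ _ k3; lra.
have yc2 : (1 + s) * yc <= 2.
  have e : 0 <= 1 + s by bound_lra.
  have := ler_wpM2l e hc.
  have : 0 <= (1 - t) * (1 - s) by apply: mulr_ge0; bound_lra.
  have p : 0 < 1 + t * s by lra.
  move=> ? ?; rewrite -(ler_pM2l p); lra.
have p1 : 0 < 1 + s by bound_lra.
have p2 : 0 <= 1 - A * s by lra.
have e1 : 3 * s + 1 <= (1 + s) * - yd.
  have := ler_wpM2l (ltW p1) (_ : 3 - yc <= - yd); lra.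
have e2 := ler_wpM2l p2 e1; have e3 := ler_wpM2l (ltW p1) hn.
have : 0 <= A * (1 - s) * s by apply: mulr_ge0; bound_lra.
have : 0 < (1 - 2 * A) by lra.
have : 0 <= (1 - 2 * A) * s by apply: mulr_ge0; bound_lra.
lra.
Qed.

(** * Supporting lines *)

Definition convex2 (R : realFieldType) (K : R -> R -> Prop) : Prop :=
  forall x1 y1 x2 y2 t, K x1 y1 -> K x2 y2 -> 0 <= t <= 1 ->
  K ((1 - t) * x1 + t * x2) ((1 - t) * y1 + t * y2).

Definition supports (R : realFieldType) (K : R -> R -> Prop) (p q x y : R) : Prop :=
  ((p != 0) || (q != 0)) /\ below K p q (p * x + q * y).

(* For convex K this says that (x, y) is not interior to K, see [not_separated_box]. *)
Definition separated (R : realFieldType) (K : R -> R -> Prop) (x y : R) : Prop :=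
  exists p q, supports K p q x y.

Definition bounded2 (R : realFieldType) (K : R -> R -> Prop) (N : nat) : Prop :=
  forall x y, K x y -> `|x| <= N%:R /\ `|y| <= N%:R.

Lemma not_separatedP (R : realFieldType) (K : R -> R -> Prop) (x y p q : R) :
  ~ separated K x y -> (p != 0) || (q != 0) ->
  exists x' y', K x' y' /\ p * x + q * y < p * x' + q * y'.
Proof.
move=> ns pq; apply: contrapT => h; apply: ns; exists p, q; split=> // x' y' k.
by rewrite leNgt; apply/negP => lt; apply: h; exists x', y'.
Qed.

(** A planar Hahn-Banach argument. If K misses the ray, the inverse slopes seen from (x0, y0) are
    never larger above the horizontal line than below it, since a segment violating this would cross
    the ray ([cross]). The supremum of the inverse slopes above is then the slope of a separating
    line. *)
Lemma ray_meets (R : realType) (K : R -> R -> Prop) (x0 y0 : R) :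
  convex2 K -> ~ separated K x0 y0 -> exists2 t, 0 < t & K (x0 + t) y0.
Proof.
move=> cK ns; apply: contrapT => h.
have noray x : K x y0 -> x <= x0.
  move=> k; rewrite leNgt; apply/negP => lt; apply: h; exists (x - x0); first by rewrite subr_gt0.
  by rewrite addrC subrK.
have cross x2 y2 x3 y3 : K x2 y2 -> K x3 y3 -> y0 < y2 -> y3 < y0 ->
    (x2 - x0) / (y2 - y0) <= (x3 - x0) / (y3 - y0).
  move=> k2 k3 h2 h3.
  have d : 0 < y2 - y3 by lra.
  pose t := (y2 - y0) / (y2 - y3).
  have t01 : 0 <= t <= 1 by rewrite divr_ge0 /= ?ler_pdivrMr; lra.
  have := cK _ _ _ _ t k2 k3 t01.
  have -> : (1 - t) * y2 + t * y3 = y0 by rewrite /t; field; lra.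
  move=> /noray.
  have -> : (1 - t) * x2 + t * x3 = ((y0 - y3) * x2 + (y2 - y0) * x3) / (y2 - y3).
    by rewrite /t; field; lra.
  rewrite ler_pdivrMr // => k.
  rewrite ler_pdivrMr ?subr_gt0 // mulrAC ler_ndivlMr ?subr_lt0 //; lra.
have [x2 [y2 [k2 h2]]] := not_separatedP (p := 0) (q := 1) ns ltac:(by rewrite oner_eq0 orbT).
have [x3 [y3 [k3 h3]]] := not_separatedP (p := 0) (q := -1) ns ltac:(by rewrite oppr_eq0 oner_eq0 orbT).
have {}h2 : y0 < y2 by lra.
have {}h3 : y3 < y0 by lra.
pose S := [set r : R | exists x y, [/\ K x y, y0 < y & r = (x - x0) / (y - y0)]].
have S0 : S !=set0 by exists ((x2 - x0) / (y2 - y0)), x2, y2.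
have ub : has_ubound S.
  by exists ((x3 - x0) / (y3 - y0)) => _ [x [y [k yy ->]]]; exact: cross.
apply: ns; exists 1, (- sup S); split; first by rewrite oner_eq0.
move=> x y k; rewrite !mul1r.
suff : (x - x0) <= sup S * (y - y0) by lra.
have [yy|yy|yy] := ltrgtP y0 y.
- rewrite -ler_pdivrMr ?subr_gt0 //; apply: ub_le_sup => //.
  by exists x, y.
- rewrite mulrC -ler_ndivlMl ?subr_lt0 //; apply: ge_sup => // _ [x' [y' [k' yy' ->]]].
  by rewrite [_^-1 * _]mulrC; exact: cross.
- by move: k; rewrite -yy => /noray; lra.
Qed.

Lemma not_separated_box (R : realType) (K : R -> R -> Prop) (x0 y0 : R) :
  convex2 K -> ~ separated K x0 y0 ->
  exists2 e, 0 < e & forall x y, `|x - x0| <= e -> `|y - y0| <= e -> K x y.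
Proof.
move=> cK ns.
have [t1 p1 k1] := ray_meets cK ns.
have [t2 p2 k2] : exists2 t, 0 < t & K (x0 - t) y0.
  have [||t t0 k] := @ray_meets R (fun x y => K (- x) y) (- x0) y0.
  - move=> a b c d t ha hb ht; have := cK _ _ _ _ t ha hb ht.
    by congr K; ring.
  - move=> [p [q [pq hs]]]; apply: ns; exists (- p), q; split; first by rewrite oppr_eq0.
    by move=> x y k; have := hs (- x) y; rewrite opprK => /(_ k); lra.
  - by exists t => //; move: k; rewrite opprD opprK.
have [t3 p3 k3] : exists2 t, 0 < t & K x0 (y0 + t).
  have [||t t0 k] := @ray_meets R (fun x y => K y x) y0 x0.
  - by move=> a b c d t ha hb ht; exact: cK.
  - move=> [p [q [pq hs]]]; apply: ns; exists q, p; split; first by rewrite orbC.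
    by move=> x y k; have := hs y x k; lra.
  - by exists t.
have [t4 p4 k4] : exists2 t, 0 < t & K x0 (y0 - t).
  have [||t t0 k] := @ray_meets R (fun x y => K y (- x)) (- y0) x0.
  - move=> a b c d t ha hb ht; have := cK _ _ _ _ t ha hb ht.
    by congr K; ring.
  - move=> [p [q [pq hs]]]; apply: ns; exists q, (- p); split; first by rewrite oppr_eq0 orbC.
    by move=> x y k; have := hs (- y) x; rewrite opprK => /(_ k); lra.
  - by exists t => //; move: k; rewrite opprD opprK.
pose m := Num.min (Num.min t1 t2) (Num.min t3 t4).
have m0 : 0 < m by rewrite !lt_min p1 p2 p3 p4.
have [[m1 m2] [m3 m4]] : (m <= t1 /\ m <= t2) /\ (m <= t3 /\ m <= t4).
  by rewrite /m !ge_min !lexx ?orbT.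
exists (m / 2) => [|x y]; first by rewrite divr_gt0.
rewrite !ler_norml => /andP[a1 a2] /andP[b1 b2].
(* (x, y) is the midpoint of (x0 + a, y0) and (x0, y0 + b), which lie on the cross of arm length [m]
   contained in K; hence the radius m / 2. *)
pose a := 2 * (x - x0); pose b := 2 * (y - y0).
have ka : K (x0 + a) y0.
  pose t := (t1 - a) / (t1 + t2).
  have t01 : 0 <= t <= 1 by rewrite divr_ge0 /= ?ler_pdivrMr /a; lra.
  have := cK _ _ _ _ t k1 k2 t01.
  by congr K; rewrite /t /a; field; lra.
have kb : K x0 (y0 + b).
  pose t := (t3 - b) / (t3 + t4).
  have t01 : 0 <= t <= 1 by rewrite divr_ge0 /= ?ler_pdivrMr /b; lra.
  have := cK _ _ _ _ t k3 k4 t01.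
  by congr K; rewrite /t /b; field; lra.
have := cK _ _ _ _ (1 / 2) ka kb ltac:(lra).
by congr K; rewrite /a /b; field.
Qed.

Lemma separated_out (R : realType) (K : R -> R -> Prop) (x y : R) :
  convex2 K -> ~ K x y -> separated K x y.
Proof.
move=> cK nK; apply: contrapT => /(not_separated_box cK) [e e0 h].
by apply: nK; apply: h; rewrite subrr normr0 ltW.
Qed.

(** * Cones over a convex set *)

(* The convex hull of K and (a, b), for K convex and nonempty. *)
Definition cone1 (R : realFieldType) (K : R -> R -> Prop) (a b x y : R) : Prop :=
  exists x0 y0 t, [/\ K x0 y0, 0 <= t <= 1, x = (1 - t) * x0 + t * a
    & y = (1 - t) * y0 + t * b].

Lemma sub_cone1 (R : realFieldType) (K : R -> R -> Prop) (a b x y : R) :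
  K x y -> cone1 K a b x y.
Proof. by move=> k; exists x, y, 0; split=> //; rewrite ?lexx ?ler01 //; ring. Qed.

Lemma cone1_apex (R : realFieldType) (K : R -> R -> Prop) (a b x y : R) :
  K x y -> cone1 K a b a b.
Proof. by move=> k; exists x, y, 1; split=> //; rewrite ?lexx ?ler01 //; ring. Qed.

Lemma cone1_min (R : realFieldType) (K C : R -> R -> Prop) (a b x y : R) :
  convex2 C -> (forall x y, K x y -> C x y) -> C a b -> cone1 K a b x y -> C x y.
Proof. by move=> cC sub cab [x0 [y0 [t [k t01 -> ->]]]]; apply: cC => //; exact: sub. Qed.

Lemma convex2_cone1 (R : realFieldType) (K : R -> R -> Prop) (a b : R) :
  convex2 K -> convex2 (cone1 K a b).
Proof.
move=> cK x1 y1 x2 y2 s [u1 [v1 [t1 [k1 /andP[a1 b1] -> ->]]]] [u2 [v2 [t2 [k2 /andP[a2 b2] -> ->]]]].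
move=> /andP[s0 s1].
pose T := (1 - s) * t1 + s * t2.
have m1 : 0 <= (1 - s) * t1 by apply: mulr_ge0; bound_lra.
have m2 : 0 <= s * t2 by apply: mulr_ge0; bound_lra.
have m3 : 0 <= (1 - s) * (1 - t1) by apply: mulr_ge0; bound_lra.
have m4 : 0 <= s * (1 - t2) by apply: mulr_ge0; bound_lra.
have T0 : 0 <= T by rewrite /T; lra.
have T1 : T <= 1 by rewrite /T; lra.
have [e|ne] := eqVneq T 1.
  exists u1, v1, 1; rewrite ler01 lexx; split=> //.
    rewrite subrr mul0r add0r mul1r.
    have -> : (1 - s) * ((1 - t1) * u1 + t1 * a) + s * ((1 - t2) * u2 + t2 * a)
      = ((1 - s) * (1 - t1)) * u1 + (s * (1 - t2)) * u2 + T * a by rewrite /T; ring.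
    have -> : (1 - s) * (1 - t1) = 0 by move: e; rewrite /T; lra.
    have -> : s * (1 - t2) = 0 by move: e; rewrite /T; lra.
    by rewrite e; ring.
  rewrite subrr mul0r add0r mul1r.
  have -> : (1 - s) * ((1 - t1) * v1 + t1 * b) + s * ((1 - t2) * v2 + t2 * b)
    = ((1 - s) * (1 - t1)) * v1 + (s * (1 - t2)) * v2 + T * b by rewrite /T; ring.
  have -> : (1 - s) * (1 - t1) = 0 by move: e; rewrite /T; lra.
  have -> : s * (1 - t2) = 0 by move: e; rewrite /T; lra.
  by rewrite e; ring.
have d : 0 < 1 - T by rewrite subr_gt0 lt_neqAle ne.
pose r := s * (1 - t2) / (1 - T).
have r01 : 0 <= r <= 1.
  by rewrite /r divr_ge0 ?(ltW d) //= ler_pdivrMr // /T; lra.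
exists ((1 - r) * u1 + r * u2), ((1 - r) * v1 + r * v2), T; split.
- exact: cK.
- by rewrite T0.
- by rewrite /r /T; field; rewrite /T in d; lra.
- by rewrite /r /T; field; rewrite /T in d; lra.
Qed.

(** Substituting one membership into the other writes (a, b) as a combination in which (a, b) itself
    has weight s t. If s t < 1, solving for (a, b) puts it in K. This makes the descent on cones
    strict in [extend_separated]. *)
Lemma cone1_antisym (R : realFieldType) (K : R -> R -> Prop) (a b c d : R) :
  convex2 K -> ~ K a b -> cone1 K a b c d -> cone1 K c d a b -> c = a /\ d = b.
Proof.
move=> cK nK [x0 [y0 [t [k /andP[t0 t1] -> ->]]]] [x1 [y1 [s [k' /andP[s0 s1] ea eb]]]].
have [e|ne] := eqVneq (s * t) 1.
  have tt : t = 1.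
    have : 0 <= t * (1 - s) by apply: mulr_ge0; bound_lra.
    by lra.
  by rewrite tt; split; ring.
exfalso; apply: nK.
have st : s * t <= 1.
  have : 0 <= t * (1 - s) by apply: mulr_ge0; bound_lra.
  by lra.
have dd : 0 < 1 - s * t by rewrite subr_gt0 lt_neqAle ne.
pose r := s * (1 - t) / (1 - s * t).
have m : 0 <= s * (1 - t) by apply: mulr_ge0; bound_lra.
have r01 : 0 <= r <= 1 by rewrite /r divr_ge0 ?(ltW dd) //= ler_pdivrMr //; lra.
have := cK _ _ _ _ r k' k r01; congr K.
- suff : ((1 - r) * x1 + r * x0) * (1 - s * t) = a * (1 - s * t) by move/(mulIf (lt0r_neq0 dd)).
  have -> : ((1 - r) * x1 + r * x0) * (1 - s * t) = (1 - s) * x1 + s * (1 - t) * x0.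
    by rewrite /r; field; lra.
  lra.
- suff : ((1 - r) * y1 + r * y0) * (1 - s * t) = b * (1 - s * t) by move/(mulIf (lt0r_neq0 dd)).
  have -> : ((1 - r) * y1 + r * y0) * (1 - s * t) = (1 - s) * y1 + s * (1 - t) * y0.
    by rewrite /r; field; lra.
  lra.
Qed.

Lemma convex2_triangle (R : realFieldType) (K : R -> R -> Prop) (o1 o2 e1 e2 f1 f2 l m : R) :
  convex2 K -> K o1 o2 -> K (o1 + 3 * e1) (o2 + 3 * e2) -> K (o1 + 3 * f1) (o2 + 3 * f2) ->
  0 <= l -> 0 <= m -> l + m <= 3 -> K (o1 + l * e1 + m * f1) (o2 + l * e2 + m * f2).
Proof.
move=> cK vO vE vF l0 m0 lm.
have [s0|s0] := eqVneq (l + m) 0.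
  have -> : l = 0 by lra.
  by have -> : m = 0 by [lra]; rewrite !mul0r !addr0.
have sp : 0 < l + m by rewrite lt_def s0 /=; lra.
have t1 : 0 <= m / (l + m) <= 1 by rewrite divr_ge0 ?ler_pdivrMr; lra.
have t2 : 0 <= (l + m) / 3 <= 1 by lra.
have := cK _ _ _ _ _ vO (cK _ _ _ _ _ vE vF t1) t2.
by congr K; field.
Qed.

(** * Adjoining lattice points *)

(** The invariant of all enlargements and changes of basis. Boundedness keeps finite the counts of
    lattice points on which the inductions run. *)
Definition good (R : realFieldType) (K : R -> R -> Prop) : Prop :=
  [/\ convex2 K, exists N, bounded2 K N, wide3 K, K 0 0 &
    forall i j : int, (i != 0) || (j != 0) -> separated K i%:~R j%:~R].

(** The 2 N + 1 indices, shifted by N, enumerate the integers from -N to N. *)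
Definition count_in (N : nat) (P : int -> int -> Prop) : nat :=
  #|[pred p : 'I_(N.*2.+1) * 'I_(N.*2.+1) | `[< P (p.1%:Z - N%:Z) (p.2%:Z - N%:Z) >]]|.

Lemma ltn_count_in (N : nat) (P Q : int -> int -> Prop) (i j : int) :
  (forall i j, P i j -> Q i j) -> Q i j -> ~ P i j -> `|i| <= N%:Z -> `|j| <= N%:Z ->
  (count_in N P < count_in N Q)%N.
Proof.
move=> PQ q nP hi hj; apply: proper_card; apply/fintype.properP; split.
  by apply/fintype.subsetP => p; rewrite !inE => /asboolP pp; apply/asboolP; exact: PQ.
have bi : (absz (i + N%:Z)%R < N.*2.+1)%N by lia.
have bj : (absz (j + N%:Z)%R < N.*2.+1)%N by lia.
have ei : (Ordinal bi)%:Z - N%:Z = i by rewrite /=; lia.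
have ej : (Ordinal bj)%:Z - N%:Z = j by rewrite /=; lia.
by exists (Ordinal bi, Ordinal bj); rewrite inE /= ei ej ?asboolE //; apply/asboolP.
Qed.

Lemma bounded2_int (R : realFieldType) (K : R -> R -> Prop) (N : nat) (i j : int) :
  bounded2 K N -> K i%:~R j%:~R -> `|i| <= N%:Z /\ `|j| <= N%:Z.
Proof.
by move=> b /b; rewrite -!intr_norm !pmulrn !ler_int.
Qed.

Lemma bounded2_le (R : realFieldType) (K : R -> R -> Prop) (N M : nat) :
  (N <= M)%N -> bounded2 K N -> bounded2 K M.
Proof.
rewrite -(ler_nat R) => NM b x y /b [hx hy].
by split; [exact: le_trans hx NM|exact: le_trans hy NM].
Qed.

Lemma bounded2_cone1 (R : realFieldType) (K : R -> R -> Prop) (N : nat) (i j : int) :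
  bounded2 K N -> `|i| <= N%:Z -> `|j| <= N%:Z -> bounded2 (cone1 K i%:~R j%:~R) N.
Proof.
move=> b hi hj x y; apply: (@cone1_min _ K (fun x y => `|x| <= N%:R /\ `|y| <= N%:R)).
- move=> x1 y1 x2 y2 t; rewrite !ler_norml.
  move=> [/andP[a1 a2] /andP[a3 a4]] [/andP[a5 a6] /andP[a7 a8]] /andP[t0 t1].
  have s0 : 0 <= 1 - t by lra.
  have := (ler_wpM2l s0 a1, ler_wpM2l s0 a2, ler_wpM2l s0 a3, ler_wpM2l s0 a4).
  have := (ler_wpM2l t0 a5, ler_wpM2l t0 a6, ler_wpM2l t0 a7, ler_wpM2l t0 a8).
  by move=> [[[? ?] ?] ?] [[[? ?] ?] ?]; split; apply/andP; split; lra.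
- exact: b.
- by rewrite -!intr_norm !pmulrn !ler_int.
Qed.

Lemma wide3_sub (R : realFieldType) (K K' : R -> R -> Prop) :
  (forall x y, K x y -> K' x y) -> wide3 K -> wide3 K'.
Proof.
move=> sub W u v uv; have [x1 [y1 [x2 [y2 [k1 k2 h]]]]] := W u v uv.
by exists x1, y1, x2, y2; split=> //; exact: sub.
Qed.

Lemma supports_cone1 (R : realFieldType) (K : R -> R -> Prop) (p q x y a b : R) :
  supports K p q x y -> p * a + q * b <= p * x + q * y -> supports (cone1 K a b) p q x y.
Proof.
move=> [pq h] hab; split=> // x' y' [x0 [y0 [t [k /andP[t0 t1] -> ->]]]].
have s0 : 0 <= 1 - t by lra.
have := ler_wpM2l s0 (h _ _ k); have := ler_wpM2l t0 hab; lra.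
Qed.

(* Take the point whose cone over K contains the fewest lattice points: a lattice
   point interior to that cone has a smaller cone. *)
Lemma extend_separated (R : realType) (K C : R -> R -> Prop) (N0 : nat) (x0 y0 : R)
    (D : int -> int -> Prop) (i j : int) :
  convex2 K -> bounded2 K N0 -> K x0 y0 -> convex2 C -> (forall x y, K x y -> C x y) ->
  C i%:~R j%:~R -> ~ K i%:~R j%:~R ->
  (forall k l, D k l -> K k%:~R l%:~R -> separated C k%:~R l%:~R) ->
  exists k l : int, [/\ C k%:~R l%:~R, ~ K k%:~R l%:~R &
    forall k' l', D k' l' -> separated (cone1 K k%:~R l%:~R) k'%:~R l'%:~R].
Proof.
move=> cK bN0 K0 cC KC Cij nKij sC.
have [N [bN hi hj]] : exists N : nat, [/\ bounded2 K N, `|i| <= N%:Z & `|j| <= N%:Z].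
  exists (N0 + absz i + absz j)%N; split; try lia.
  by apply: bounded2_le bN0; lia.
move: {2}(count_in N _).+1 (ltnSn (count_in N (fun k l => cone1 K i%:~R j%:~R k%:~R l%:~R))) => n.
elim: n i j Cij nKij hi hj => [//|n IH] i j Cij nKij hi hj; rewrite ltnS => le_n.
have [h|h] := pselect (forall k l, D k l -> separated (cone1 K i%:~R j%:~R) k%:~R l%:~R).
  by exists i, j.
have [k [l [kl nsep]]] : exists k l : int, D k l /\
    ~ separated (cone1 K i%:~R j%:~R) k%:~R l%:~R.
  apply: contrapT => h'; apply: h => k l kl; apply: contrapT => ns.
  by apply: h'; exists k, l.
have ckl : cone1 K i%:~R j%:~R k%:~R l%:~R.
  by apply: contrapT => /(separated_out (convex2_cone1 cK)).
have Ckl : C k%:~R l%:~R by exact: (cone1_min cC KC Cij ckl).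
have nKkl : ~ K k%:~R l%:~R.
  (* A lattice point of K is separated from [C], hence from the cone inside [C]; so the offending
     point is a new one. *)
  move=> Kkl; apply: nsep; have [p [q [pq h']]] := sC k l kl Kkl.
  by exists p, q; split=> // x y c; apply: h'; exact: (cone1_min cC KC Cij c).
have [hk hl] := bounded2_int (bounded2_cone1 bN hi hj) ckl.
apply: (IH k l) => //; apply: leq_trans le_n.
(* The cone over (k, l) lies in the cone over (i, j) and misses its apex by antisymmetry. The two
   apexes differ because (i, j), being outside K, has a line separating it from K, which also
   supports the cone at its apex. *)
apply: (@ltn_count_in _ _ _ i j) => //.
- move=> k' l'; apply: cone1_min => //; first exact: convex2_cone1.
  by move=> x y; exact: sub_cone1.
- exact: cone1_apex K0.
- move=> /(cone1_antisym cK nKij ckl) [ek el]; apply: nsep; rewrite ek el.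
  have [p [q s]] := separated_out cK nKij.
  by exists p, q; exact: supports_cone1.
Qed.

(** [C] is where the new point is looked for: large enough to contain some missing lattice point,
    small enough to keep the lattice points of K separated and to control where the new point
    lands. *)
Lemma extend_good (R : realType) (K C : R -> R -> Prop) (i j : int) :
  good K -> convex2 C -> (forall x y, K x y -> C x y) ->
  C i%:~R j%:~R -> ~ K i%:~R j%:~R ->
  (forall k l : int, (k != 0) || (l != 0) -> K k%:~R l%:~R ->
     separated C k%:~R l%:~R) ->
  exists k l : int, [/\ C k%:~R l%:~R, ~ K k%:~R l%:~R & good (cone1 K k%:~R l%:~R)].
Proof.
move=> [cK [N bN] W K0 sK] cC KC Cij nKij sC.
have [k [l [Ckl nKkl s]]] := extend_separated cK bN K0 cC KC Cij nKij sC.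
exists k, l; split=> //; split=> //.
- exact: convex2_cone1.
- exists (N + absz k + absz l)%N; apply: bounded2_cone1; try lia.
  by apply: bounded2_le bN; lia.
- by apply: wide3_sub W => x y; exact: sub_cone1.
- exact: sub_cone1.
Qed.

(* Adjoining (a, b) to K would make (x, y) an interior point. *)
Definition blocks (R : realFieldType) (K : R -> R -> Prop) (x y a b : R) : Prop :=
  forall p q, supports K p q x y -> p * x + q * y < p * a + q * b.

Definition saturated_at (R : realFieldType) (K : R -> R -> Prop) (i j : int) : Prop :=
  K i%:~R j%:~R \/ exists k l : int, [/\ (k != 0) || (l != 0), K k%:~R l%:~R &
    blocks K k%:~R l%:~R i%:~R j%:~R].

(** Induction on the number of lattice points missing from a box that contains both K and the
    window. The point adjoined lies in the cone over a point of the window, so the box is never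
    left. *)
Lemma saturate (R : realType) (K : R -> R -> Prop) (M : nat) : good K ->
  exists K' : R -> R -> Prop, [/\ good K', (forall x y, K x y -> K' x y) &
    forall i j : int, `|i| <= M%:Z -> `|j| <= M%:Z -> saturated_at K' i j].
Proof.
move=> gK.
have [N bN MN] : exists2 N : nat, bounded2 K N & (M <= N)%N.
  have [_ [N0 bN0] _ _ _] := gK; exists (N0 + M)%N; last by rewrite leq_addl.
  by apply: bounded2_le bN0; rewrite leq_addr.
move: {2}(count_in N _).+1 (ltnSn (count_in N (fun k l => ~ K k%:~R l%:~R))) => n.
elim: n K gK bN => [//|n IH] K gK bN; rewrite ltnS => le_n.
have [h|h] := pselect (forall i j : int, `|i| <= M%:Z -> `|j| <= M%:Z -> saturated_at K i j).
  by exists K.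
have [i [j [hi hj ns]]] : exists i j : int, [/\ `|i| <= M%:Z, `|j| <= M%:Z & ~ saturated_at K i j].
  apply: contrapT => h'; apply: h => i j hi hj; apply: contrapT => ns.
  by apply: h'; exists i, j.
have nK : ~ K i%:~R j%:~R by move=> k; apply: ns; left.
have [cK _ _ K0 _] := gK.
have hi' : `|i| <= N%:Z by lia.
have hj' : `|j| <= N%:Z by lia.
have [|||||k [l [Ckl nKkl g']]] := @extend_good R K (cone1 K i%:~R j%:~R) i j gK.
- exact: convex2_cone1.
- by move=> x y; exact: sub_cone1.
- exact: cone1_apex K0.
- exact: nK.
(* If (k, l) does not block (i, j), some supporting line at (k, l) keeps (i, j) on the side of K, so
   it supports the cone as well. *)
- move=> k l kl Kkl; apply: contrapT => nsep; apply: ns; right.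
  exists k, l; split=> // p q s; rewrite ltNge; apply/negP => le.
  by apply: nsep; exists p, q; exact: supports_cone1.
have [hk hl] := bounded2_int (bounded2_cone1 bN hi' hj') Ckl.
have [||K' [gK' sub sat]] := IH _ g'.
- exact: bounded2_cone1.
- apply: leq_trans le_n; apply: (@ltn_count_in _ _ _ k l) => //.
    by move=> a b h' k'; apply: h'; exact: sub_cone1.
  by apply; exact: cone1_apex K0.
- by exists K'; split=> // x y k0; apply: sub; exact: sub_cone1.
Qed.

(** * Unimodular changes of coordinates *)

(** The preimage of K under an integer matrix: the points (a, c) and (b, d) of K become (1,0) and
    (0,1). *)
Definition pull (R : realFieldType) (K : R -> R -> Prop) (a b c d : int) (x y : R) : Prop :=
  K (a%:~R * x + b%:~R * y) (c%:~R * x + d%:~R * y).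

Definition shift (R : realFieldType) (K : R -> R -> Prop) (i j : int) (x y : R) : Prop :=
  K (x + i%:~R) (y + j%:~R).

Lemma supports_pull (R : realFieldType) (K : R -> R -> Prop) (a b c d : int) (p q x y : R) :
  a * d - b * c = 1 \/ a * d - b * c = -1 ->
  supports K p q (a%:~R * x + b%:~R * y) (c%:~R * x + d%:~R * y) ->
  supports (pull K a b c d) (p * a%:~R + q * c%:~R) (p * b%:~R + q * d%:~R) x y.
Proof.
move=> det [pq h]; split; last by move=> x' y' /h; lra.
rewrite -negb_and; apply/negP => /andP[/eqP e1 /eqP e2].
have hd : (a * d - b * c)%:~R != 0 :> R.
  by case: det => ->; rewrite ?rmorphN1 ?oppr_eq0 oner_eq0.
move: hd; rewrite rmorphB !rmorphM /= => hd.
have ep : p * (a%:~R * d%:~R - b%:~R * c%:~R) = 0.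
  have -> : p * (a%:~R * d%:~R - b%:~R * c%:~R) =
    (p * a%:~R + q * c%:~R) * d%:~R - (p * b%:~R + q * d%:~R) * c%:~R :> R by ring.
  by rewrite e1 e2 !mul0r subrr.
have eq : q * (a%:~R * d%:~R - b%:~R * c%:~R) = 0.
  have -> : q * (a%:~R * d%:~R - b%:~R * c%:~R) =
    (p * b%:~R + q * d%:~R) * a%:~R - (p * a%:~R + q * c%:~R) * b%:~R :> R by ring.
  by rewrite e1 e2 !mul0r subrr.
move/eqP: ep; move/eqP: eq; rewrite !mulf_eq0 (negPf hd) !orbF => /eqP q0 /eqP p0.
by move: pq; rewrite p0 q0 eqxx.
Qed.

Lemma separated_pull (R : realFieldType) (K : R -> R -> Prop) (a b c d : int) (x y : R) :
  a * d - b * c = 1 \/ a * d - b * c = -1 ->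
  separated K (a%:~R * x + b%:~R * y) (c%:~R * x + d%:~R * y) ->
  separated (pull K a b c d) x y.
Proof. by move=> det [p [q s]]; do 2!eexists; exact: supports_pull s. Qed.

Lemma blocks_pull (R : realFieldType) (K : R -> R -> Prop) (a b c d : int) (x y x' y' : R) :
  a * d - b * c = 1 \/ a * d - b * c = -1 ->
  blocks K (a%:~R * x + b%:~R * y) (c%:~R * x + d%:~R * y)
    (a%:~R * x' + b%:~R * y') (c%:~R * x' + d%:~R * y') ->
  blocks (pull K a b c d) x y x' y'.
Proof.
move=> det h p q s.
(* Functionals of the preimage have to be carried back to K by the inverse matrix. As the
   determinant [e] is 1 or -1, that inverse is [e] times the adjugate, and e e = 1 replaces
   division. *)
pose e : R := (a * d - b * c)%:~R.
have e2 : e * e = 1 by rewrite /e; case: det => ->; rewrite ?rmorphN1 ?mulrNN mulr1.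
have eE : e = a%:~R * d%:~R - b%:~R * c%:~R by rewrite /e rmorphB !rmorphM.
pose p' := e * (p * d%:~R - q * c%:~R); pose q' := e * (q * a%:~R - p * b%:~R).
have pE u v : p' * (a%:~R * u + b%:~R * v) + q' * (c%:~R * u + d%:~R * v) = p * u + q * v.
  transitivity ((e * e) * (p * u + q * v)); last by rewrite e2 mul1r.
  by rewrite {2}eE /p' /q'; ring.
suff : supports K p' q' (a%:~R * x + b%:~R * y) (c%:~R * x + d%:~R * y).
  by move=> /h; rewrite !pE.
have [pq hs] := s; split.
  rewrite -negb_and; apply/negP => /andP[/eqP e1 /eqP e2'].
  move: pq; have -> : p = 0 by have := pE 1 0; rewrite e1 e2'; lra.
  by have -> : q = 0 by [have := pE 0 1; rewrite e1 e2'; lra]; rewrite eqxx.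
move=> u v k; rewrite pE.
have -> : p' * u + q' * v = p * (e * (d%:~R * u - b%:~R * v)) + q * (e * (a%:~R * v - c%:~R * u)).
  by rewrite /p' /q'; ring.
apply: hs; rewrite /pull.
have -> : a%:~R * (e * (d%:~R * u - b%:~R * v)) + b%:~R * (e * (a%:~R * v - c%:~R * u)) = u.
  by transitivity ((e * e) * u); [rewrite {3}eE; ring|rewrite e2 mul1r].
have -> : c%:~R * (e * (d%:~R * u - b%:~R * v)) + d%:~R * (e * (a%:~R * v - c%:~R * u)) = v.
  by transitivity ((e * e) * v); [rewrite {3}eE; ring|rewrite e2 mul1r].
exact: k.
Qed.

Lemma good_pull (R : realFieldType) (K : R -> R -> Prop) (a b c d : int) :
  a * d - b * c = 1 \/ a * d - b * c = -1 -> good K -> good (pull K a b c d).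
Proof.
move=> det [cK [N bN] W K0 sK].
pose ei : int := a * d - b * c.
have e2i : ei * ei = 1 by rewrite /ei; case: det => ->.
pose e : R := ei%:~R.
have e2 : e * e = 1 by rewrite -rmorphM e2i.
have eE : e = a%:~R * d%:~R - b%:~R * c%:~R by rewrite /e /ei rmorphB !rmorphM.
have inv1 (x y : R) : x = e * (d%:~R * (a%:~R * x + b%:~R * y) - b%:~R * (c%:~R * x + d%:~R * y)).
  by transitivity ((e * e) * x); [rewrite e2 mul1r|rewrite {2}eE; ring].
have inv2 (x y : R) : y = e * (a%:~R * (c%:~R * x + d%:~R * y) - c%:~R * (a%:~R * x + b%:~R * y)).
  by transitivity ((e * e) * y); [rewrite e2 mul1r|rewrite {2}eE; ring].
have en : `|e| = 1.
  by rewrite /e /ei; case: det => ->; rewrite ?rmorphN1 ?normrN normr1.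
split.
- move=> x1 y1 x2 y2 t k1 k2 t01; have := cK _ _ _ _ t k1 k2 t01.
  by rewrite /pull; congr K; ring.
- pose M : nat := ((absz a + absz b + absz c + absz d) * N)%N.
  have cf (k l : int) (u v : R) : `|u| <= N%:R -> `|v| <= N%:R ->
      (absz k + absz l <= absz a + absz b + absz c + absz d)%N ->
      `|e * (k%:~R * u - l%:~R * v)| <= M%:R.
    move=> hu hv kl; rewrite normrM en mul1r; apply: le_trans (ler_normB _ _) _.
    rewrite !normrM.
    apply: (@le_trans _ _ ((absz k + absz l)%:R * N%:R)); last first.
      by rewrite /M natrM ler_wpM2r // ler_nat.
    rewrite natrD mulrDl; apply: lerD.
      by rewrite natr_absz -intr_norm; apply: ler_wpM2l => //; rewrite ler0z.
    by rewrite natr_absz -intr_norm; apply: ler_wpM2l => //; rewrite ler0z.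
  exists M => x y /bN [hX hY]; split.
    by rewrite (inv1 x y); apply: cf => //; lia.
  by rewrite (inv2 x y); apply: cf => //; lia.
- move=> u v uv.
  pose u' : int := ei * (u * d - v * c); pose v' : int := ei * (v * a - u * b).
  have uE : u' * a + v' * c = u.
    by transitivity ((ei * ei) * u); [rewrite {2}/ei /u' /v'; ring|rewrite e2i mul1r].
  have vE : u' * b + v' * d = v.
    by transitivity ((ei * ei) * v); [rewrite {2}/ei /u' /v'; ring|rewrite e2i mul1r].
  have uv' : (u' != 0) || (v' != 0).
    rewrite -negb_and; apply/negP => /andP[/eqP e1 /eqP e2'].
    by move: uv; rewrite -uE -vE e1 e2' !mul0r addr0 eqxx.
  have [x1 [y1 [x2 [y2 [k1 k2 h]]]]] := W _ _ uv'.
  pose X (x y : R) := e * (d%:~R * x - b%:~R * y).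
  pose Y (x y : R) := e * (a%:~R * y - c%:~R * x).
  have XE x y : a%:~R * X x y + b%:~R * Y x y = x.
    by transitivity ((e * e) * x); [rewrite {2}eE /X /Y; ring|rewrite e2 mul1r].
  have YE x y : c%:~R * X x y + d%:~R * Y x y = y.
    by transitivity ((e * e) * y); [rewrite {2}eE /X /Y; ring|rewrite e2 mul1r].
  exists (X x1 y1), (Y x1 y1), (X x2 y2), (Y x2 y2).
  rewrite /pull !XE !YE; split=> //.
  have uvE x y : u%:~R * X x y + v%:~R * Y x y = u'%:~R * x + v'%:~R * y.
    transitivity (u'%:~R * (a%:~R * X x y + b%:~R * Y x y) + v'%:~R * (c%:~R * X x y + d%:~R * Y x y)).
      by rewrite -uE -vE !rmorphD !rmorphM /=; ring.
    by rewrite XE YE.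
  by rewrite !uvE.
- by rewrite /pull !mulr0 !addr0.
- move=> i j ij; apply: separated_pull => //; rewrite -!rmorphM -!rmorphD; apply: sK.
  rewrite -negb_and; apply/negP => /andP[/eqP e1 /eqP e2'].
  have i0 : ei * i = 0.
    have -> : ei * i = d * (a * i + b * j) - b * (c * i + d * j) by rewrite /ei; ring.
    by rewrite e1 e2' !mulr0 subr0.
  have j0 : ei * j = 0.
    have -> : ei * j = a * (c * i + d * j) - c * (a * i + b * j) by rewrite /ei; ring.
    by rewrite e1 e2' !mulr0 subr0.
  move: ij; rewrite -[i]mul1r -[j]mul1r -e2i -!mulrA i0 j0 !mulr0 eqxx.
  by [].
Qed.

Lemma good_shift (R : realFieldType) (K : R -> R -> Prop) (N : nat) (i j : int) :
  convex2 K -> bounded2 K N -> wide3 K -> K i%:~R j%:~R ->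
  (forall k l : int, (k != i) || (l != j) -> separated K k%:~R l%:~R) ->
  good (shift K i j).
Proof.
move=> cK bN W kij sK; split.
- move=> x1 y1 x2 y2 t k1 k2 t01; have := cK _ _ _ _ t k1 k2 t01.
  by rewrite /shift; congr K; ring.
- exists (N + (absz i + absz j))%N => x y /bN [hx hy].
  rewrite !natrD !natr_absz; split.
    rewrite -[x](addrK i%:~R); apply: le_trans (ler_normB _ _) _.
    by apply: lerD => //; rewrite -intr_norm lerDl ler0z.
  rewrite -[y](addrK j%:~R); apply: le_trans (ler_normB _ _) _.
  by apply: lerD => //; rewrite -intr_norm lerDr ler0z.
- move=> u v uv; have [x1 [y1 [x2 [y2 [k1 k2 h]]]]] := W u v uv.
  exists (x1 - i%:~R), (y1 - j%:~R), (x2 - i%:~R), (y2 - j%:~R).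
  by rewrite /shift !subrK; split=> //; lra.
- by rewrite /shift !add0r.
- move=> k l kl.
  have [p [q [pq h]]] : separated K (k + i)%:~R (l + j)%:~R.
    by apply: sK; rewrite -subr_eq0 -[l + j == j]subr_eq0 !addrK.
  by exists p, q; split=> // x y /h; rewrite !rmorphD /=; lra.
Qed.

(** * Unimodular copies of the triangle *)

(* K is the image of 3 Delta_2 under the affine unimodular map with translation o
   and columns e, f. *)
Definition big_triangle (R : realFieldType) (K : R -> R -> Prop) : Prop :=
  exists o1 o2 e1 e2 f1 f2 : int, (e1 * f2 - e2 * f1 = 1 \/ e1 * f2 - e2 * f1 = -1) /\
    forall x y, K x y <-> exists l m : R, [/\ 0 <= l, 0 <= m, l + m <= 3,
      x = o1%:~R + l * e1%:~R + m * f1%:~R & y = o2%:~R + l * e2%:~R + m * f2%:~R].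

Lemma big_triangle_pull (R : realFieldType) (K : R -> R -> Prop) (a b c d : int) :
  a * d - b * c = 1 \/ a * d - b * c = -1 -> big_triangle (pull K a b c d) -> big_triangle K.
Proof.
move=> det [ o1 [ o2 [e1 [e2 [f1 [f2 [det' h]]]]]]].
exists (a * o1 + b * o2), (c * o1 + d * o2), (a * e1 + b * e2), (c * e1 + d * e2),
  (a * f1 + b * f2), (c * f1 + d * f2); split.
  have -> : (a * e1 + b * e2) * (c * f1 + d * f2) - (c * e1 + d * e2) * (a * f1 + b * f2)
    = (a * d - b * c) * (e1 * f2 - e2 * f1) by ring.
  by case: det => ->; case: det' => ->; rewrite ?mulrNN ?mulN1r ?mul1r; tauto.
move=> x y.
pose e : R := (a * d - b * c)%:~R.
have e2E : e * e = 1 by rewrite /e; case: det => ->; rewrite ?rmorphN1 ?mulrNN mulr1.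
have eE : e = a%:~R * d%:~R - b%:~R * c%:~R by rewrite /e rmorphB !rmorphM.
pose X := e * (d%:~R * x - b%:~R * y); pose Y := e * (a%:~R * y - c%:~R * x).
have XE : a%:~R * X + b%:~R * Y = x.
  by transitivity ((e * e) * x); [rewrite {2}eE /X /Y; ring|rewrite e2E mul1r].
have YE : c%:~R * X + d%:~R * Y = y.
  by transitivity ((e * e) * y); [rewrite {2}eE /X /Y; ring|rewrite e2E mul1r].
have := h X Y; rewrite /pull XE YE => ->; split=> -[l [m [l0 m0 lm h1 h2]]]; exists l, m; split=> //.
- by rewrite -XE h1 h2 !rmorphD !rmorphM /=; ring.
- by rewrite -YE h1 h2 !rmorphD !rmorphM /=; ring.
- transitivity ((e * e) * (o1%:~R + l * e1%:~R + m * f1%:~R)); last by rewrite e2E mul1r.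
  by rewrite {2}eE /X h1 h2 !rmorphD !rmorphM /=; ring.
- transitivity ((e * e) * (o2%:~R + l * e2%:~R + m * f2%:~R)); last by rewrite e2E mul1r.
  by rewrite {2}eE /Y h1 h2 !rmorphD !rmorphM /=; ring.
Qed.

Lemma big_triangle_shift (R : realFieldType) (K : R -> R -> Prop) (i j : int) :
  big_triangle (shift K i j) -> big_triangle K.
Proof.
move=> [ o1 [ o2 [e1 [e2 [f1 [f2 [det h]]]]]]].
exists (o1 + i), (o2 + j), e1, e2, f1, f2; split=> // x y.
have := h (x - i%:~R) (y - j%:~R); rewrite /shift !subrK => ->.
by split=> -[l [m [l0 m0 lm h1 h2]]]; exists l, m; split=> //; move: h1 h2; rewrite !rmorphD /=; lra.
Qed.

(** In the coordinates l, m of the triangle, the integer functionals l, m and l + m range over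
    [0, 3]. Width 3 makes K attain max l, max m and min (l + m), each of which occurs at a single
    vertex; by convexity K is everything. *)
Lemma big_triangle_sub (R : realFieldType) (K K' : R -> R -> Prop) :
  (forall x y, K x y -> K' x y) -> convex2 K -> wide3 K -> big_triangle K' -> big_triangle K.
Proof.
move=> sub cK W [ o1 [ o2 [e1 [e2 [f1 [f2 [det h]]]]]]].
exists o1, o2, e1, e2, f1, f2; split=> // x y; split=> [/sub /h //|].
pose ei : int := e1 * f2 - e2 * f1.
have ei2 : ei * ei = 1 by rewrite /ei; case: det => ->.
pose e : R := ei%:~R.
have ee : e * e = 1 by rewrite -rmorphM ei2.
have eE : e = e1%:~R * f2%:~R - e2%:~R * f1%:~R by rewrite /e /ei rmorphB !rmorphM.
have ei0 (u v : int) : u * e1 + v * e2 != 0 \/ u * f1 + v * f2 != 0 -> (u != 0) || (v != 0).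
  move=> huv; rewrite -negb_and; apply/negP => /andP[/eqP u0 /eqP v0].
  by case: huv; rewrite u0 v0 !mul0r addr0 eqxx.
have val (u v : int) (x1 y1 l m : R) :
    x1 = o1%:~R + l * e1%:~R + m * f1%:~R -> y1 = o2%:~R + l * e2%:~R + m * f2%:~R ->
    u%:~R * x1 + v%:~R * y1 = (u * o1 + v * o2)%:~R + l * (u * e1 + v * e2)%:~R + m * (u * f1 + v * f2)%:~R.
  by move=> -> ->; rewrite !rmorphD !rmorphM /=; ring.
(* (ei f2, - ei f1) and (- ei e2, ei e1) are the rows of the inverse matrix, that is, the
   functionals l and m up to constants. *)
have D1 : ei * f2 * e1 + - (ei * f1) * e2 = 1 by rewrite -ei2 {3}/ei; ring.
have D2 : ei * f2 * f1 + - (ei * f1) * f2 = 0 by ring.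
have D3 : - (ei * e2) * e1 + ei * e1 * e2 = 0 by ring.
have D4 : - (ei * e2) * f1 + ei * e1 * f2 = 1 by rewrite -ei2 {3}/ei; ring.
have vE : K (o1%:~R + 3 * e1%:~R) (o2%:~R + 3 * e2%:~R).
  have [|x1 [y1 [x2 [y2 [k1 k2 hd]]]]] := W (ei * f2) (- (ei * f1)).
    by apply: ei0; left; rewrite D1.
  have [l [m [l0 m0 lm hx hy]]] := (h _ _).1 (sub _ _ k1).
  have [l' [m' [l'0 m'0 lm' hx' hy']]] := (h _ _).1 (sub _ _ k2).
  move: hd; rewrite (val _ _ _ _ _ _ hx hy) (val _ _ _ _ _ _ hx' hy') D1 D2 mulr0 mulr1 => hd.
  have lE : l = 3 by lra.
  have mE : m = 0 by lra.
  by move: k1; rewrite hx hy lE mE !mul0r !addr0.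
have vF : K (o1%:~R + 3 * f1%:~R) (o2%:~R + 3 * f2%:~R).
  have [|x1 [y1 [x2 [y2 [k1 k2 hd]]]]] := W (- (ei * e2)) (ei * e1).
    by apply: ei0; right; rewrite D4.
  have [l [m [l0 m0 lm hx hy]]] := (h _ _).1 (sub _ _ k1).
  have [l' [m' [l'0 m'0 lm' hx' hy']]] := (h _ _).1 (sub _ _ k2).
  move: hd; rewrite (val _ _ _ _ _ _ hx hy) (val _ _ _ _ _ _ hx' hy') D3 D4 mulr0 mulr1 => hd.
  have mE : m = 3 by lra.
  have lE : l = 0 by lra.
  by move: k1; rewrite hx hy lE mE !mul0r !addr0.
have vO : K o1%:~R o2%:~R.
  have D5 : (ei * f2 - ei * e2) * e1 + (ei * e1 - ei * f1) * e2 = 1 by rewrite -ei2 {5}/ei; ring.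
  have D6 : (ei * f2 - ei * e2) * f1 + (ei * e1 - ei * f1) * f2 = 1 by rewrite -ei2 {5}/ei; ring.
  have [|x1 [y1 [x2 [y2 [k1 k2 hd]]]]] := W (ei * f2 - ei * e2) (ei * e1 - ei * f1).
    by apply: ei0; left; rewrite D5.
  have [l [m [l0 m0 lm hx hy]]] := (h _ _).1 (sub _ _ k1).
  have [l' [m' [l'0 m'0 lm' hx' hy']]] := (h _ _).1 (sub _ _ k2).
  move: hd; rewrite (val _ _ _ _ _ _ hx hy) (val _ _ _ _ _ _ hx' hy') D5 D6 mulr1 => hd.
  have lE : l' = 0 by lra.
  have mE : m' = 0 by lra.
  by move: k2; rewrite hx' hy' lE mE !mul0r !addr0.
by move=> [l [m [l0 m0 lm -> ->]]]; exact: convex2_triangle.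
Qed.

(** * Three consecutive lattice points on an edge *)

(** The line y = 1 supports K. With lines of tilts [be] and [ga] at (1,0) and (-1,0), the height
    gives be + ga <= 1 and the width along x gives be + ga >= 1. So K is the triangle with vertices
    (1 + be, 1), (-2 + be, 1), (1 - 2 be, -2), which has (0,-1) in its interior unless be is 0 or
    1. *)
Lemma edge_case (R : realFieldType) (K : R -> R -> Prop) :
  good K -> K (-1) 1 -> K 0 1 -> K 1 1 -> big_triangle K.
Proof.
move=> [cK _ W K0 sK] kl kc kr.
have [xa [ya [xb [yb [k1 k2 h1]]]]] := wide3_x W.
have [xc [yc [xd [yd [k3 k4 h2]]]]] := wide3_y W.
have top x y : K x y -> y <= 1.
  have [p [q [pq h]]] : separated K 0 1 := sK 0 1 isT.
  have p0 : p = 0 by have := (h _ _ kl, h _ _ kr) => -[]; lra.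
  have q0 : 0 < q.
    by rewrite lt_def; move: pq; rewrite p0 eqxx /= => -> /=; have := h _ _ K0; lra.
  by move=> /h k; rewrite -(ler_pM2l q0); move: k; rewrite p0; lra.
have [be be0 rt] : exists2 be, 0 <= be & below K 1 (- be) 1.
  have [p [q [pq h]]] : separated K 1 0 := sK 1 0 isT.
  have p0 : 0 <= p by have := h _ _ K0; lra.
  have q0 : q <= 0 by have := h _ _ kr; lra.
  (* A horizontal line at (1,0) would confine K to 0 <= y <= 1. *)
  have [pE|pn] := eqVneq p 0.
    have qn : q < 0 by rewrite lt_neqAle q0 andbT; move: pq; rewrite pE eqxx.
    have : 0 <= yd by rewrite -(ler_nM2l qn); have := h _ _ k4; rewrite pE; lra.
    by have := top _ _ k3; lra.
  have pp : 0 < p by rewrite lt_def pn.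
  exists (- q / p); first by rewrite divr_ge0 ?oppr_ge0.
  move=> x y /h k; rewrite -(ler_pM2l pp).
  have -> : p * (1 * x + - (- q / p) * y) = p * x + q * y by field; lra.
  lra.
have [ga ga0 lt] : exists2 ga, 0 <= ga & below K (-1) (- ga) 1.
  have [p [q [pq h]]] : separated K (-1) 0 := sK (-1) 0 isT.
  have p0 : p <= 0 by have := h _ _ K0; lra.
  have q0 : q <= 0 by have := h _ _ kl; lra.
  have [pE|pn] := eqVneq p 0.
    have qn : q < 0 by rewrite lt_neqAle q0 andbT; move: pq; rewrite pE eqxx.
    have : 0 <= yd by rewrite -(ler_nM2l qn); have := h _ _ k4; rewrite pE; lra.
    by have := top _ _ k3; lra.
  have pp : 0 < - p by rewrite oppr_gt0 lt_neqAle pn.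
  exists (q / p); first by rewrite -[q / p]mulrNN -invrN divr_ge0 ?oppr_ge0 //; lra.
  move=> x y /h k; rewrite -(ler_pM2l pp).
  have -> : - p * (-1 * x + - (q / p) * y) = p * x + q * y by field; lra.
  lra.
have yd2 : yd <= -2 by have := top _ _ k3; lra.
have kap1 : be + ga <= 1.
  have : 0 <= (be + ga) * (- yd - 2) by apply: mulr_ge0; bound_lra.
  by have := rt _ _ k4; have := lt _ _ k4; lra.
have xa1 : xa <= 1 + be.
  have : 0 <= be * (1 - ya) by apply: mulr_ge0 => //; have := top _ _ k1; lra.
  by have := rt _ _ k1; lra.
have xb1 : - xb <= 1 + ga.
  have : 0 <= ga * (1 - yb) by apply: mulr_ge0 => //; have := top _ _ k2; lra.
  by have := lt _ _ k2; lra.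
have gaE : ga = 1 - be by lra.
have xaE : xa = 1 + be by lra.
have xbE : xb = - 2 + be by lra.
have ydE : yd = -2 by have := rt _ _ k4; have := lt _ _ k4; rewrite gaE; lra.
have xdE : xd = 1 - 2 * be by have := rt _ _ k4; have := lt _ _ k4; rewrite gaE ydE; lra.
have vr : K (1 + be) 1.
  have [->|bn] := eqVneq be 0; first by rewrite addr0.
  have bp : 0 < be by rewrite lt_def bn.
  suff yE : ya = 1 by move: k1; rewrite xaE yE.
  apply/eqP; rewrite eq_le (top _ _ k1) /= -(ler_pM2l bp); have := rt _ _ k1; rewrite xaE; lra.
have vl : K (-2 + be) 1.
  have [ge|gn] := eqVneq ga 0; first by rewrite (_ : -2 + be = -1) //; lra.
  have gp : 0 < ga by rewrite lt_def gn.
  suff yE : yb = 1 by move: k2; rewrite xbE yE.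
  apply/eqP; rewrite eq_le (top _ _ k2) /= -(ler_pM2l gp); have := lt _ _ k2; rewrite xbE; lra.
have vb : K (1 - 2 * be) (-2) by rewrite -ydE -xdE.
have be01 : be = 0 \/ be = 1.
  have [p [q [pq h]]] : separated K 0 (-1) := sK 0 (-1) isT.
  have [e|n0] := eqVneq be 0; first by left.
  have [e|n1] := eqVneq be 1; first by right.
  have b0 : 0 < be by rewrite lt_def n0.
  have b1 : 0 < 1 - be by rewrite subr_gt0 lt_neqAle n1 /=; lra.
  have i1 := h _ _ vr; have i2 := h _ _ vl; have i3 := h _ _ vb.
  exfalso; have p0 : p = 0.
    apply/eqP; rewrite eq_le; apply/andP; split; rewrite leNgt; apply/negP => pp.
      by have : 0 < p * (1 - be); [apply: mulr_gt0|]; lra.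
    by have : 0 < - p * be; [apply: mulr_gt0; rewrite // oppr_gt0|]; lra.
  by move: pq; rewrite p0 eqxx /= => /eqP; apply; move: i1 i2 i3; rewrite p0; lra.
case: be01 => bE; move: vr vl vb rt lt; rewrite gaE bE => vr vl vb rt lt.
- exists 1, 1, (-1), 0, 0, (-1); split; first by left.
  move=> x y; split=> [k|[l [m [l0 m0 lm -> ->]]]].
    exists (1 - x), (1 - y); rewrite !rmorphN !rmorph1 !rmorph0.
    by have := (top _ _ k, rt _ _ k, lt _ _ k) => -[[? ?] ?]; split; lra.
  apply: convex2_triangle => //.
  + by move: vl; congr K; rewrite ?rmorphN ?rmorph1 ?rmorph0; ring.
  + by move: vb; congr K; rewrite ?rmorphN ?rmorph1 ?rmorph0; ring.
- exists (-1), 1, 1, 0, 0, (-1); split; first by right.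
  move=> x y; split=> [k|[l [m [l0 m0 lm -> ->]]]].
    exists (x + 1), (1 - y); rewrite !rmorphN !rmorph1 !rmorph0.
    by have := (top _ _ k, rt _ _ k, lt _ _ k) => -[[? ?] ?]; split; lra.
  apply: convex2_triangle => //.
  + by move: vr; congr K; rewrite ?rmorphN ?rmorph1 ?rmorph0; ring.
  + by move: vb; congr K; rewrite ?rmorphN ?rmorph1 ?rmorph0; ring.
Qed.

(** f is the middle one of the three points and e their common difference; the determinant puts the
    origin at lattice distance one from their line. *)
Lemma edge_basis (R : realFieldType) (K : R -> R -> Prop) (e1 e2 f1 f2 : int) :
  e1 * f2 - f1 * e2 = 1 \/ e1 * f2 - f1 * e2 = -1 -> good K ->
  K (f1 - e1)%:~R (f2 - e2)%:~R -> K f1%:~R f2%:~R -> K (f1 + e1)%:~R (f2 + e2)%:~R ->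
  big_triangle K.
Proof.
move=> det gK k1 k2 k3; apply: (big_triangle_pull det); apply: edge_case.
- exact: good_pull.
- by move: k1; rewrite /pull; congr K; rewrite rmorphB /=; ring.
- by move: k2; rewrite /pull; congr K; ring.
- by move: k3; rewrite /pull; congr K; rewrite rmorphD /=; ring.
Qed.

(** As (s,0) is the midpoint of 0 and (2s,0), its supporting line is the axis, which also separates
    the origin. All lattice points are then separated, so (0,1) can take over as origin, next to the
    three points. *)
Lemma edge_on_axis (R : realFieldType) (K : R -> R -> Prop) (s : int) :
  s = 1 \/ s = -1 -> good K -> K 0 1 -> K s%:~R 0 -> K (s + s)%:~R 0 -> big_triangle K.
Proof.
move=> s1 gK k01 ks k2s; have [cK _ W K0 sK] := gK.
have sn : (s != 0) || (0 != 0 :> int) by case: s1 => ->.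
have [p [q [pq h]]] := sK _ _ sn.
have p0 : p = 0.
  by move: (h _ _ K0) (h _ _ k2s); rewrite rmorphD /=; case: s1 => ->; rewrite ?rmorphN ?rmorph1; lra.
have s00 : separated K 0 0.
  exists p, q; split=> // x y /h; rewrite p0; lra.
have K01 : K (0 : int)%:~R (1 : int)%:~R by exact: k01.
apply: (@big_triangle_shift _ _ 0 1).
apply: (@edge_basis _ _ 1 0 s (-1)).
- by right; rewrite mulr0 subr0 mul1r.
- have [N bN] : exists N, bounded2 K N by have [] := gK.
  apply: (good_shift cK bN W K01) => k l kl.
  have [/andP[/eqP -> /eqP ->]|kl0] := boolP ((k == 0) && (l == 0)); first exact: s00.
  by apply: sK; rewrite -negb_and.
- rewrite /shift; case: s1 ks k2s => -> ks k2s.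
    by move: K0; congr K; rewrite ?rmorphB ?rmorphN ?rmorph1 ?rmorph0 /=; ring.
  by move: k2s; congr K; rewrite ?rmorphB ?rmorphD ?rmorphN ?rmorph1 ?rmorph0 /=; ring.
- by rewrite /shift; move: ks; congr K; rewrite ?rmorphB ?rmorphN ?rmorph1 ?rmorph0 /=; ring.
- rewrite /shift; case: s1 ks k2s => -> ks k2s.
    by move: k2s; congr K; rewrite ?rmorphB ?rmorphD ?rmorphN ?rmorph1 ?rmorph0 /=; ring.
  by move: K0; congr K; rewrite ?rmorphB ?rmorphD ?rmorphN ?rmorph1 ?rmorph0 /=; ring.
Qed.

Lemma scale_in (R : realFieldType) (K : R -> R -> Prop) (x y t : R) :
  convex2 K -> K 0 0 -> K x y -> 0 <= t <= 1 -> K (t * x) (t * y).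
Proof.
by move=> cK K0 k t01; have := cK _ _ _ _ t K0 k t01; rewrite !mulr0 !add0r.
Qed.

(** When 0 is the only lattice point of K, nothing has to stay separated from [C], which can be the
    whole plane; any lattice point outside the bounding box starts the search. *)
Lemma add_lattice_point (R : realType) (K : R -> R -> Prop) : good K ->
  exists K' : R -> R -> Prop, [/\ good K', forall x y, K x y -> K' x y &
    exists i j : int, (i != 0) || (j != 0) /\ K' i%:~R j%:~R].
Proof.
move=> gK; have [h|h] := pselect (exists i j : int, (i != 0) || (j != 0) /\ K i%:~R j%:~R).
  by exists K.
have [cK [N bN] W K0 sK] := gK.
have nK : ~ K (N.+1%:Z)%:~R (0 : int)%:~R.
  by move=> /(bounded2_int bN) [+ _]; lia.
have [|||||k [l [_ nkl g']]] := @extend_good R K (fun _ _ => True) N.+1%:Z 0 gK => //.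
- by move=> k l kl kk; case: h; exists k, l.
exists (cone1 K k%:~R l%:~R); split=> //; first by move=> x y; exact: sub_cone1.
exists k, l; split; last exact: cone1_apex K0.
rewrite -negb_and; apply/negP => /andP[/eqP k0 /eqP l0].
by apply: nkl; rewrite k0 l0.
Qed.

(** * Finding two independent lattice points *)

Lemma primitive_basis (i j : int) : (i != 0) || (j != 0) ->
  exists g a b c d : int, [/\ 0 < g, i = g * a, j = g * c & a * d - b * c = 1].
Proof.
move=> ij; have [u [v huv]] := Bezoutz i j.
have g0 : 0 < gcdz i j.
  by rewrite lt_def gcdz_eq0 negb_and ij /= /gcdz.
have ei := divzK (dvdz_gcdl i j); have ej := divzK (dvdz_gcdr i j).
move: (gcdz i j) (i %/ gcdz i j)%Z (j %/ gcdz i j)%Z g0 huv ei ej => g a c g0 huv ei ej.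
exists g, a, (- v), c, u; split; rewrite ?[g * _]mulrC ?ei ?ej //.
apply: (mulfI (lt0r_neq0 g0)); rewrite mulr1 -[RHS]huv -ei -ej; ring.
Qed.

Definition off_axis (R : realFieldType) (K : R -> R -> Prop) : Prop :=
  exists i j : int, j != 0 /\ K i%:~R j%:~R.

Lemma extend_off_axis (R : realType) (K C : R -> R -> Prop) (i j : int) : good K -> ~ off_axis K -> convex2 C ->
    (forall x y, K x y -> C x y) -> j != 0 -> C i%:~R j%:~R ->
    (forall k : int, k != 0 -> K k%:~R 0 -> separated C k%:~R 0) ->
    exists k l : int, [/\ C k%:~R l%:~R, ~ K k%:~R l%:~R & good (cone1 K k%:~R l%:~R)].
Proof.
move=> gK noff cC KC j0 Cij sC; apply: (extend_good gK cC KC Cij).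
  by move=> k; apply: noff; exists i, j.
move=> k l kl kk; have [l0|ln] := eqVneq l 0; last by case: noff; exists k, l.
by move: kl kk; rewrite l0 orbF => k0 kk; exact: sC.
Qed.

(** [C] is an open half-plane bounded by the axis together with the part of K on the axis. The axis
    separates the lattice points of K from [C], and a point of [C] outside K is off the axis. *)
Lemma leave_axis_flat (R : realType) (K : R -> R -> Prop) (q : R) : good K -> K 1 0 -> ~ off_axis K -> q != 0 ->
    (forall x y, K x y -> q * y <= 0) ->
    exists K' : R -> R -> Prop, [/\ good K', forall x y, K x y -> K' x y & off_axis K'].
Proof.
move=> gK k10 noff q0 hq; have [cK _ _ K0 _] := gK.
pose C x y := q * y <= 0 /\ (y = 0 -> K x y).
have cC : convex2 C.
  move=> x1 y1 x2 y2 t [a1 b1] [a2 b2] /andP[t0 t1].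
  have s0 : 0 <= 1 - t by lra.
  have m1 := ler_wpM2l s0 a1; have m2 := ler_wpM2l t0 a2.
  split=> [|e]; first lra.
  have [t0'|tn] := eqVneq t 0.
    by move: e; rewrite t0' subr0 !mul0r !addr0 !mul1r; exact: b1.
  have [t1'|tn1] := eqVneq t 1.
    by move: e; rewrite t1' subrr !mul0r !add0r !mul1r; exact: b2.
  have e' : (1 - t) * (q * y1) + t * (q * y2) = 0.
    by transitivity (q * ((1 - t) * y1 + t * y2)); [ring|rewrite e mulr0].
  have z1 : (1 - t) * (q * y1) = 0 by lra.
  have z2 : t * (q * y2) = 0 by lra.
  have y10 : y1 = 0.
    by move/eqP: z1; rewrite !mulf_eq0 (negPf q0) subr_eq0 eq_sym (negPf tn1) => /eqP.
  have y20 : y2 = 0.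
    by move/eqP: z2; rewrite !mulf_eq0 (negPf q0) (negPf tn) => /eqP.
  by apply: cK; [exact: b1|exact: b2|rewrite t0].
pose j : int := if 0 < q then -1 else 1.
have [||||k [l [[_ Ckl] nkl g']]] := @extend_off_axis _ K C 0 j gK noff cC.
- by move=> x y k; split=> //; exact: hq k.
- by rewrite /j; case: ifP.
- split; last by rewrite /j; case: ifP => _ /eqP; rewrite ?rmorphN ?oppr_eq0 oner_eq0.
  rewrite /j; case: ifPn => [qp|]; first by rewrite rmorphN rmorph1; lra.
  by rewrite -leNgt rmorph1 mulr1.
- move=> k k0 kk; exists 0, q; split; first by rewrite q0 orbT.
  by move=> x y [h _]; lra.
exists (cone1 K k%:~R l%:~R); split=> //; first by move=> x y; exact: sub_cone1.
exists k, l; split; last exact: cone1_apex K0.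
by apply/eqP => l0; apply: nkl; apply: Ckl; rewrite l0.
Qed.

(** When neither supporting line is the axis, [C] is the region between the lines at (1,0) and
    (-1,0). Its lattice points on the axis are -1, 0, 1, all in K, so the new point is off the
    axis. *)
Lemma leave_axis_strip (R : realType) (K : R -> R -> Prop) : good K -> K 1 0 -> K (-1) 0 ->
    exists K' : R -> R -> Prop, [/\ good K', forall x y, K x y -> K' x y & off_axis K'].
Proof.
move=> gK k10 km10; have [out|noff] := pselect (off_axis K); first by exists K.
have [cK _ _ K0 sK] := gK.
have [p [q [pq h]]] : separated K 1 0 := sK 1 0 isT.
have [p' [q' [pq' h']]] : separated K (-1) 0 := sK (-1) 0 isT.
have p0 : 0 <= p by have := h _ _ K0; lra.
have p'0 : p' <= 0 by have := h' _ _ K0; lra.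
have [pE|pn] := eqVneq p 0.
  by move: pq; rewrite pE eqxx /= => qn; apply: (@leave_axis_flat _ K q) => // x y /h; rewrite pE; lra.
have [pE|pn'] := eqVneq p' 0.
  by move: pq'; rewrite pE eqxx /= => qn; apply: (@leave_axis_flat _ K q') => // x y /h'; rewrite pE; lra.
have pp : 0 < p by rewrite lt_def pn.
have pp' : 0 < - p' by rewrite oppr_gt0 lt_neqAle pn'.
pose C x y := p * x + q * y <= p /\ p' * x + q' * y <= - p'.
have cC : convex2 C.
  move=> x1 y1 x2 y2 t [a1 b1] [a2 b2] /andP[t0 t1].
  have s0 : 0 <= 1 - t by lra.
  have := (ler_wpM2l s0 a1, ler_wpM2l t0 a2, ler_wpM2l s0 b1, ler_wpM2l t0 b2).
  by move=> [[[? ?] ?] ?]; split; lra.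
have KC x y : K x y -> C x y by move=> k; have := (h _ _ k, h' _ _ k) => -[]; split; lra.
pose Q := q / p; pose Q' := - q' / p'.
have [k [j [j0 Ckj]]] : exists k j : int, j != 0 /\ C k%:~R j%:~R.
  have CE x y : C x y <-> x + Q * y <= 1 /\ - x + Q' * y <= 1.
    have e1 : p * (x + Q * y) = p * x + q * y by rewrite /Q; field.
    have e2 : - p' * (- x + Q' * y) = p' * x + q' * y by rewrite /Q'; field.
    by rewrite -(ler_pM2l pp (x + Q * y)) -(ler_pM2l pp' (- x + Q' * y)) e1 e2 !mulr1.
  (* The section of [C] has length 2 on the axis, hence at least 2 on one of the lines y = 1 and y =
     -1, and contains an integer there. *)
  have [s|s] := lerP (Q + Q') 0.
    exists (Num.floor (1 - Q)), 1; split=> //; apply/CE.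
    have := floor_le_tmp (1 - Q); have := floorD1_gt (1 - Q); rewrite rmorphD rmorph1 /=; lra.
  exists (Num.floor (1 + Q)), (-1); split=> //; apply/CE.
  have := floor_le_tmp (1 + Q); have := floorD1_gt (1 + Q); rewrite rmorphD rmorph1 rmorphN rmorph1 /=; lra.
have [||||k' [l [[c1 c2] nkl g']]] := @extend_off_axis _ K C k j gK noff cC.
- exact: KC.
- exact: j0.
- exact: Ckj.
- move=> i i0 ki.
  have hi := h _ _ ki; have hi' := h' _ _ ki.
  have : (i%:~R <= 1 :> R) by rewrite -(ler_pM2l pp); lra.
  have : (-1 <= i%:~R :> R) by rewrite -(ler_pM2l pp'); lra.
  rewrite -[1 in X in X <= _](rmorph1 (intmul 1)) -rmorphN !ler_int /= => i1.
  rewrite -[1](rmorph1 (intmul 1)) ler_int => i2.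
  have [->|->] : i = 1 \/ i = -1 by clear -i0 i1 i2; lia.
    by exists p, q; split=> // x y [h1 _]; rewrite rmorph1; lra.
  by exists p', q'; split=> // x y [_ h1]; rewrite rmorphN rmorph1; lra.
exists (cone1 K k'%:~R l%:~R); split=> //; first by move=> x y; exact: sub_cone1.
exists k', l; split; last exact: cone1_apex K0.
apply/eqP => l0; apply: nkl.
move: c1 c2; rewrite l0 mulr0z !mulr0 !addr0 => c1 c2.
have : (k'%:~R <= 1 :> R) by rewrite -(ler_pM2l pp); lra.
have : (-1 <= k'%:~R :> R) by rewrite -(ler_pM2l pp'); lra.
rewrite -[1 in X in X <= _](rmorph1 (intmul 1)) -rmorphN !ler_int /= => i1.
rewrite -[1](rmorph1 (intmul 1)) ler_int => i2.
have [->|[->|->]] : k' = 1 \/ k' = -1 \/ k' = 0 by clear -i1 i2; lia.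
- by [].
- by rewrite rmorphN rmorph1.
- by [].
Qed.

(** Without (-1,0), the search starts from that point in the half-plane of the line at (1,0). If the
    point found is on the axis, it is some (k,0) with k <= -1, so the enlarged body contains (-1,0)
    and the two-sided case applies. *)
Lemma leave_axis (R : realType) (K : R -> R -> Prop) : good K -> K 1 0 ->
  exists K' : R -> R -> Prop, [/\ good K', forall x y, K x y -> K' x y & off_axis K'].
Proof.
move=> gK k10; have [out|noff] := pselect (off_axis K); first by exists K.
have [km|nkm] := pselect (K (-1) 0); first exact: leave_axis_strip.
have [cK _ _ K0 sK] := gK.
have [p [q [pq h]]] : separated K 1 0 := sK 1 0 isT.
have p0 : 0 <= p by have := h _ _ K0; lra.
have [pE|pn] := eqVneq p 0.
  by move: pq; rewrite pE eqxx /= => qn; apply: (@leave_axis_flat _ K q) => // x y /h; rewrite pE; lra.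
have pp : 0 < p by rewrite lt_def pn.
pose C x y := p * x + q * y <= p.
have cC : convex2 C.
  move=> x1 y1 x2 y2 t a1 a2 /andP[t0 t1].
  have s0 : 0 <= 1 - t by lra.
  by have := (ler_wpM2l s0 a1, ler_wpM2l t0 a2) => -[? ?]; rewrite /C; lra.
have [||||k [l [c1 nkl g']]] := extend_good (i := -1) (j := 0) gK cC.
- by move=> x y /h; rewrite /C; lra.
- by rewrite /C rmorphN rmorph1; lra.
- by rewrite rmorphN rmorph1.
- move=> k l kl kk; have [l0|ln] := eqVneq l 0; last by case: noff; exists k, l.
  have k0 : k != 0 by move: kl; rewrite l0 orbF.
  move: kk; rewrite l0 => kk.
  have : (k%:~R <= 1 :> R) by rewrite -(ler_pM2l pp); have := h _ _ kk; rewrite mulr0z; lra.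
  rewrite -[1](rmorph1 (intmul 1)) ler_int => k1.
  have [kpos|kneg] : k = 1 \/ k <= -1 by lia.
    by exists p, q; split=> // x y; rewrite /C kpos rmorph1 mulr0z; lra.
  case: nkm; have kr : (k%:~R <= -1 :> R).
    by rewrite -[1](rmorph1 (intmul 1)) -rmorphN ler_int.
  have := scale_in (t := - (k%:~R)^-1) cK K0 kk.
  have kn : k%:~R != 0 :> R by rewrite intr_eq0.
  rewrite mulr0z mulr0 mulNr mulVf //; apply.
  by rewrite -invrN invr_ge0 invf_le1; lra.
have [l0|nk] := eqVneq l 0; last first.
  exists (cone1 K k%:~R l%:~R); split=> //; first by move=> x y; exact: sub_cone1.
  by exists k, l; split=> //; exact: cone1_apex K0.
move: c1 nkl; rewrite /C l0 mulr0z mulr0 addr0 => c1 nkl.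
have : (k%:~R <= 1 :> R) by rewrite -(ler_pM2l pp); lra.
rewrite -[1](rmorph1 (intmul 1)) ler_int => k1.
have kneg : k <= -1.
  have [k2|k2] : k <= -1 \/ (k = 0 \/ k = 1) by lia.
    by [].
  by case: k2 nkl => ->; rewrite ?rmorph1.
have kr : (k%:~R <= -1 :> R) by rewrite -[1](rmorph1 (intmul 1)) -rmorphN ler_int.
have [|||K' [gK' sub oK']] := @leave_axis_strip _ (cone1 K k%:~R l%:~R).
- exact: g'.
- exact: sub_cone1.
- have [cK' _ _ K0' _] := g'.
  have := scale_in (t := - (k%:~R)^-1) cK' K0' (cone1_apex k%:~R l%:~R K0).
  have kn : k%:~R != 0 :> R by lra.
  rewrite l0 mulr0z mulr0 mulNr mulVf //; apply.
  by rewrite -invrN invr_ge0 invf_le1; lra.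
by exists K'; split=> // x y k0; apply: sub; exact: sub_cone1.
Qed.

(** * Position of the lattice points *)

Ltac field_lra := field; first [lra | apply: lt0r_neq0; lra | apply: ltr0_neq0; lra].

Lemma swap_det : (0 : int) * 0 - 1 * 1 = 1 \/ (0 : int) * 0 - 1 * 1 = -1.
Proof. by right. Qed.

Lemma pull_swap (R : realFieldType) (K : R -> R -> Prop) (x y : R) :
  pull K 0 1 1 0 x y = K y x.
Proof. by rewrite /pull; congr K; ring. Qed.

Lemma blocks_swap (R : realFieldType) (K : R -> R -> Prop) (x y a b : R) :
  blocks K y x b a -> blocks (pull K 0 1 1 0) x y a b.
Proof.
move=> h; apply: (blocks_pull swap_det); move: h; congr blocks; ring.
Qed.

Lemma good_swap (R : realFieldType) (K : R -> R -> Prop) : good K -> good (pull K 0 1 1 0).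
Proof. exact: good_pull swap_det. Qed.

Lemma swap_neg (R : realFieldType) (K : R -> R -> Prop) :
  ~ big_triangle K -> ~ big_triangle (pull K 0 1 1 0).
Proof. by move=> n h; apply: n; exact: (big_triangle_pull swap_det h). Qed.

Lemma convex2_comb3 (R : realFieldType) (K : R -> R -> Prop) (x1 y1 x2 y2 x3 y3 a b c : R) :
  convex2 K -> K x1 y1 -> K x2 y2 -> K x3 y3 -> 0 <= a -> 0 <= b -> 0 < c -> a + b + c = 1 ->
  K (a * x1 + b * x2 + c * x3) (a * y1 + b * y2 + c * y3).
Proof.
move=> cK k1 k2 k3 a0 b0 c0 s.
have bc : 0 < b + c by lra.
have t1 : 0 <= c / (b + c) <= 1 by rewrite divr_ge0 ?ler_pdivrMr; lra.
have t2 : 0 <= b + c <= 1 by lra.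
have := cK _ _ _ _ _ k1 (cK _ _ _ _ _ k2 k3 t1) t2.
have -> : a = 1 - (b + c) by lra.
by congr K; field_lra.
Qed.

(** (-1,0) lies in the triangle with vertices 0, (0,1), (-m,-n), and in its interior unless m = n +
    1. In that case (0,1), (-1,0), (-2,-1) are consecutive points of an edge. *)
Lemma lattice_low_left (R : realFieldType) (K : R -> R -> Prop) (m n : int) :
  good K -> K 0 1 -> 1 <= n -> n < m -> K (- m)%:~R (- n)%:~R -> big_triangle K.
Proof.
move=> gK kb n1 nm km; have [cK _ W K0 sK] := gK.
have nR : 1 <= n%:~R :> R by rewrite ler1z.
have mR : n%:~R + 1 <= m%:~R :> R by rewrite -[1](rmorph1 (intmul 1)) -rmorphD ler_int lezD1.
have [p [q [pq h]]] : separated K (-1) 0 := sK (-1) 0 isT.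
have p0 : 0 <= - p by have := h _ _ K0; lra.
have qp : q <= - p by have := h _ _ kb; lra.
have := h _ _ km; rewrite !rmorphN /= => hk.
have qp' : - p <= q.
  have n0 : 0 < n%:~R :> R by lra.
  rewrite -(ler_pM2l n0).
  have : 0 <= - p * (m%:~R - 1 - n%:~R) by apply: mulr_ge0; bound_lra.
  lra.
have qE : q = - p by lra.
have pp : 0 < - p.
  by rewrite lt_def p0 andbT oppr_eq0; apply: contraTneq pq => e; rewrite qE e oppr0 eqxx.
have mE : m%:~R = n%:~R + 1 :> R.
  by apply/eqP; rewrite eq_le mR andbT -(ler_pM2l pp); move: hk; rewrite qE; lra.
have n1' : 0 < n%:~R + 1 :> R by lra.
have t2 : 0 <= (2 : R) / (n%:~R + 1) <= 1 by rewrite divr_ge0 ?ler_pdivrMr; lra.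
have t1 : 0 <= (1 : R) / (n%:~R + 1) <= 1 by rewrite divr_ge0 ?ler_pdivrMr; lra.
have k2 := cK _ _ _ _ _ kb km t2; have k1 := cK _ _ _ _ _ kb km t1.
apply: (@edge_basis _ _ 1 1 (-1) 0) => //; first by left.
- by move: k2; congr K; rewrite ?rmorphD ?rmorphN /= ?mE; field_lra.
- by move: k1; congr K; rewrite ?rmorphN /= ?mE; field_lra.
Qed.

(** If m <= n, the triangle with vertices 0, (1,0), (m,-n) contains (1,-1). Otherwise (1,0) is
    interior to the triangle with vertices 0, (0,1), (m,-n), unless m = n + 1, where (0,1), (1,0),
    (2,-1) are consecutive on an edge. *)
Lemma lattice_low_right (R : realFieldType) (K : R -> R -> Prop) (m n : int) :
  good K -> K 1 0 -> K 0 1 -> 1 <= m -> 1 <= n -> K m%:~R (- n)%:~R ->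
  big_triangle K \/ K 1 (-1).
Proof.
move=> gK ka kb m1 n1 km; have [cK _ W K0 sK] := gK.
have nR : 1 <= n%:~R :> R by rewrite ler1z.
have mR : 1 <= m%:~R :> R by rewrite ler1z.
have [le|lt] := lerP m n.
  right; have mn : m%:~R <= n%:~R :> R by rewrite ler_int.
  have n0 : 0 < n%:~R :> R by lra.
  have g1 : 0 <= (m%:~R - 1) / n%:~R :> R by rewrite divr_ge0; lra.
  have g2 : 0 <= 1 - m%:~R / n%:~R :> R by rewrite subr_ge0 ler_pdivrMr ?mul1r.
  have g3 : 0 < 1 / n%:~R :> R by rewrite divr_gt0.
  have g4 : (m%:~R - 1) / n%:~R + (1 - m%:~R / n%:~R) + 1 / n%:~R = 1 :> R by field_lra.
  have := convex2_comb3 cK K0 ka km g1 g2 g3 g4.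
  by congr K; rewrite ?rmorphN /=; field_lra.
have mR' : n%:~R + 1 <= m%:~R :> R by rewrite -[1](rmorph1 (intmul 1)) -rmorphD ler_int lezD1.
have [p [q [pq h]]] : separated K 1 0 := sK 1 0 isT.
have p0 : 0 <= p by have := h _ _ K0; lra.
have qp : q <= p by have := h _ _ kb; lra.
have := h _ _ km; rewrite !rmorphN /= => hk.
have qp' : p <= q.
  have n0 : 0 < n%:~R :> R by lra.
  rewrite -(ler_pM2l n0).
  have : 0 <= p * (m%:~R - 1 - n%:~R) by apply: mulr_ge0; bound_lra.
  lra.
have qE : q = p by lra.
have pp : 0 < p.
  by rewrite lt_def p0 andbT; apply: contraTneq pq => e; rewrite qE e eqxx.
have mE : m%:~R = n%:~R + 1 :> R.
  by apply/eqP; rewrite eq_le mR' andbT -(ler_pM2l pp); move: hk; rewrite qE; lra.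
left; have t1 : 0 <= (1 : R) / n%:~R <= 1 by rewrite divr_ge0 ?ler_pdivrMr; lra.
have k2 := cK _ _ _ _ _ ka km t1.
apply: (@edge_basis _ _ 1 (-1) 1 0) => //; first by left.
by move: k2; congr K; rewrite ?rmorphD ?rmorphN /= ?mE; field_lra.
Qed.

Lemma lattice_on_axis (R : realFieldType) (K : R -> R -> Prop) (k : int) :
  good K -> K 1 0 -> K 0 1 -> K k%:~R 0 -> big_triangle K \/ `|k| <= 1.
Proof.
move=> gK ka kb kk; have [cK _ W K0 sK] := gK.
have [?|[k2|k2]] : `|k| <= 1 \/ (2 <= k \/ k <= -2) by lia.
- by right.
- left; have kR : 2 <= k%:~R :> R by rewrite (ler_int _ 2 k).
  apply: (@edge_on_axis _ _ 1) => //; first by left.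
  have t1 : 0 <= (2 : R) / k%:~R <= 1 by rewrite divr_ge0 ?ler_pdivrMr; lra.
  by have := scale_in cK K0 kk t1; congr K; rewrite ?rmorphD /=; field_lra.
- left; have kR : k%:~R <= -2 :> R by rewrite (ler_int _ k (-2)).
  apply: (@edge_on_axis _ _ (-1)) => //; first by right.
    have t1 : 0 <= (1 : R) / - k%:~R <= 1 by rewrite divr_ge0 ?ler_pdivrMr; lra.
    by have := scale_in cK K0 kk t1; congr K; rewrite ?rmorphN /=; field_lra.
  have t1 : 0 <= (2 : R) / - k%:~R <= 1 by rewrite divr_ge0 ?ler_pdivrMr; lra.
  by have := scale_in cK K0 kk t1; congr K; rewrite ?rmorphD ?rmorphN /=; field_lra.
Qed.

Lemma lattice_low_diag (R : realFieldType) (K : R -> R -> Prop) (m n : int) :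
  good K -> ~ big_triangle K -> K 1 0 -> K 0 1 -> 1 <= m -> 1 <= n ->
  K (- m)%:~R (- n)%:~R -> m = 1 /\ n = 1.
Proof.
move=> gK nb ka kb m1 n1 km; have [cK _ W K0 sK] := gK.
have [lt|[lt|e]] : n < m \/ (m < n \/ m = n) by lia.
- by case: nb; exact: lattice_low_left km.
- case: (swap_neg nb); apply: (@lattice_low_left _ _ n m) => //; first exact: good_swap.
    by rewrite pull_swap.
  by rewrite pull_swap.
(* For m = n >= 2 the point (-1,-1) is interior to the triangle with vertices (1,0), (0,1),
   (-m,-m). *)
- have [//|m2] : (m = 1 /\ n = 1) \/ 2 <= m by lia.
  have mR : 2 <= m%:~R :> R by rewrite (ler_int _ 2 m).
  have [p [q [pq h]]] : separated K (-1) (-1) := sK (-1) (-1) isT.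
  have := (h _ _ K0, h _ _ ka, h _ _ kb) => -[[h0 ha] hb].
  have := h _ _ km; rewrite -e !rmorphN /= => hk.
  have : 0 <= (m%:~R - 2) * - (p + q) by apply: mulr_ge0; bound_lra.
  move=> hh; have p0 : p = 0 by lra.
  by have q0 : q = 0 by [lra]; move: pq; rewrite p0 q0 eqxx.
Qed.

Lemma lattice_high_diag (R : realFieldType) (K : R -> R -> Prop) (m n : int) :
  good K -> K 1 0 -> K 0 1 -> 1 <= m -> 1 <= n -> K m%:~R n%:~R -> K 1 1.
Proof.
move=> [cK _ W K0 sK] ka kb m1 n1 km.
have nR : 1 <= n%:~R :> R by rewrite ler1z.
have mR : 1 <= m%:~R :> R by rewrite ler1z.
have s0 : 0 < m%:~R + n%:~R - 1 :> R by lra.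
have g1 : 0 <= (n%:~R - 1) / (m%:~R + n%:~R - 1) :> R by rewrite divr_ge0; lra.
have g2 : 0 <= (m%:~R - 1) / (m%:~R + n%:~R - 1) :> R by rewrite divr_ge0; lra.
have g3 : 0 < 1 / (m%:~R + n%:~R - 1) :> R by rewrite divr_gt0.
have g4 : (n%:~R - 1) / (m%:~R + n%:~R - 1) + (m%:~R - 1) / (m%:~R + n%:~R - 1)
    + 1 / (m%:~R + n%:~R - 1) = 1 :> R by field_lra.
have := convex2_comb3 cK ka kb km g1 g2 g3 g4.
by congr K; field_lra.
Qed.

Lemma lattice_of_basis (R : realFieldType) (K : R -> R -> Prop) (i j : int) :
  good K -> ~ big_triangle K -> K 1 0 -> K 0 1 -> ~ K 1 1 -> ~ K 1 (-1) -> ~ K (-1) 1 ->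
  (i != 0) || (j != 0) -> K i%:~R j%:~R ->
  [\/ (i = 1 /\ j = 0) \/ (i = 0 /\ j = 1), i = -1 /\ j = 0, i = 0 /\ j = -1 |
    i = -1 /\ j = -1].
Proof.
move=> gK nb ka kb n1 n2 n3 ij kij.
have gK' := good_swap gK; have nb' := swap_neg nb.
have ka' : pull K 0 1 1 0 1 0 by rewrite pull_swap.
have kb' : pull K 0 1 1 0 0 1 by rewrite pull_swap.
have [j0|jn] := eqVneq j 0.
  move: kij ij; rewrite j0 orbF => kij i0.
  have [//|i1] := lattice_on_axis gK ka kb kij.
  have [->|->] : i = 1 \/ i = -1 by lia.
    by constructor 1; left.
  by constructor 2.
have [i0|iN] := eqVneq i 0.
  move: kij; rewrite i0 => kij.
  have kij' : pull K 0 1 1 0 j%:~R 0 by rewrite pull_swap.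
  have [//|j1] := lattice_on_axis gK' ka' kb' kij'.
  have [->|->] : j = 1 \/ j = -1 by lia.
    by constructor 1; right.
  by constructor 3.
have [[i1 j1]|[[i1 j1]|[[i1 j1]|[i1 j1]]]] : (1 <= i /\ 1 <= j) \/ ((1 <= i /\ j <= -1) \/
    ((i <= -1 /\ 1 <= j) \/ (i <= -1 /\ j <= -1))) by lia.
- by case: n1; exact: lattice_high_diag kij.
- have [//|] : big_triangle K \/ K 1 (-1).
    by apply: (@lattice_low_right _ K i (- j)) => //; rewrite ?opprK //; lia.
  by [].
- have [//|] : big_triangle (pull K 0 1 1 0) \/ pull K 0 1 1 0 1 (-1).
    by apply: (@lattice_low_right _ _ j (- i)) => //; rewrite ?pull_swap ?opprK //; lia.
  by rewrite pull_swap.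
- have [|||m1 m2] := @lattice_low_diag _ K (- i) (- j) gK nb ka kb; rewrite ?opprK //; try lia.
  by constructor 4; lia.
Qed.

Lemma ge2_int (R : realFieldType) (i : int) : 1 <= i -> i != 1 -> 2 <= i%:~R :> R.
Proof. by move=> i1 iN; rewrite (ler_int _ 2 i); lia. Qed.

Lemma lattice_of_square (R : realFieldType) (K : R -> R -> Prop) (i j : int) :
  good K -> ~ big_triangle K -> K 1 0 -> K 0 1 -> K 1 1 ->
  (i != 0) || (j != 0) -> K i%:~R j%:~R ->
  [\/ [\/ i = 1 /\ j = 0, i = 0 /\ j = 1 | i = 1 /\ j = 1],
    i = -1 /\ j = 0, i = 0 /\ j = -1 | i = -1 /\ j = -1].
Proof.
move=> gK nb ka kb kc ij kij; have [cK _ W K0 sK] := gK.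
have nd : ~ K 1 (-1).
  move=> k; apply: nb; apply: (@edge_basis _ _ 0 1 1 0) => //; first by right.
have nd' : ~ K (-1) 1.
  move=> k; apply: nb; apply: (@edge_basis _ _ 1 0 0 1) => //; first by left.
have gK' := good_swap gK; have nb' := swap_neg nb.
have ka' : pull K 0 1 1 0 1 0 by rewrite pull_swap.
have kb' : pull K 0 1 1 0 0 1 by rewrite pull_swap.
have [j0|jn] := eqVneq j 0.
  move: kij ij; rewrite j0 orbF => kij i0.
  have [//|i1] := lattice_on_axis gK ka kb kij.
  have [->|->] : i = 1 \/ i = -1 by lia.
    by constructor 1; constructor 1.
  by constructor 2.
have [i0|iN] := eqVneq i 0.
  move: kij; rewrite i0 => kij.
  have kij' : pull K 0 1 1 0 j%:~R 0 by rewrite pull_swap.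
  have [//|j1] := lattice_on_axis gK' ka' kb' kij'.
  have [->|->] : j = 1 \/ j = -1 by lia.
    by constructor 1; constructor 2.
  by constructor 3.
have [[i1 j1]|[[i1 j1]|[[i1 j1]|[i1 j1]]]] : (1 <= i /\ 1 <= j) \/ ((1 <= i /\ j <= -1) \/
    ((i <= -1 /\ 1 <= j) \/ (i <= -1 /\ j <= -1))) by lia.
(* A supporting line at (1,1) has nonnegative coefficients, so a further point of the quadrant lies
   on it. That line is then vertical or horizontal, and contains three consecutive lattice points of
   K. *)
- constructor 1; constructor 3.
  have iR : 1 <= i%:~R :> R by rewrite ler1z.
  have jR : 1 <= j%:~R :> R by rewrite ler1z.
  have [p [q [pq h]]] : separated K 1 1 := sK 1 1 isT.
  have := (h _ _ ka, h _ _ kb, h _ _ kij) => -[[ha hb] hk].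
  have p0 : 0 <= p by lra.
  have q0 : 0 <= q by lra.
  have mp : 0 <= p * (i%:~R - 1) by apply: mulr_ge0; bound_lra.
  have mq : 0 <= q * (j%:~R - 1) by apply: mulr_ge0; bound_lra.
  have ep : p * (i%:~R - 1) = 0 by lra.
  have eq : q * (j%:~R - 1) = 0 by lra.
  have [iE|iNE] := eqVneq i 1; have [jE|jNE] := eqVneq j 1; first by [].
  + case: nb; apply: (@edge_basis _ _ 0 1 1 1) => //; first by right.
    have j2 : 2 <= j%:~R :> R := ge2_int R j1 jNE.
    have t1 : 0 <= (1 : R) / (j%:~R - 1) <= 1 by rewrite divr_ge0 ?ler_pdivrMr; lra.
    by have := cK _ _ _ _ _ kc kij t1; congr K; rewrite ?iE ?rmorphD /=; field_lra.
  + case: nb; apply: (@edge_basis _ _ 1 0 1 1) => //; first by left.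
    have i2 : 2 <= i%:~R :> R := ge2_int R i1 iNE.
    have t1 : 0 <= (1 : R) / (i%:~R - 1) <= 1 by rewrite divr_ge0 ?ler_pdivrMr; lra.
    by have := cK _ _ _ _ _ kc kij t1; congr K; rewrite ?jE ?rmorphD /=; field_lra.
  + have i2 : 2 <= i%:~R :> R := ge2_int R i1 iNE.
    have j2 : 2 <= j%:~R :> R := ge2_int R j1 jNE.
    have hp : 0 <= p * (i%:~R - 2) by apply: mulr_ge0; bound_lra.
    have hq : 0 <= q * (j%:~R - 2) by apply: mulr_ge0; bound_lra.
    have p00 : p = 0 by lra.
    have q00 : q = 0 by lra.
    by move: pq; rewrite p00 q00 eqxx.
- have [//|] : big_triangle K \/ K 1 (-1).
    by apply: (@lattice_low_right _ K i (- j)) => //; rewrite ?opprK //; lia.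
  by [].
- have [//|] : big_triangle (pull K 0 1 1 0) \/ pull K 0 1 1 0 1 (-1).
    by apply: (@lattice_low_right _ _ j (- i)) => //; rewrite ?pull_swap ?opprK //; lia.
  by rewrite pull_swap.
- have [|||m1 m2] := @lattice_low_diag _ K (- i) (- j) gK nb ka kb; rewrite ?opprK //; try lia.
  by constructor 4; lia.
Qed.

(** * Bodies not containing a unit square *)

Local Notation smul := (mulr0, mulr1, mulrN1, addr0, add0r, opprK).

Lemma wide3_pull (R : realFieldType) (K : R -> R -> Prop) (a b c d : int) :
  a * d - b * c = 1 \/ a * d - b * c = -1 -> good K -> wide3 (pull K a b c d).
Proof. by move=> det /(good_pull det) []. Qed.

Lemma ratioP (R : realFieldType) (a b : R) : 0 < a <= b -> exists2 r, 0 < r <= 1 & a = b * r.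
Proof.
move=> /andP[a0 ab]; have b0 := lt_le_trans a0 ab.
exists (a / b); first by rewrite divr_gt0 //= ler_pdivrMr // mul1r.
by rewrite mulrC divfK // lt0r_neq0.
Qed.

Lemma ratio0P (R : realFieldType) (a b : R) : 0 < b -> 0 <= a <= b ->
  exists2 r, 0 <= r <= 1 & a = b * r.
Proof.
move=> b0 /andP[a0 ab].
exists (a / b); first by rewrite divr_ge0 ?(ltW b0) //= ler_pdivrMr // mul1r.
by rewrite mulrC divfK // lt0r_neq0.
Qed.

Lemma below_scale (R : realFieldType) (K : R -> R -> Prop) (s p q c p' q' c' : R) : 0 < s ->
  below K p' q' c' -> p' = s * p -> q' = s * q -> c' = s * c -> below K p q c.
Proof.
by move=> s0 h ep eq ec x y /h; rewrite ep eq ec -!mulrA -mulrDr ler_pM2l.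
Qed.

Lemma below_swap (R : realFieldType) (K : R -> R -> Prop) (p q c : R) :
  below K p q c -> below (pull K 0 1 1 0) q p c.
Proof. by move=> h x y; rewrite pull_swap => /h; rewrite addrC. Qed.

Lemma supports_swap (R : realFieldType) (K : R -> R -> Prop) (p q x y : R) :
  supports K p q x y -> supports (pull K 0 1 1 0) q p y x.
Proof.
by move=> [z h]; split; [rewrite orbC|move=> u v; rewrite pull_swap => /h; lra].
Qed.

Lemma not_both0 (R : realFieldType) (p q : R) : (p != 0) || (q != 0) -> p = 0 -> q = 0 -> False.
Proof. by move=> h p0 q0; move: h; rewrite p0 q0 eqxx. Qed.

(** The homogeneous form, with coefficients as they come from [separated]; dividing by the dominant
    coefficient of each line gives the tilts. *)
Lemma low_triangle_lines (R : realFieldType) (K : R -> R -> Prop) (a u s S t T : R) :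
  wide3 K -> 0 <= a -> a + a < u -> 0 < s <= S -> 0 < t <= T ->
  below K a (- u) a -> below K (- S) s S -> below K t T T -> False.
Proof.
move=> W a0 au sS tT La Lc Lb.
have u0 : 0 < u by lra.
have [sp _] := andP sS; have [tp _] := andP tT.
have S0 : 0 < S by lra.
have T0 : 0 < T by lra.
have au' : 0 <= a <= u by apply/andP; split; lra.
have [r /andP[r0 r1] aE] := ratio0P u0 au'.
have [s' s'01 sE] := ratioP sS; have [t' t'01 tE] := ratioP tT.
apply: (low_triangle W (A := r) (s := s') (t := t')) => //.
- rewrite r0 /= -(ltr_pM2l u0) -aE; lra.
- by apply: (below_scale u0 La); rewrite ?aE; ring.
- by apply: (below_scale S0 Lc); rewrite ?sE; ring.
- by apply: (below_scale T0 Lb); rewrite ?tE; ring.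
Qed.

Lemma pinwheel_lines (R : realFieldType) (K : R -> R -> Prop) (a A b B c C d D : R) :
  wide3 K -> 0 < a <= A -> 0 < b <= B -> 0 < c <= C -> 0 < d <= D ->
  below K A a A -> below K (- b) B B -> below K (- C) (- c) C -> below K d (- D) D -> False.
Proof.
move=> W ha hb hc hd La Lb Lc Ld.
have pos (x X : R) : 0 < x <= X -> 0 < X by move=> /andP[]; exact: lt_le_trans.
have [q q01 aE] := ratioP ha; have [p p01 bE] := ratioP hb.
have [q' q'01 cE] := ratioP hc; have [p' p'01 dE] := ratioP hd.
apply: (pinwheel W p01 q01 p'01 q'01).
- by apply: (below_scale (pos _ _ ha) La); rewrite ?aE; ring.
- by apply: (below_scale (pos _ _ hb) Lb); rewrite ?bE; ring.
- by apply: (below_scale (pos _ _ hc) Lc); rewrite ?cE; ring.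
- by apply: (below_scale (pos _ _ hd) Ld); rewrite ?dE; ring.
Qed.

(** Once supporting functionals are fixed, each blocked diagonal becomes a choice of strict
    inequalities on their coefficients. The sign of [qa] settles the choices, and the two outcomes
    are mirror images, both refuted by [low_triangle_lines]. *)
Lemma no_diagonal_one_antipode (R : realFieldType) (K : R -> R -> Prop) :
  good K -> K 1 0 -> K 0 1 -> K (-1) 0 ->
  (blocks K 1 0 1 1 \/ (blocks K 0 1 1 1 \/ blocks K (-1) 0 1 1)) ->
  (blocks K 1 0 (-1) 1 \/ (blocks K 0 1 (-1) 1 \/ blocks K (-1) 0 (-1) 1)) ->
  (blocks K 1 0 1 (-1) \/ (blocks K 0 1 1 (-1) \/ blocks K (-1) 0 1 (-1))) ->
  (blocks K 1 0 (-1) (-1) \/ (blocks K 0 1 (-1) (-1) \/ blocks K (-1) 0 (-1) (-1))) ->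
  False.
Proof.
move=> gK ka kb kc; have [cK _ W K0 sK] := gK.
have [pa [qa sa]] : separated K 1 0 := sK 1 0 isT.
have [pb [qb sb]] : separated K 0 1 := sK 0 1 isT.
have [pc [qc sc]] : separated K (-1) 0 := sK (-1) 0 isT.
have [[za ha] [zb hb] [zc hc]] := And3 sa sb sc.
have := (ha _ _ K0, ha _ _ kb, hb _ _ K0, hb _ _ ka, hb _ _ kc).
rewrite !smul => -[[[[a1 a2] b1] b2] b3].
have := (hc _ _ K0, hc _ _ kb); rewrite !smul => -[c1 c2].
move: ha hb hc; rewrite !smul => ha hb hc.
move=> D1 D2 D3 D4.
(* Of the possible blockers of each diagonal, those contradicting that K contains the origin and the
   other points are discarded. *)
have {}D1 : 0 < qa \/ 0 < pb.
  case: D1 => [/(_ _ _ sa)|[/(_ _ _ sb)|/(_ _ _ sc)]]; rewrite !smul => h; [left; lra|right; lra|].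
  by exfalso; apply: (not_both0 zc); lra.
have {}D2 : pb < 0 \/ 0 < qc.
  case: D2 => [/(_ _ _ sa)|[/(_ _ _ sb)|/(_ _ _ sc)]]; rewrite !smul => h; [|left; lra|right; lra].
  by exfalso; apply: (not_both0 za); lra.
have {}D3 : qa < 0 \/ qc < pc + pc.
  by case: D3 => [/(_ _ _ sa)|[/(_ _ _ sb)|/(_ _ _ sc)]]; rewrite !smul => h; [left| |right]; lra.
have {}D4 : qa < - (pa + pa) \/ qc < 0.
  by case: D4 => [/(_ _ _ sa)|[/(_ _ _ sb)|/(_ _ _ sc)]]; rewrite !smul => h; [left| |right]; lra.
clear sa sb sc za zb zc.
have [qa0|qa0] := ltrP 0 qa.
- have qc0 : qc < pc + pc by case: D3 => //; lra.
  have pb0 : pb < 0 by case: D2 => //; lra.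
  have m : (-1 : int) * 1 - 0 * 0 = 1 \/ (-1 : int) * 1 - 0 * 0 = -1 by right.
  have Ls p q c : below K p q c -> below (pull K (-1) 0 0 1) (- p) q c.
    by move=> h x y /h; lra.
  apply: (@low_triangle_lines _ (pull K (-1) 0 0 1) (- pc) (- qc) qa pa (- pb) qb).
  + exact: wide3_pull m gK.
  + by [].
  + by lra.
  + by rewrite qa0.
  + by apply/andP; split; lra.
  + by rewrite opprK; exact: Ls.
  + exact: Ls.
  + exact: Ls.
- have pb0 : 0 < pb by case: D1 => //; lra.
  have qc0 : 0 < qc by case: D2 => //; lra.
  have qa1 : qa < - (pa + pa) by case: D4 => //; lra.
  apply: (@low_triangle_lines _ K pa (- qa) qc (- pc) pb qb W) => //.
  + by lra.
  + by rewrite qc0.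
  + by rewrite pb0.
  + by rewrite opprK.
  + by rewrite opprK.
Qed.

(** The sign of [qa] propagates through [D1] to [D4] around the four points, so all lines turn in
    the same sense and form a pinwheel, up to exchanging the coordinates. *)
Lemma no_diagonal_two_antipodes (R : realFieldType) (K : R -> R -> Prop) :
  good K -> K 1 0 -> K 0 1 -> K (-1) 0 -> K 0 (-1) ->
  (blocks K 1 0 1 1 \/ blocks K 0 1 1 1 \/ blocks K (-1) 0 1 1 \/ blocks K 0 (-1) 1 1) ->
  (blocks K 1 0 (-1) 1 \/ blocks K 0 1 (-1) 1 \/ blocks K (-1) 0 (-1) 1 \/ blocks K 0 (-1) (-1) 1) ->
  (blocks K 1 0 1 (-1) \/ blocks K 0 1 1 (-1) \/ blocks K (-1) 0 1 (-1) \/ blocks K 0 (-1) 1 (-1)) ->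
  (blocks K 1 0 (-1) (-1) \/ blocks K 0 1 (-1) (-1) \/ blocks K (-1) 0 (-1) (-1)
    \/ blocks K 0 (-1) (-1) (-1)) ->
  False.
Proof.
move=> gK ka kb kc kd; have [cK _ W K0 sK] := gK.
have [pa [qa sa]] : separated K 1 0 := sK 1 0 isT.
have [pb [qb sb]] : separated K 0 1 := sK 0 1 isT.
have [pc [qc sc]] : separated K (-1) 0 := sK (-1) 0 isT.
have [pd [qd sd]] : separated K 0 (-1) := sK 0 (-1) isT.
have [[za ha] [zb hb] [zc hc] [zd hd]] := And4 sa sb sc sd.
have := (ha _ _ kd, ha _ _ kb, hb _ _ ka, hb _ _ kc); rewrite !smul => -[[[a1 a2] b2] b3].
have := (hc _ _ kd, hc _ _ kb, hd _ _ ka, hd _ _ kc); rewrite !smul => -[[[c1 c2] d1] d2].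
move: ha hb hc hd; rewrite !smul => ha hb hc hd.
move=> D1 D2 D3 D4.
have pan : 0 < pa by rewrite ltNge; apply/negP => ?; apply: (not_both0 za); lra.
have qbn : 0 < qb by rewrite ltNge; apply/negP => ?; apply: (not_both0 zb); lra.
have pcn : 0 < - pc by rewrite ltNge; apply/negP => ?; apply: (not_both0 zc); lra.
have qdn : 0 < - qd by rewrite ltNge; apply/negP => ?; apply: (not_both0 zd); lra.
have {}D1 : 0 < qa \/ 0 < pb.
  by case: D1 => [/(_ _ _ sa)|[/(_ _ _ sb)|[/(_ _ _ sc)|/(_ _ _ sd)]]]; rewrite !smul => h; [left| right| |]; lra.
have {}D2 : pb < 0 \/ 0 < qc.
  by case: D2 => [/(_ _ _ sa)|[/(_ _ _ sb)|[/(_ _ _ sc)|/(_ _ _ sd)]]]; rewrite !smul => h; [|left|right|]; lra.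
have {}D3 : qa < 0 \/ 0 < pd.
  by case: D3 => [/(_ _ _ sa)|[/(_ _ _ sb)|[/(_ _ _ sc)|/(_ _ _ sd)]]]; rewrite !smul => h; [left| | |right]; lra.
have {}D4 : qc < 0 \/ pd < 0.
  by case: D4 => [/(_ _ _ sa)|[/(_ _ _ sb)|[/(_ _ _ sc)|/(_ _ _ sd)]]]; rewrite !smul => h; [| |left|right]; lra.
clear sa sb sc sd za zb zc zd.
have [qa0|qa0] := ltrP 0 qa.
- have pd0 : 0 < pd by case: D3 => // ?; lra.
  have qc0 : qc < 0 by case: D4 => // ?; lra.
  have pb0 : pb < 0 by case: D2 => // ?; lra.
  apply: (@pinwheel_lines _ K qa pa (- pb) qb (- qc) (- pc) pd (- qd) W); rewrite ?opprK //.
  + by rewrite qa0.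
  + by rewrite oppr_gt0 pb0.
  + by rewrite oppr_gt0 qc0.
  + by rewrite pd0.
- have pb0 : 0 < pb by case: D1 => // ?; lra.
  have qc0 : 0 < qc by case: D2 => // ?; lra.
  have pd0 : pd < 0 by case: D4 => // ?; lra.
  have qa1 : qa < 0 by case: D3 => // ?; lra.
  apply: (@pinwheel_lines _ (pull K 0 1 1 0) pb qb (- qa) pa (- pd) (- qd) qc (- pc)); rewrite ?opprK.
  + exact: wide3_pull swap_det gK.
  + by rewrite pb0.
  + by rewrite oppr_gt0 qa1.
  + by rewrite oppr_gt0 pd0.
  + by rewrite qc0.
  + exact: below_swap.
  + exact: below_swap.
  + exact: below_swap.
  + exact: below_swap.
Qed.

(** The order-three map (1,0) -> (0,1) -> (-1,-1) -> (1,0) permutes the lines cyclically and moves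
    the largest tilt to the place of [q2]. *)
Lemma cyclic_tilts_good (R : realFieldType) (K : R -> R -> Prop) (q0 q2 q4 : R) :
  good K -> 0 < q0 <= 1 -> 0 < q2 <= 1 -> 0 < q4 <= 1 ->
  below K 1 q0 1 -> below K (- (1 + q2)) 1 1 -> below K q4 (- (1 + q4)) 1 -> False.
Proof.
have key (K' : R -> R -> Prop) (r0 r2 r4 : R) : good K' -> 0 < r0 <= 1 -> 0 < r2 <= 1 ->
    0 < r4 <= 1 -> r0 <= r2 -> r4 <= r2 ->
    below K' 1 r0 1 -> below K' (- (1 + r2)) 1 1 -> below K' r4 (- (1 + r4)) 1 -> False.
  move=> [_ _ W _ _] /andP[a0 a1] /andP[b0 b1] /andP[c0 c1] ab cb.
  by apply: cyclic_tilts => //; rewrite ?a0 ?c0.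
move=> gK h0 h2 h4 L0 L2 L4.
have det1 : (0 : int) * -1 - -1 * 1 = 1 \/ (0 : int) * -1 - -1 * 1 = -1 by left.
have rot (K' : R -> R -> Prop) (r0 r2 r4 : R) :
    below K' 1 r0 1 -> below K' (- (1 + r2)) 1 1 -> below K' r4 (- (1 + r4)) 1 ->
    [/\ below (pull K' 0 (-1) 1 (-1)) 1 r2 1, below (pull K' 0 (-1) 1 (-1)) (- (1 + r4)) 1 1
      & below (pull K' 0 (-1) 1 (-1)) r0 (- (1 + r0)) 1].
  by move=> l0 l2 l4; split=> x y k; [have := l2 _ _ k|have := l4 _ _ k|have := l0 _ _ k]; lra.
have [L2' L4' L0'] := rot _ _ _ _ L0 L2 L4.
have [L4'' L0'' L2''] := rot _ _ _ _ L2' L4' L0'.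
have gK' := good_pull det1 gK; have gK'' := good_pull det1 gK'.
have [[a b]|[[a b]|[a b]]] : (q0 <= q2 /\ q4 <= q2) \/ (q2 <= q4 /\ q0 <= q4) \/ (q4 <= q0 /\ q2 <= q0).
- have [?|?] := lerP q0 q2; have [?|?] := lerP q4 q2; have [?|?] := lerP q4 q0; try (by left; lra);
  try (by right; left; lra); by right; right; lra.
- exact: (key K q0 q2 q4).
- exact: (key _ q2 q4 q0 gK').
- exact: (key _ q4 q0 q2 gK'').
Qed.

Lemma three_vertices_cyclic (R : realFieldType) (K : R -> R -> Prop) (pa qa pb qb pc qc : R) :
  good K -> K 1 0 -> K 0 1 -> K (-1) (-1) ->
  supports K pa qa 1 0 -> supports K pb qb 0 1 -> supports K pc qc (-1) (-1) ->
  0 < qa -> pb < - qb -> 0 < pc -> False.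
Proof.
move=> gK ka kb kc [za ha] [zb hb] [zc hc]; have [cK _ W K0 sK] := gK.
have := (ha _ _ K0, ha _ _ kb, hb _ _ K0, hb _ _ ka, hb _ _ kc).
rewrite !smul => -[[[[a1 a2] b1] b2] b3].
have := (hc _ _ K0, hc _ _ ka); rewrite !smul => -[c1 c2] qa0 pb0 pc0.
move: ha hb hc; rewrite !smul => ha hb hc.
have pan : 0 < pa by lra.
have qbn : 0 < qb by rewrite ltNge; apply/negP => ?; apply: (not_both0 zb); lra.
have sn : 0 < - pc - qc by lra.
clear za zb zc.
have qaP : 0 < qa <= pa by rewrite qa0.
have pbP : 0 < - pb - qb <= qb by apply/andP; split; lra.
have pcP : 0 < pc <= - pc - qc by rewrite pc0.
have [[q0 q001 aE] [q2 q201 bE] [q4 q401 cE]] := And3 (ratioP qaP) (ratioP pbP) (ratioP pcP).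
apply: (@cyclic_tilts_good _ K q0 q2 q4) => //.
- by apply: (below_scale pan ha); rewrite ?mulr1.
- by apply: (below_scale qbn hb); rewrite ?mulr1 // mulrN mulrDr -bE; ring.
- by apply: (below_scale sn hc); rewrite ?mulr1 // mulrN mulrDr -cE; ring.
Qed.

Lemma three_vertices (R : realFieldType) (K : R -> R -> Prop) :
  good K -> K 1 0 -> K 0 1 -> K (-1) (-1) ->
  (blocks K 1 0 1 1 \/ blocks K 0 1 1 1 \/ blocks K (-1) (-1) 1 1) ->
  (blocks K 1 0 (-1) 0 \/ blocks K 0 1 (-1) 0 \/ blocks K (-1) (-1) (-1) 0) ->
  (blocks K 1 0 0 (-1) \/ blocks K 0 1 0 (-1) \/ blocks K (-1) (-1) 0 (-1)) -> False.
Proof.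
move=> gK ka kb kc; have [cK _ W K0 sK] := gK.
have [pa [qa sa]] : separated K 1 0 := sK 1 0 isT.
have [pb [qb sb]] : separated K 0 1 := sK 0 1 isT.
have [pc [qc sc]] : separated K (-1) (-1) := sK (-1) (-1) isT.
have [[za ha] [zb hb] [zc hc]] := And3 sa sb sc.
have := (ha _ _ K0, hb _ _ K0, hc _ _ K0); rewrite !smul => -[[a1 b1] c1].
move=> D1 D2 D3.
have {}D1 : 0 < qa \/ 0 < pb.
  by case: D1 => [/(_ _ _ sa)|[/(_ _ _ sb)|/(_ _ _ sc)]]; rewrite !smul => h; [left|right|]; lra.
have {}D2 : pb < - qb \/ 0 < qc.
  by case: D2 => [/(_ _ _ sa)|[/(_ _ _ sb)|/(_ _ _ sc)]]; rewrite !smul => h; [|left|right]; lra.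
have {}D3 : qa < - pa \/ 0 < pc.
  by case: D3 => [/(_ _ _ sa)|[/(_ _ _ sb)|/(_ _ _ sc)]]; rewrite !smul => h; [left| |right]; lra.
have [qa0|qa0] := ltrP 0 qa.
  have pc0 : 0 < pc by case: D3 => // ?; lra.
  have pb0 : pb < - qb by case: D2 => // ?; lra.
  exact: (@three_vertices_cyclic _ K pa qa pb qb pc qc).
have pb0 : 0 < pb by case: D1 => // ?; lra.
have qc0 : 0 < qc by case: D2 => // ?; lra.
have qa1 : qa < - pa by case: D3 => // ?; lra.
apply: (@three_vertices_cyclic _ (pull K 0 1 1 0) qb pb qa pa qc pc); rewrite ?pull_swap //.
- exact: good_swap.
- exact: supports_swap.
- exact: supports_swap.
- exact: supports_swap.
Qed.

(** * Bodies containing the unit square *)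

Definition square (R : realFieldType) (K : R -> R -> Prop) : Prop :=
  [/\ K 1 0, K 0 1 & K 1 1].

Lemma square_swap (R : realFieldType) (K : R -> R -> Prop) : square K -> square (pull K 0 1 1 0).
Proof. by move=> [? ? ?]; split; rewrite pull_swap. Qed.

Lemma square_corner (R : realFieldType) (K : R -> R -> Prop) : good K -> square K ->
  exists2 al, 0 <= al <= 1 & below K al (1 - al) 1.
Proof.
move=> [cK _ W K0 sK] [ka kb kc].
have [p [q [z h]]] : separated K 1 1 := sK 1 1 isT.
have := (h _ _ ka, h _ _ kb); rewrite !smul => -[h1 h2].
have pq : 0 < p + q by rewrite ltNge; apply/negP => ?; apply: (not_both0 z); lra.
have [|al al01 pE] := ratio0P pq (a := p); first by apply/andP; split; lra.
exists al => //; move: h; rewrite !smul => h.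
by apply: (below_scale pq h); rewrite ?mulr1 // mulrBr mulr1 -pE; ring.
Qed.

(** The condition p0 < - q0 says that the line at (1,0) leaves out (0,-1); p0 + p0 < - q0 says that
    it leaves out (-1,-1) as well. *)
Lemma square_right_line (R : realFieldType) (K : R -> R -> Prop) (p0 q0 : R) : good K ->
  supports K p0 q0 1 0 -> p0 < - q0 ->
  exists2 B, 0 <= B < 1 /\ (p0 + p0 < - q0 -> B < 1 / 2) & below K B (-1) B.
Proof.
move=> [cK _ W K0 sK] [z h] t.
have := h _ _ K0; move: h; rewrite !smul => h a0.
have q0n : 0 < - q0 by lra.
have [|B /andP[B0 B1] pE] := ratio0P q0n (a := p0); first by apply/andP; split; lra.
exists B; last by apply: (below_scale q0n h); rewrite ?mulrN1 ?opprK.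
split; first by rewrite B0 /= -(ltr_pM2l q0n) -pE mulr1.
by move=> t'; rewrite -(ltr_pM2l q0n) -pE; lra.
Qed.

Lemma square_two_tilts (R : realFieldType) (K : R -> R -> Prop) (p0 q0 p2 q2 : R) :
  good K -> square K -> supports K p0 q0 1 0 -> supports K p2 q2 0 1 ->
  p0 < - q0 -> q2 < - p2 -> False.
Proof.
move=> gK sq s0 s2 t0 t2; have [al al01 L1] := square_corner gK sq.
have [B [B01 _] L0] := square_right_line gK s0 t0.
have [C [C01 _] L2] := square_right_line (good_swap gK) (supports_swap s2) t2.
have [_ _ W _ _] := gK.
apply: (mutual_tilts W al01 B01 C01 L1 L0) => x y k.
by have := L2 y x; rewrite pull_swap => /(_ k); rewrite addrC.
Qed.

Lemma square_left_facts (R : realFieldType) (K : R -> R -> Prop) (p2 q2 p3 q3 : R) :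
  good K -> square K -> K (-1) 0 -> supports K p2 q2 0 1 -> supports K p3 q3 (-1) 0 ->
  [/\ exists2 ga, 0 <= ga <= 1 & below K (- ga) 1 1,
     q3 < 0 -> exists2 d, 0 < d <= 1 /\ - q3 = (- p3 - q3) * d
        & below K (- (1 - d)) (- d) (1 - d)
   & 0 <= q3 -> exists2 si, 0 <= si <= 1 & below K (-1) si 1].
Proof.
move=> [cK _ W K0 sK] [ka kb kc] kd [z2 h2] [z3 h3].
have := (h2 _ _ K0, h2 _ _ kc, h2 _ _ kd, h3 _ _ K0, h3 _ _ kb).
move: h2 h3; rewrite !smul => h2 h3 [[[[a1 a2] a3] b1] b2].
split=> [|q3n|q30].
- have q2n : 0 < q2 by rewrite ltNge; apply/negP => ?; apply: (not_both0 z2); lra.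
  have [|ga ga01 pE] := ratio0P q2n (a := - p2); first by apply/andP; split; lra.
  by exists ga => //; apply: (below_scale q2n h2); rewrite ?mulr1 // mulrN -pE opprK.
- have s : 0 < - p3 - q3 by lra.
  have [|d d01 qE] := ratioP (a := - q3) (b := - p3 - q3); first by apply/andP; split; lra.
  exists d => //; apply: (below_scale s h3); rewrite ?mulrN ?mulrBr ?mulr1 -?qE; ring.
- have p3n : 0 < - p3 by rewrite ltNge; apply/negP => ?; apply: (not_both0 z3); lra.
  have [|si si01 qE] := ratio0P p3n (a := q3); first by apply/andP; split; lra.
  by exists si => //; apply: (below_scale p3n h3); rewrite ?mulr1 ?mulrN1 ?opprK.
Qed.

Lemma square_tilts_apart (R : realFieldType) (K : R -> R -> Prop) (p0 q0 p3 q3 : R) :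
  good K -> square K -> K (-1) 0 -> supports K p0 q0 1 0 -> supports K p3 q3 (-1) 0 ->
  p0 < - q0 -> q3 < 0 -> False.
Proof.
move=> gK sq kd s0 s3 t0 t3; have [al al01 L1] := square_corner gK sq.
have [_ _ W _ sK] := gK.
have [B [B01 _] L0] := square_right_line gK s0 t0.
have [p2 [q2 s2]] : separated K 0 1 := sK 0 1 isT.
have [[ga ga01 L2] /(_ t3) [d [d01 _] L3] _] := square_left_facts gK sq kd s2 s3.
exact: (tilts_apart W al01 B01 ga01 d01 L1 L0 L2 L3).
Qed.

Lemma square_steep_tilt (R : realFieldType) (K : R -> R -> Prop) (p0 q0 p3 q3 : R) :
  good K -> square K -> K (-1) 0 -> supports K p0 q0 1 0 -> supports K p3 q3 (-1) 0 ->
  p0 + p0 < - q0 -> False.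
Proof.
move=> gK sq kd s0 s3 t0; have [_ _ W K0 sK] := gK.
have p00 : 0 <= p0 by have [_ /(_ _ _ K0)] := s0; rewrite !smul.
have t0' : p0 < - q0 by lra.
have [q3n|q30] := ltrP q3 0; first exact: (square_tilts_apart gK sq kd s0 s3).
have [al al01 L1] := square_corner gK sq.
have [B [/andP[B0 _] /(_ t0) B2] L0] := square_right_line gK s0 t0'.
have [p2 [q2 s2]] : separated K 0 1 := sK 0 1 isT.
have [[ga ga01 L2] _ /(_ q30) [si si01 L3]] := square_left_facts gK sq kd s2 s3.
by apply: (steep_tilt W al01 _ ga01 si01 L1 L0 L2 L3); rewrite B0.
Qed.

Lemma square_one_antipode (R : realFieldType) (K : R -> R -> Prop) :
  good K -> square K -> K (-1) 0 ->
  (blocks K 1 0 0 (-1) \/ blocks K (-1) 0 0 (-1)) ->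
  (blocks K 1 0 (-1) (-1) \/ blocks K (-1) 0 (-1) (-1)) -> False.
Proof.
move=> gK sq kd; have [[cK _ W K0 sK] [ka kb kc]] := (gK, sq).
have [p0 [q0 s0]] : separated K 1 0 := sK 1 0 isT.
have [p3 [q3 s3]] : separated K (-1) 0 := sK (-1) 0 isT.
move=> D5 [/(_ _ _ s0)|/(_ _ _ s3)]; rewrite !smul => h4.
  by apply: (square_steep_tilt gK sq kd s0 s3); lra.
case: D5 => [/(_ _ _ s0)|/(_ _ _ s3)]; rewrite !smul => h5.
  by apply: (square_tilts_apart gK sq kd s0 s3); lra.
(* The remaining case is a mirror image of the first: this map exchanges (1,0) with (-1,0), (0,1)
   with (1,1), and (0,-1) with (-1,-1). *)
have det : (-1 : int) * 1 - 1 * 0 = 1 \/ (-1 : int) * 1 - 1 * 0 = -1 by right.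
have s3' : supports K p3 q3 ((-1)%:~R * 1 + 1%:~R * 0) (0%:~R * 1 + 1%:~R * 0).
  by move: s3; congr supports; rewrite ?rmorphN; ring.
have s0' : supports K p0 q0 ((-1)%:~R * (-1) + 1%:~R * 0) (0%:~R * (-1) + 1%:~R * 0).
  by move: s0; congr supports; rewrite ?rmorphN; ring.
apply: (square_steep_tilt (good_pull det gK) _ _ (supports_pull det s3') (supports_pull det s0')).
- split; rewrite /pull.
  + by move: kd; congr K; rewrite ?rmorphN; ring.
  + by move: kc; congr K; rewrite ?rmorphN; ring.
  + by move: kb; congr K; rewrite ?rmorphN; ring.
- by rewrite /pull; move: ka; congr K; rewrite ?rmorphN; ring.
- by rewrite rmorphN !rmorph1 rmorph0; lra.
Qed.

Lemma square_opposite (R : realFieldType) (K : R -> R -> Prop) :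
  good K -> square K -> K (-1) (-1) -> blocks K 0 1 (-1) 0 -> blocks K (-1) (-1) 0 (-1) -> False.
Proof.
move=> gK sq kd D3 D5; have [al al01 L1] := square_corner gK sq.
have [[cK _ W K0 sK] [ka kb kc]] := (gK, sq).
have [p0 [q0 s0]] : separated K 1 0 := sK 1 0 isT.
have [p2 [q2 s2]] : separated K 0 1 := sK 0 1 isT.
have [p4 [q4 s4]] : separated K (-1) (-1) := sK (-1) (-1) isT.
have := (D3 _ _ s2, D5 _ _ s4); rewrite !smul => -[{}D3 {}D5].
have [t0|t0] := ltrP p0 (- q0); first by apply: (square_two_tilts gK sq s0 s2); lra.
have [[z0 h0] [z2 h2] [z4 h4]] := And3 s0 s2 s4.
have := (h0 _ _ K0, h0 _ _ kc, h2 _ _ K0, h2 _ _ kd, h4 _ _ K0, h4 _ _ ka).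
move: h0 h2 h4; rewrite !smul => h0 h2 h4 [[[[[a1 a2] b1] b2] c1] c2].
have p0n : 0 < p0 by rewrite ltNge; apply/negP => ?; apply: (not_both0 z0); lra.
have p2n : 0 < - p2 by lra.
have s4n : 0 < - p4 - q4 by lra.
have [|be be01 bE] := ratio0P p0n (a := - q0); first by apply/andP; split; lra.
have [|de /andP[de0 _] dE] := ratioP (a := - p2 - q2) (b := - p2); first by apply/andP; split; lra.
have [|et et01 eE] := ratioP (a := p4) (b := - p4 - q4); first by apply/andP; split; lra.
have de2 : 0 < de <= 1 / 2 by rewrite de0 /= -(ler_pM2l p2n) -dE; lra.
apply: (opposite_tilts W al01 be01 de2 et01 L1).
- by apply: (below_scale p0n h0); rewrite ?mulr1 // mulrN -bE opprK.
- by apply: (below_scale p2n h2); rewrite ?mulrN1 ?mulrBr ?mulr1 ?opprK // -dE; ring.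
- by apply: (below_scale s4n h4); rewrite ?mulr1 // mulrN mulrDr mulr1 -eE; ring.
Qed.

Lemma square_five (R : realFieldType) (K : R -> R -> Prop) :
  good K -> ~ big_triangle K -> square K -> K (-1) 0 -> K 0 (-1) ->
  blocks K (-1) 0 (-1) (-1) -> False.
Proof.
move=> gK nb sq kd ke D4; have [al al01 L1] := square_corner gK sq.
have [[cK _ W K0 sK] [ka kb kc]] := (gK, sq).
have [p0 [q0 [z0 h0]]] : separated K 1 0 := sK 1 0 isT.
have [p2 [q2 s2]] : separated K 0 1 := sK 0 1 isT.
have [p3 [q3 s3]] : separated K (-1) 0 := sK (-1) 0 isT.
have [p5 [q5 [z5 h5]]] : separated K 0 (-1) := sK 0 (-1) isT.
have {}D4 := D4 _ _ s3; move: D4; rewrite !smul => D4.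
have q3n : q3 < 0 by lra.
have [[ga ga01 L2] /(_ q3n) [d [/andP[d0 _] dE] L3] _] := square_left_facts gK sq kd s2 s3.
have [_ h3] := s3.
have := (h0 _ _ K0, h0 _ _ kc, h0 _ _ ke, h3 _ _ ke, h5 _ _ K0, h5 _ _ ka, h5 _ _ kd).
move: h0 h5; rewrite !smul => h0 h5 [[[[[[a1 a2] a3] b1] c1] c2] c3].
have p0n : 0 < p0 by rewrite ltNge; apply/negP => ?; apply: (not_both0 z0); lra.
have q5n : 0 < - q5 by rewrite ltNge; apply/negP => ?; apply: (not_both0 z5); lra.
have d2 : 0 < d <= 1 / 2.
  by rewrite d0 -(ler_pM2l (_ : 0 < - p3 - q3)) -?dE; lra.
have [|be be01 bE] := ratio0P p0n (a := - q0); first by apply/andP; split; lra.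
have L0 : below K 1 (- be) 1.
  by apply: (below_scale p0n h0); rewrite ?mulr1 // mulrN -bE opprK.
have [p50|p50] := lerP 0 p5.
  have [|ta ta01 tE] := ratio0P q5n (a := p5); first by apply/andP; split; lra.
  apply: (one_tilt W al01 be01 ga01 d2 ta01 L1 L0 L2 L3).
  by apply: (below_scale q5n h5); rewrite ?mulr1 ?mulrN1 ?opprK.
have s5n : 0 < - p5 - q5 by lra.
have [|d' /andP[d'0 _] d'E] := ratioP (a := - p5) (b := - p5 - q5); first by apply/andP; split; lra.
have d'2 : 0 < d' <= 1 / 2 by rewrite d'0 -(ler_pM2l s5n) -d'E; lra.
have L5 : below K (- d') (- (1 - d')) (1 - d').
  by apply: (below_scale s5n h5); rewrite ?mulrN ?mulrBr ?mulr1 -?d'E; ring.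
(* The sharp case produces the vertex (1,-2), which [lattice_of_square] excludes unless K is already
   a copy of the triangle. *)
have k' : K 1%:~R (-2)%:~R by exact: (two_tilts W al01 be01 ga01 d2 d'2 L1 L0 L2 L3 L5).
by have [[[]|[]|[]]|[]|[]|[]] := lattice_of_square gK nb ka kb kc (isT : (1 != 0 :> int) || (-2 != 0)) k'.
Qed.

Lemma square_five' (R : realFieldType) (K : R -> R -> Prop) :
  good K -> ~ big_triangle K -> square K -> K (-1) 0 -> K 0 (-1) ->
  blocks K (-1) 0 (-1) (-1) \/ blocks K 0 (-1) (-1) (-1) -> False.
Proof.
move=> gK nb sq kd ke [h|h]; first exact: (square_five gK nb sq kd ke h).
apply: (square_five (good_swap gK) (swap_neg nb) (square_swap sq)); rewrite ?pull_swap //.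
exact: blocks_swap.
Qed.

Lemma square_six (R : realFieldType) (K : R -> R -> Prop) :
  good K -> ~ big_triangle K -> square K -> K (-1) 0 -> K 0 (-1) -> K (-1) (-1) -> False.
Proof.
move=> gK nb sq kd ke kf; have [al al01 L1] := square_corner gK sq.
have [[cK _ W K0 sK] [ka kb kc]] := (gK, sq).
have [p0 [q0 [z0 h0]]] : separated K 1 0 := sK 1 0 isT.
have [p2 [q2 s2]] : separated K 0 1 := sK 0 1 isT.
have [p3 [q3 s3]] : separated K (-1) 0 := sK (-1) 0 isT.
have [p4 [q4 [z4 h4]]] : separated K (-1) (-1) := sK (-1) (-1) isT.
have [p5 [q5 [z5 h5]]] : separated K 0 (-1) := sK 0 (-1) isT.
have [z3 h3] := s3.
have q30 : 0 <= q3 by have := h3 _ _ kf; lra.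
have [[ga ga01 L2] _ /(_ q30) [si si01 L3]] := square_left_facts gK sq kd s2 s3.
have := (h0 _ _ K0, h0 _ _ kc, h0 _ _ ke, h5 _ _ K0, h5 _ _ ka, h5 _ _ kf).
have := (h4 _ _ K0, h4 _ _ kd, h4 _ _ ke).
move: h0 h4 h5; rewrite !smul => h0 h4 h5 [[e1 e2] e3] [[[[[a1 a2] a3] c1] c2] c3].
have p0n : 0 < p0 by rewrite ltNge; apply/negP => ?; apply: (not_both0 z0); lra.
have q5n : 0 < - q5 by rewrite ltNge; apply/negP => ?; apply: (not_both0 z5); lra.
have s4n : 0 < - p4 - q4 by rewrite ltNge; apply/negP => ?; apply: (not_both0 z4); lra.
have [|be be01 bE] := ratio0P p0n (a := - q0); first by apply/andP; split; lra.
have [|ta ta01 tE] := ratio0P q5n (a := p5); first by apply/andP; split; lra.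
have [|th th01 hE] := ratio0P s4n (a := - p4); first by apply/andP; split; lra.
have [|||k|k] := no_tilt W al01 be01 ga01 si01 ta01 th01 L1 _ L2 L3.
- by apply: (below_scale p0n h0); rewrite ?mulr1 // mulrN -bE opprK.
- by apply: (below_scale q5n h5); rewrite ?mulr1 ?mulrN1 ?opprK.
- by apply: (below_scale s4n h4); rewrite ?mulrN ?mulrBr ?mulr1 -?hE; ring.
- have k' : K 2%:~R 1%:~R by exact: k.
  by have [[[]|[]|[]]|[]|[]|[]] := lattice_of_square gK nb ka kb kc (isT : (2 != 0 :> int) || (1 != 0 :> int)) k'.
- have k' : K 1%:~R 2%:~R by exact: k.
  by have [[[]|[]|[]]|[]|[]|[]] := lattice_of_square gK nb ka kb kc (isT : (1 != 0 :> int) || (2 != 0 :> int)) k'.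
Qed.

(** * Wide bodies are unimodular copies of the triangle *)

Lemma saturated_pull (R : realFieldType) (K : R -> R -> Prop) (a b c d i j : int) :
  a * d - b * c = 1 \/ a * d - b * c = -1 ->
  saturated_at K (a * i + b * j) (c * i + d * j) -> saturated_at (pull K a b c d) i j.
Proof.
move=> det; rewrite /saturated_at !rmorphD !rmorphM /=.
move=> [k|[k [l [kl kk blk]]]]; [by left|right].
pose e := a * d - b * c.
have e2 : e * e = 1 by rewrite /e; case: det => ->.
pose k' := e * (d * k - b * l); pose l' := e * (a * l - c * k).
have kE : a * k' + b * l' = k.
  by transitivity ((e * e) * k); [rewrite {2}/e /k' /l'; ring|rewrite e2 mul1r].
have lE : c * k' + d * l' = l.
  by transitivity ((e * e) * l); [rewrite {2}/e /k' /l'; ring|rewrite e2 mul1r].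
exists k', l'; split.
- rewrite -negb_and; apply/negP => /andP[/eqP k0 /eqP l0].
  by move: kl; rewrite -kE -lE k0 l0 !mulr0 addr0 eqxx.
- by rewrite /pull -!rmorphM -!rmorphD /= kE lE.
- by apply: blocks_pull => //; rewrite -!rmorphM -!rmorphD /= kE lE !rmorphD !rmorphM.
Qed.

Lemma square_blocker (R : realFieldType) (K : R -> R -> Prop) (i j : int) :
  good K -> ~ big_triangle K -> square K -> saturated_at K i j -> ~ K i%:~R j%:~R ->
  let P x y := blocks K x y i%:~R j%:~R in
  [\/ P 1 0 \/ P 0 1, P 1 1, K (-1) 0 /\ P (-1) 0 |
     (K 0 (-1) /\ P 0 (-1)) \/ (K (-1) (-1) /\ P (-1) (-1))].
Proof.
move=> gK nb [ka kb kc] [//|[k [l [kl kk blk]]]] _ P.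
have [[[e1 e2]|[e1 e2]|[e1 e2]]|[e1 e2]|[e1 e2]|[e1 e2]] := lattice_of_square gK nb ka kb kc kl kk;
  move: kk blk; rewrite e1 e2 => kk blk.
- by constructor 1; left.
- by constructor 1; right.
- by constructor 2.
- by constructor 3.
- by constructor 4; left.
- by constructor 4; right.
Qed.

Lemma blocks_antipode (R : realFieldType) (K : R -> R -> Prop) (x y a b : R) :
  K 0 0 -> separated K x y -> a = - x -> b = - y -> ~ blocks K x y a b.
Proof.
by move=> K0 [p [q s]] -> -> /(_ _ _ s); have [_ /(_ _ _ K0)] := s; lra.
Qed.

(** A supporting functional at (x, y) is nonnegative there because 0 is in K, and at (x', y') it is
    no larger; so it is at most 0 at the difference, which thus lies on the side of K. *)
Lemma blocks_second (R : realFieldType) (K : R -> R -> Prop) (x y x' y' a b : R) :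
  K 0 0 -> separated K x y -> K x' y' -> a = x' - x -> b = y' - y -> ~ blocks K x y a b.
Proof.
move=> K0 [p [q s]] k -> -> /(_ _ _ s).
by have [_ h] := s; have := h _ _ K0; have := h _ _ k; lra.
Qed.

Lemma square_left (R : realFieldType) (K : R -> R -> Prop) :
  good K -> ~ big_triangle K -> square K -> K (-1) 0 ->
  saturated_at K (-1) (-1) -> saturated_at K 0 (-1) -> False.
Proof.
move=> gK nb sq kd s4 s5; have [[cK _ W K0 sK] [ka kb kc]] := (gK, sq).
have sa : separated K 1 0 := sK 1 0 isT.
have sb : separated K 0 1 := sK 0 1 isT.
have sc : separated K 1 1 := sK 1 1 isT.
have sd : separated K (-1) 0 := sK (-1) 0 isT.
have [k4|n4] := pselect (K (-1) (-1)); have [k5|n5] := pselect (K 0 (-1)).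
- exact: (square_six gK nb sq kd k5 k4).
- have D5 : blocks K 1 0 0 (-1) \/ blocks K (-1) (-1) 0 (-1).
    have [[b|b]|b|[_ b]|[[k5 _]|[_ b]]] : _ := square_blocker gK nb sq s5 n5.
    + by left.
    + by case: (blocks_antipode K0 sb _ _ b); ring.
    + by case: (blocks_second K0 sc ka _ _ b); rewrite ?rmorphN ?rmorph1 ?rmorph0; ring.
    + by case: (blocks_second K0 sd k4 _ _ b); rewrite ?rmorphN ?rmorph1 ?rmorph0; ring.
    + by [].
    + by right.
  (* In the basis (1,1), (-1,0) the points (-1,-1) and (1,0) become (-1,0) and (0,-1), and the
     missing (0,-1) becomes (-1,-1): the five-point case. *)
  have det : (1 : int) * 0 - (-1) * 1 = 1 \/ (1 : int) * 0 - (-1) * 1 = -1 by left.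
  apply: (square_five' (good_pull det gK)).
  + by move=> /(big_triangle_pull det).
  + split; rewrite /pull.
    * by move: kc; congr K; rewrite ?rmorphN; ring.
    * by move: kd; congr K; rewrite ?rmorphN; ring.
    * by move: kb; congr K; rewrite ?rmorphN; ring.
  + by rewrite /pull; move: k4; congr K; rewrite ?rmorphN; ring.
  + by rewrite /pull; move: ka; congr K; rewrite ?rmorphN; ring.
  + case: D5 => b; [right|left]; apply: (blocks_pull det); move: b; congr blocks;
      rewrite ?rmorphN; ring.
- apply: (square_five' gK nb sq kd k5).
  have [[b|b]|b|[_ b]|[[_ b]|[k4 _]]] : _ := square_blocker gK nb sq s4 n4.
  + by case: (blocks_second K0 sa k5 _ _ b); rewrite ?rmorphN ?rmorph1 ?rmorph0; ring.
  + by case: (blocks_second K0 sb kd _ _ b); rewrite ?rmorphN ?rmorph1 ?rmorph0; ring.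
  + by case: (blocks_antipode K0 sc _ _ b); rewrite ?rmorphN ?rmorph1 ?rmorph0; ring.
  + by left.
  + by right.
  + by [].
- apply: (square_one_antipode gK sq kd).
  + have [[b|b]|b|[_ b]|[[k5 _]|[k4 _]]] : _ := square_blocker gK nb sq s5 n5 => //.
    * by left.
    * by case: (blocks_antipode K0 sb _ _ b); ring.
    * by case: (blocks_second K0 sc ka _ _ b); rewrite ?rmorphN ?rmorph1 ?rmorph0; ring.
    * by right.
  + have [[b|b]|b|[_ b]|[[k5 _]|[k4 _]]] : _ := square_blocker gK nb sq s4 n4 => //.
    * by left.
    * by case: (blocks_second K0 sb kd _ _ b); rewrite ?rmorphN ?rmorph1 ?rmorph0; ring.
    * by case: (blocks_antipode K0 sc _ _ b); rewrite ?rmorphN ?rmorph1 ?rmorph0; ring.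
    * by right.
Qed.

Lemma saturated_swap (R : realFieldType) (K : R -> R -> Prop) (i j : int) :
  saturated_at K j i -> saturated_at (pull K 0 1 1 0) i j.
Proof.
by move=> s; apply: (saturated_pull swap_det); rewrite !mul0r !mul1r addr0 add0r.
Qed.

Lemma square_case (R : realFieldType) (K : R -> R -> Prop) :
  good K -> ~ big_triangle K -> square K ->
  saturated_at K (-1) 0 -> saturated_at K (-1) (-1) -> saturated_at K 0 (-1) -> False.
Proof.
move=> gK nb sq s3 s4 s5; have [[cK _ W K0 sK] [ka kb kc]] := (gK, sq).
have [k3|n3] := pselect (K (-1) 0); first exact: (square_left gK nb sq k3 s4 s5).
have [k5|n5] := pselect (K 0 (-1)).
  apply: (square_left (good_swap gK) (swap_neg nb) (square_swap sq)).
  - by rewrite pull_swap.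
  - exact: saturated_swap.
  - exact: saturated_swap.
have sa : separated K 1 0 := sK 1 0 isT.
have sb : separated K 0 1 := sK 0 1 isT.
have sc : separated K 1 1 := sK 1 1 isT.
have D3 : blocks K 0 1 (-1) 0 \/ K (-1) (-1) /\ blocks K (-1) (-1) (-1) 0.
  have [[b|b]|b|[k3 _]|[[k5 _]|b]] : _ := square_blocker gK nb sq s3 n3 => //.
  - by case: (blocks_antipode K0 sa _ _ b); rewrite ?rmorphN ?rmorph1 ?rmorph0; ring.
  - by left.
  - by case: (blocks_second K0 sc kb _ _ b); rewrite ?rmorphN ?rmorph1 ?rmorph0; ring.
  - by right.
have D5 : blocks K 1 0 0 (-1) \/ K (-1) (-1) /\ blocks K (-1) (-1) 0 (-1).
  have [[b|b]|b|[k3 _]|[[k5 _]|b]] : _ := square_blocker gK nb sq s5 n5 => //.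
  - by left.
  - by case: (blocks_antipode K0 sb _ _ b); rewrite ?rmorphN ?rmorph1 ?rmorph0; ring.
  - by case: (blocks_second K0 sc ka _ _ b); rewrite ?rmorphN ?rmorph1 ?rmorph0; ring.
  - by right.
case: D3 => [b3|[k4 b3]]; case: D5 => [b5|[k4' b5]].
- have [[p0 [q0 s0]] [p2 [q2 s2]]] := (sa, sb).
  have := (b3 _ _ s2, b5 _ _ s0); rewrite !smul => -[t2 t0].
  by apply: (square_two_tilts gK sq s0 s2); lra.
- exact: (square_opposite gK sq k4' b3 b5).
- apply: (square_opposite (good_swap gK) (square_swap sq)).
  + by rewrite pull_swap.
  + exact: blocks_swap.
  + exact: blocks_swap.
- have [p [q s]] : separated K (-1) (-1) := sK (-1) (-1) isT.
  have [_ h] := s; have := h _ _ K0.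
  by have := (b3 _ _ s, b5 _ _ s); rewrite !smul => -[? ?]; lra.
Qed.

(** The bounds keep the images of (-1,0), (-1,-1) and (0,-1) inside the window where saturation is
    known. *)
Lemma square_case_pull (R : realFieldType) (K : R -> R -> Prop) (a b c d : int) :
  a * d - b * c = 1 \/ a * d - b * c = -1 -> good K -> ~ big_triangle K ->
  (forall i j : int, `|i| <= 1 -> `|j| <= 1 -> saturated_at K i j) ->
  `|a| <= 1 -> `|b| <= 1 -> `|c| <= 1 -> `|d| <= 1 -> `|a + b| <= 1 -> `|c + d| <= 1 ->
  K a%:~R c%:~R -> K b%:~R d%:~R -> K (a + b)%:~R (c + d)%:~R -> False.
Proof.
move=> det gK nb sat ha hb hc hd hab hcd k1 k2 k3.
apply: (square_case (good_pull det gK)).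
- by move=> /(big_triangle_pull det).
- split; rewrite /pull.
  + by move: k1; congr K; ring.
  + by move: k2; congr K; ring.
  + by move: k3; congr K; rewrite rmorphD /=; ring.
- by apply: saturated_pull => //; apply: sat; lia.
- by apply: saturated_pull => //; apply: sat; lia.
- by apply: saturated_pull => //; apply: sat; lia.
Qed.

Lemma basis_blocker (R : realFieldType) (K : R -> R -> Prop) (i j : int) :
  good K -> ~ big_triangle K -> K 1 0 -> K 0 1 -> ~ K 1 1 -> ~ K 1 (-1) -> ~ K (-1) 1 ->
  saturated_at K i j -> ~ K i%:~R j%:~R ->
  let P x y := blocks K x y i%:~R j%:~R in
  [\/ P 1 0 \/ P 0 1, K (-1) 0 /\ P (-1) 0, K 0 (-1) /\ P 0 (-1) |
     K (-1) (-1) /\ P (-1) (-1)].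
Proof.
move=> gK nb ka kb n1 n2 n3 [//|[k [l [kl kk blk]]]] _ P.
have [[[e1 e2]|[e1 e2]]|[e1 e2]|[e1 e2]|[e1 e2]] := lattice_of_basis gK nb ka kb n1 n2 n3 kl kk;
  move: kk blk; rewrite e1 e2 => kk blk.
- by constructor 1; left.
- by constructor 1; right.
- by constructor 2.
- by constructor 3.
- by constructor 4.
Qed.

Lemma saturated_big_triangle (R : realFieldType) (K : R -> R -> Prop) :
  good K -> K 1 0 -> K 0 1 ->
  (forall i j : int, `|i| <= 1 -> `|j| <= 1 -> saturated_at K i j) -> big_triangle K.
Proof.
move=> gK ka kb sat; apply: contrapT => nb; have [cK _ W K0 sK] := gK.
have n11 : ~ K 1 1.
  move=> k; apply: (square_case gK nb); first by [].
  - exact: sat.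
  - exact: sat.
  - exact: sat.
(* (0,1) and (1,-1) form a basis with sum (1,0), so K would contain a unit square in that basis; the
   other exclusions are of the same kind. *)
have n1m : ~ K 1 (-1).
  move=> k; apply: (@square_case_pull _ K 0 1 1 (-1) _ gK nb sat) => //; by right.
have nm1 : ~ K (-1) 1.
  move=> k; apply: (@square_case_pull _ K 1 (-1) 0 1 _ gK nb sat) => //; by left.
have bl i j : `|i| <= 1 -> `|j| <= 1 -> ~ K i%:~R j%:~R -> _ :=
  fun hi hj n => basis_blocker gK nb ka kb n11 n1m nm1 (sat i j hi hj) n.
have [kmm|nmm] := pselect (K (-1) (-1)).
  have nc : ~ K (-1) 0.
    move=> k; apply: (@square_case_pull _ K 0 (-1) 1 (-1) _ gK nb sat) => //; by left.
  have nd : ~ K 0 (-1).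
    move=> k; apply: (@square_case_pull _ K 1 (-1) 0 (-1) _ gK nb sat) => //; by right.
  apply: (three_vertices gK ka kb kmm).
  - by have [[b|b]|[k _]|[k _]|[_ b]] := bl 1 1 isT isT n11; [left|right; left| | |right; right].
  - by have [[b|b]|[k _]|[k _]|[_ b]] := bl (-1) 0 isT isT nc; [left|right; left| | |right; right].
  - by have [[b|b]|[k _]|[k _]|[_ b]] := bl 0 (-1) isT isT nd; [left|right; left| | |right; right].
have b1 := bl 1 1 isT isT n11; have b2 := bl (-1) 1 isT isT nm1.
have b3 := bl 1 (-1) isT isT n1m; have b4 := bl (-1) (-1) isT isT nmm.
have [kc|nc] := pselect (K (-1) 0); have [kd|nd] := pselect (K 0 (-1)).
- apply: (no_diagonal_two_antipodes gK ka kb kc kd).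
  + by case: b1 => [[b|b]|[_ b]|[_ b]|[]//]; tauto.
  + by case: b2 => [[b|b]|[_ b]|[_ b]|[]//]; tauto.
  + by case: b3 => [[b|b]|[_ b]|[_ b]|[]//]; tauto.
  + by case: b4 => [[b|b]|[_ b]|[_ b]|[]//]; tauto.
- apply: (no_diagonal_one_antipode gK ka kb kc).
  + by case: b1 => [[b|b]|[_ b]|[]//|[]//]; tauto.
  + by case: b2 => [[b|b]|[_ b]|[]//|[]//]; tauto.
  + by case: b3 => [[b|b]|[_ b]|[]//|[]//]; tauto.
  + by case: b4 => [[b|b]|[_ b]|[]//|[]//]; tauto.
- apply: (no_diagonal_one_antipode (good_swap gK)); rewrite ?pull_swap //.
  + by case: b1 => [[b|b]|[]//|[_ b]|[]//]; [right; left|left|right; right]; exact: blocks_swap.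
  + by case: b3 => [[b|b]|[]//|[_ b]|[]//]; [right; left|left|right; right]; exact: blocks_swap.
  + by case: b2 => [[b|b]|[]//|[_ b]|[]//]; [right; left|left|right; right]; exact: blocks_swap.
  + by case: b4 => [[b|b]|[]//|[_ b]|[]//]; [right; left|left|right; right]; exact: blocks_swap.
(* Only (1,0) and (0,1) can block here, and they cannot block all of (1,1), (1,-1) and (-1,1). *)
- have [pa [qa sa]] : separated K 1 0 := sK 1 0 isT.
  have [pb [qb sb]] : separated K 0 1 := sK 0 1 isT.
  have [[za ha] [zb hb]] := (sa, sb).
  have := (ha _ _ K0, ha _ _ kb, hb _ _ K0, hb _ _ ka); rewrite !smul => -[[[a1 a2] a3] a4].
  case: b1 => [[/(_ _ _ sa)|/(_ _ _ sb)]|[]//|[]//|[]//]; rewrite !smul => h1.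
    case: b3 => [[/(_ _ _ sa)|/(_ _ _ sb)]|[]//|[]//|[]//]; rewrite rmorphN !smul => h3.
      by lra.
    by lra.
  case: b2 => [[/(_ _ _ sa)|/(_ _ _ sb)]|[]//|[]//|[]//]; rewrite rmorphN !smul => h2.
    by lra.
  by lra.
Qed.

Lemma off_axis_big_triangle (R : realType) (K : R -> R -> Prop) (i j : int) :
  good K -> K 1 0 -> 1 <= j -> K i%:~R j%:~R -> big_triangle K.
Proof.
move=> gK k10 j1 kij; have [cK _ W K0 sK] := gK.
have jn : j != 0 by lia.
(* [m] is i / j rounded up. The triangle with vertices 0, (1,0), (i,j) meets the line y = 1 in the
   segment from i / j to i / j + 1 - 1 / j, which contains [m]. *)
pose m := - (- i %/ j)%Z; pose r := (- i %% j)%Z.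
have rE : m * j - i = r.
  by have e := divz_eq (- i) j; rewrite /m /r mulNr {2}e; ring.
have r0 : 0 <= r by exact: modz_ge0.
have rj : r < j by apply: ltz_pmod; lia.
have jR : 1 <= j%:~R :> R by rewrite ler1z.
have r0R : 0 <= r%:~R :> R by rewrite ler0z.
have rjR : r%:~R + 1 <= j%:~R :> R by rewrite -[1](rmorph1 (intmul 1)) -rmorphD ler_int lezD1.
have rER : r%:~R = m%:~R * j%:~R - i%:~R :> R by rewrite -rmorphM -rmorphB rE.
have km : K m%:~R 1.
  have g1 : 0 <= (j%:~R - 1 - r%:~R) / j%:~R :> R by rewrite divr_ge0; lra.
  have g2 : 0 <= r%:~R / j%:~R :> R by rewrite divr_ge0; lra.
  have g3 : 0 < 1 / j%:~R :> R by rewrite divr_gt0; lra.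
  have g4 : (j%:~R - 1 - r%:~R) / j%:~R + r%:~R / j%:~R + 1 / j%:~R = 1 :> R by field_lra.
  have := convex2_comb3 cK K0 k10 kij g1 g2 g3 g4.
  by congr K; rewrite ?rER; field_lra.
have det : (1 : int) * 1 - m * 0 = 1 \/ (1 : int) * 1 - m * 0 = -1 by left; rewrite mulr0 subr0.
apply: (big_triangle_pull det).
have gK' := good_pull det gK.
have [K' [gK'' sub sat]] := saturate 1 gK'.
have [cK' _ W' _ _] := gK'.
apply: (big_triangle_sub sub cK' W').
apply: (saturated_big_triangle gK'') => //.
- by apply: sub; rewrite /pull; move: k10; congr K; ring.
- by apply: sub; rewrite /pull; move: km; congr K; ring.
Qed.

Lemma good_big_triangle (R : realType) (K : R -> R -> Prop) : good K -> big_triangle K.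
Proof.
move=> gK; have [cK _ W _ _] := gK.
have [K1 [gK1 sub1 [i [j [ij k1]]]]] := add_lattice_point gK.
apply: (big_triangle_sub sub1 cK W).
have [g [a [b [c [d [g0 iE jE det]]]]]] := primitive_basis ij.
have det' : a * d - b * c = 1 \/ a * d - b * c = -1 by left.
apply: (big_triangle_pull det').
have gK2 := good_pull det' gK1; have [cK2 _ W2 _ _] := gK2.
have k2 : pull K1 a b c d 1 0.
  have [cK1 _ _ K10 _] := gK1.
  have gR : 1 <= g%:~R :> R by rewrite ler1z.
  have t01 : 0 <= (1 : R) / g%:~R <= 1 by rewrite divr_ge0 ?ler_pdivrMr; lra.
  have := scale_in cK1 K10 k1 t01; rewrite iE jE /pull.
  by congr K1; rewrite !rmorphM /=; field_lra.
have [K3 [gK3 sub3 [k [l [l0 k3]]]]] := leave_axis gK2 k2.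
apply: (big_triangle_sub sub3 cK2 W2).
have k10 := sub3 _ _ k2.
have [lp|ln] : 1 <= l \/ l <= -1 by lia.
  exact: (off_axis_big_triangle gK3 k10 lp k3).
have det3 : (1 : int) * -1 - 0 * 0 = 1 \/ (1 : int) * -1 - 0 * 0 = -1 by right.
apply: (big_triangle_pull det3).
apply: (@off_axis_big_triangle _ _ k (- l) (good_pull det3 gK3)).
- by rewrite /pull; move: k10; congr K3; rewrite ?rmorphN; ring.
- by lia.
- by rewrite /pull; move: k3; congr K3; rewrite ?rmorphN /=; ring.
Qed.

(** * From convex bodies to planar predicates *)

Definition row2 (R : pzRingType) (x y : R) : 'rV[R]_2 := \row_j (if j == 0 then x else y).

Lemma row2E (R : pzRingType) (x y : R) : (row2 x y 0 0 = x) * (row2 x y 0 1 = y).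
Proof. by rewrite !mxE. Qed.

Lemma row2_eta (R : pzRingType) (v : 'rV[R]_2) : row2 (v 0 0) (v 0 1) = v.
Proof.
apply/rowP => j; rewrite mxE; case: j => [[|[|//]] hj] /=.
  by congr (v _ _); apply: val_inj.
by congr (v _ _); apply: val_inj.
Qed.

Lemma row2D (R : pzRingType) (x y x' y' : R) : row2 x y + row2 x' y' = row2 (x + x') (y + y').
Proof. by rewrite -[LHS]row2_eta !mxE. Qed.

Lemma row2Z (R : pzRingType) (a x y : R) : a *: row2 x y = row2 (a * x) (a * y).
Proof. by rewrite -[LHS]row2_eta !mxE. Qed.

Lemma row2_lattice (R : realType) (i j : int) :
  lattice_vec R (row2 i j) = row2 i%:~R j%:~R.
Proof. by rewrite -[LHS]row2_eta !mxE. Qed.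

Lemma dotv2 (R : realType) (u v : 'rV[R]_2) : dotv u v = u 0 0 * v 0 0 + u 0 1 * v 0 1.
Proof.
rewrite /dotv big_ord_recl big_ord1; congr (_ + _ * _); congr (_ _ _); exact: val_inj.
Qed.

Definition planar (R : realType) (K : set 'rV[R]_2) (x y : R) : Prop := K (row2 x y).

Lemma convex2_planar (R : realType) (K : set 'rV[R]_2) : convex_set K -> convex2 (planar K).
Proof.
move=> cK x1 y1 x2 y2 t k1 k2 /andP[t0 t1]; rewrite /planar.
have s0 : 0 <= 1 - t by rewrite subr_ge0.
have s1 : 1 - t <= 1 by rewrite gerBl.
have := cK (row2 x1 y1) (row2 x2 y2) (Itv01 s0 s1) (mem_set k1) (mem_set k2).
move/set_mem; congr K; rewrite /conv /= /unstable.onem !row2Z row2D.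
have -> : 1 - (1 - t) = t by ring.
by [].
Qed.

Lemma bounded2_planar (R : realType) (K : set 'rV[R]_2) :
  compact K -> exists N, bounded2 (planar K) N.
Proof.
move=> /compact_bounded[M [_ hM]].
have M0 : M < (Num.truncn `|M|).+1%:R.
  by apply: le_lt_trans (ler_norm _) _; rewrite truncnS_gt.
exists (Num.truncn `|M|).+1 => x y k.
have := hM _ M0 _ k; rewrite /Num.norm /= mx_normrE => h.
have e i j : `|row2 x y i j| <= (Num.truncn `|M|).+1%:R.
  by apply: le_trans h; apply: (le_bigmax _ (fun ij => `|row2 x y ij.1 ij.2|) (i, j)).
by have := (e 0 0, e 0 1); rewrite !row2E => -[].
Qed.

Lemma dotv_continuous (R : realType) (u : 'rV[R]_2) : continuous (dotv u).
Proof.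
have -> : dotv u = (fun v => u 0 0 * v 0 0 + u 0 1 * v 0 1).
  by apply/funext => v; exact: dotv2.
move=> v.
have nF := @nbhs_filter ('rV[R]_2 : topologicalType) v.
have h (c : R) j : (fun w : 'rV[R]_2 => c * w 0 j) w @[w --> v] --> c * v 0 j.
  by apply: cvgMr; exact: (@coord_continuous R 1 2 0 j v).
exact: (@cvgD _ _ _ _ nF _ _ _ _ (h (u 0 0) 0) (h (u 0 1) 1)).
Qed.

Lemma width_along_attained (R : realType) (K : set 'rV[R]_2) (u : 'rV[R]_2) :
  K !=set0 -> compact K ->
  exists v w, [/\ K v, K w, width_along K u = dotv u v - dotv u w &
    forall x y, K x -> K y -> dotv u x - dotv u y <= width_along K u].
Proof.
move=> K0 cK; have cu := continuous_subspaceT (@dotv_continuous R u).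
have [v /set_mem kv hv] := EVT_max_rV K0 cK (cu K).
have [w /set_mem kw hw] := EVT_min_rV K0 cK (cu K).
have sE : sup (dotv u @` K) = dotv u v.
  apply/eqP; rewrite eq_le; apply/andP; split.
    apply: ge_sup; first by exists (dotv u v), v.
    by move=> _ [x kx <-]; apply: hv; exact/mem_set.
  apply: ub_le_sup; last by exists v.
  by exists (dotv u v) => _ [x kx <-]; apply: hv; exact/mem_set.
have iE : inf (dotv u @` K) = dotv u w.
  apply/eqP; rewrite eq_le; apply/andP; split.
    apply: ge_inf; last by exists w.
    by exists (dotv u w) => _ [x kx <-]; apply: hw; exact/mem_set.
  apply: lb_le_inf; first by exists (dotv u w), w.
  by move=> _ [x kx <-]; apply: hw; exact/mem_set.
exists v, w; split=> //; rewrite /width_along sE iE // => x y kx ky.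
by apply: lerB; [apply: hv|apply: hw]; exact/mem_set.
Qed.

Lemma lattice_width_le (R : realType) (K : set 'rV[R]_2) (u : 'rV[int]_2) :
  K !=set0 -> compact K -> u != 0 -> lattice_width K <= width_along K (lattice_vec R u).
Proof.
move=> K0 cK u0; apply: ge_inf; last by exists u.
exists 0 => _ [w _ <-]; have [v [v' [kv _ _ h]]] := width_along_attained (lattice_vec R w) K0 cK.
by have := h _ _ kv kv; rewrite subrr.
Qed.

Lemma wide3_planar (R : realType) (K : set 'rV[R]_2) :
  K !=set0 -> compact K -> 3 <= lattice_width K -> wide3 (planar K).
Proof.
move=> K0 cK h3 i j ij.
have u0 : row2 i j != 0.
  apply: contraTN ij => /eqP e; rewrite negb_or !negbK.
  by rewrite -(row2E i j).1 -{2}(row2E i j).2 e !mxE eqxx.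
have := le_trans h3 (lattice_width_le K0 cK u0).
have [v [w [kv kw -> _]]] := width_along_attained (lattice_vec R (row2 i j)) K0 cK.
rewrite row2_lattice !dotv2 !row2E => h.
by exists (v 0 0), (v 0 1), (w 0 0), (w 0 1); rewrite /planar !row2_eta.
Qed.

Lemma separated_planar (R : realType) (K : set 'rV[R]_2) (x y : R) :
  convex_set K -> ~ interior K (row2 x y) -> separated (planar K) x y.
Proof.
move=> cK nK; apply: contrapT => /(not_separated_box (convex2_planar cK)) [e e0 h].
apply: nK; apply/nbhs_ballP; exists e => //= v [_ hv].
rewrite -[v]row2_eta; apply: h; rewrite distrC ltW //.
  by have := hv 0 0; rewrite row2E.
by have := hv 0 1; rewrite row2E.
Qed.

Lemma interior_lattice_unique (R : realType) (K : set 'rV[R]_2) (i j k l : int) :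
  (interior_lattice_count K <= 1%:E)%E ->
  interior K (row2 i%:~R j%:~R) -> interior K (row2 k%:~R l%:~R) -> k = i /\ l = j.
Proof.
rewrite /interior_lattice_count /counting; case: asboolP => // fin; rewrite lee_fin -[1]/(1%:R) ler_nat => c1 h1 h2.
have mem i' j' : interior K (row2 i'%:~R j'%:~R) ->
    row2 i'%:~R j'%:~R \in fset_set (interior K `&` lattice R 2).
  move=> h; rewrite in_fset_set //; apply/mem_set; split=> //.
  by exists (row2 i' j') => //; rewrite row2_lattice.
move: (fset_set _) c1 (mem _ _ h1) (mem _ _ h2) => F c1 m1 m2.
have e : row2 i%:~R j%:~R = row2 k%:~R l%:~R :> 'rV[R]_2.
  apply/eqP; apply: contraTT c1 => ne; rewrite -ltnNge.
  have sub : ([fset row2 i%:~R j%:~R; row2 k%:~R l%:~R] `<=` F)%fset.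
    by apply/fsubsetP => v /fset2P[->|->].
  by apply: leq_trans (fsubset_leq_card sub); rewrite cardfs2 ltnS lt0b; exact: ne.
have := congr1 (fun v : 'rV[R]_2 => v 0 0) e; have := congr1 (fun v : 'rV[R]_2 => v 0 1) e.
by rewrite !row2E => /intr_inj -> /intr_inj ->.
Qed.

(** The origin is placed at the interior lattice point if there is one, else at any lattice point of
    K. If K has no lattice point at all, one is adjoined first, keeping every lattice point
    separated. *)
Lemma wide_big_triangle (R : realType) (K : set 'rV[R]_2) :
  convex_body K -> (interior_lattice_count K <= 1%:E)%E -> 3 <= lattice_width K ->
  big_triangle (planar K).
Proof.
move=> [K0 cK xK] c1 w3.
have W := wide3_planar K0 cK w3; have X := convex2_planar xK; have [N B] := bounded2_planar cK.
have ofshift (i j : int) : planar K i%:~R j%:~R ->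
    (forall k l : int, (k != i) || (l != j) -> separated (planar K) k%:~R l%:~R) ->
    big_triangle (planar K).
  by move=> kij s; apply: big_triangle_shift; apply: good_big_triangle; exact: (good_shift X B W kij s).
have [[i [j hij]]|none] := pselect (exists i j : int, interior K (row2 i%:~R j%:~R)).
  apply: (ofshift i j) => [|k l kl]; first exact: (interior_subset hij).
  apply: separated_planar => // hkl.
  by have [ek el] := interior_lattice_unique c1 hij hkl; move: kl; rewrite ek el !eqxx.
have sep (k l : int) : separated (planar K) k%:~R l%:~R.
  by apply: separated_planar => // h; apply: none; exists k, l.
have [[i [j kij]]|nolat] := pselect (exists i j : int, planar K i%:~R j%:~R).
  exact: (ofshift i j).
have [v kv] := K0; rewrite -[v]row2_eta in kv.
(* K has no lattice points to keep separated from [C], so [C] is the whole plane and (0,0) is an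
   arbitrary start. *)
have [//|//|//||k l _ kl|i [j [_ _ s]]] := @extend_separated R (planar K) (fun _ _ => True) N
  (v 0 0) (v 0 1) (fun _ _ => True) 0 0 X B kv.
- by move=> k; apply: nolat; exists 0, 0.
- by exfalso; apply: nolat; exists k, l.
apply: (big_triangle_sub (fun x y => @sub_cone1 _ _ i%:~R j%:~R x y) X W).
apply: big_triangle_shift; apply: good_big_triangle.
have BN : bounded2 (planar K) (N + absz i + absz j)%N.
  by apply: bounded2_le B; lia.
apply: (good_shift (convex2_cone1 X) (bounded2_cone1 BN _ _)); try lia.
- by apply: wide3_sub W => x y; exact: sub_cone1.
- exact: cone1_apex kv.
- by move=> k l _; exact: s.
Qed.

(** * The standard triangle and its width *)

Lemma convex_set_halfplane (R : realType) (a b c : R) :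
  convex_set [set v : 'rV[R]_2 | a * v 0 0 + b * v 0 1 <= c].
Proof.
move=> v w p /set_mem /= hv /set_mem /= hw; apply/mem_set; rewrite /= /conv /= /unstable.onem !mxE.
have p0 : 0 <= p%:inum by [].
have p1 : 0 <= 1 - p%:inum by rewrite subr_ge0.
have := (ler_wpM2l p0 hv, ler_wpM2l p1 hw) => -[]; lra.
Qed.

Lemma Delta2P (R : realType) (x y : R) :
  Delta2 R (row2 x y) <-> [/\ 0 <= x, 0 <= y & x + y <= 1].
Proof.
have e0 : 0 = row2 0 0 :> 'rV[R]_2 by rewrite -[LHS]row2_eta !mxE.
have e1 : delta_mx 0 1 = row2 0 1 :> 'rV[R]_2 by rewrite -[LHS]row2_eta !mxE.
have e2 : delta_mx 0 0 = row2 1 0 :> 'rV[R]_2 by rewrite -[LHS]row2_eta !mxE.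
split=> [h|[x0 y0 xy] C [cC hC]].
  have half a b c : c >= 0 -> b <= c -> a <= c -> a * x + b * y <= c.
    move=> c0 bc ac; have := smallest_sub (convex_set_halfplane (a := a) (b := b) (c := c)).
    move=> /(_ [set 0; delta_mx 0 1; delta_mx 0 0]) sub.
    have : a * row2 x y 0 0 + b * row2 x y 0 1 <= c; last by rewrite !row2E.
    apply: sub h => v [[->|->]|->] /=; rewrite ?e0 ?e1 ?e2 !row2E; lra.
  have := (half (-1) 0 0, half 0 (-1) 0, half 1 1 1) => -[[h1 h2] h3].
  by split; [have := h1 _ _ _|have := h2 _ _ _|have := h3 _ _ _]; lra.
have v0 : planar C 0 0 by apply: hC; left; left; rewrite -e0.
(* The edge vectors are a third of the unit vectors, to cancel the factor 3 built into
   [convex2_triangle]. *)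
have v1 : planar C (0 + 3 * (1 / 3)) (0 + 3 * 0).
  by apply: hC; right; rewrite e2 /=; congr (row2 _ _); field.
have v2 : planar C (0 + 3 * 0) (0 + 3 * (1 / 3)).
  by apply: hC; left; right; rewrite e1 /=; congr (row2 _ _); field.
have := @convex2_triangle R _ 0 0 (1 / 3) 0 0 (1 / 3) (3 * x) (3 * y) (convex2_planar cC) v0 v1 v2.
have -> : 0 + 3 * x * (1 / 3) + 3 * y * 0 = x by field.
have -> : 0 + 3 * x * 0 + 3 * y * (1 / 3) = y by field.
by apply; lra.
Qed.

Lemma unitmx_int2 (U : 'M[int]_2) :
  U \in unitmx <-> U 0 0 * U 1 1 - U 1 0 * U 0 1 = 1 \/ U 0 0 * U 1 1 - U 1 0 * U 0 1 = -1.
Proof.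
have -> : U 0 0 * U 1 1 - U 1 0 * U 0 1 = \det U.
  rewrite (expand_det_col _ 0) big_ord_recl big_ord1 /cofactor !det_mx11 !mxE /=.
  rewrite expr0 expr1 mul1r mulN1r mulrN.
  by congr (U _ _ * U _ _ - U _ _ * U _ _); exact: val_inj.
rewrite unitmxE; split=> [/orP[]/eqP|[|] ->]; [by left|by right|by []|by []].
Qed.

Lemma row2_affine (R : realType) (U : 'M[int]_2) (t : 'rV[int]_2) (x y : R) :
  row2 x y *m (map_mx intr U)^T + lattice_vec R t =
  row2 ((t 0 0)%:~R + x * (U 0 0)%:~R + y * (U 0 1)%:~R)
    ((t 0 1)%:~R + x * (U 1 0)%:~R + y * (U 1 1)%:~R).
Proof.
rewrite -[LHS]row2_eta !mxE !big_ord_recl !big_ord0 !mxE /=.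
have -> : lift ord0 ord0 = 1 :> 'I_2 by exact: val_inj.
by congr row2; ring.
Qed.

Lemma unimodular_big_triangle (R : realType) (K : set 'rV[R]_2) :
  unimodularly_equivalent K (dilate 3 (Delta2 R)) <-> big_triangle (planar K).
Proof.
split=> [[U [t [/unitmx_int2 det KE]]]|[ o1 [ o2 [e1 [e2 [f1 [f2 [det h]]]]]]]].
  exists (t 0 0), (t 0 1), (U 0 0), (U 1 0), (U 0 1), (U 1 1); split=> // x y.
  rewrite /planar KE; split=> [[_ [v hv <-]]|[l [m [l0 m0 lm xE yE]]]].
    rewrite -[v]row2_eta in hv *; move/Delta2P: hv => [v0 v1 v01].
    rewrite row2Z row2_affine => e; exists (3 * v 0 0), (3 * v 0 1); split; try lra.
      by have := congr1 (fun v : 'rV[R]_2 => v 0 0) e; rewrite !row2E.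
    by have := congr1 (fun v : 'rV[R]_2 => v 0 1) e; rewrite !row2E.
  exists (row2 l m); last by rewrite row2_affine xE yE.
  exists (row2 (l / 3) (m / 3)); first by apply/Delta2P; split; lra.
  by rewrite row2Z; congr row2; field.
pose U : 'M[int]_2 := \matrix_(i, j)
  (if i == 0 then if j == 0 then e1 else f1 else if j == 0 then e2 else f2).
exists U, (row2 o1 o2); split.
  by apply/unitmx_int2; rewrite !mxE.
apply/seteqP; split=> [v|_ [_ [v hv <-] <-]].
  rewrite -[v]row2_eta => /h [l [m [l0 m0 lm -> ->]]].
  exists (row2 l m); last by rewrite row2_affine !row2E !mxE.
  exists (row2 (l / 3) (m / 3)); first by apply/Delta2P; split; lra.
  by rewrite row2Z; congr row2; field.
rewrite -[v]row2_eta in hv *; move/Delta2P: hv => [v0 v1 v01].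
rewrite row2Z row2_affine !row2E !mxE /=; apply/h.
by exists (3 * v 0 0), (3 * v 0 1); split; lra.
Qed.

(** The coordinate functional l has width at most 3 on the triangle. Conversely a nonzero integer
    functional takes integer values [A], [B] on the edge vectors, not both zero, and so varies by at
    least 3 along some edge. *)
Lemma big_triangle_width (R : realType) (K : set 'rV[R]_2) :
  K !=set0 -> compact K -> big_triangle (planar K) -> lattice_width K = 3.
Proof.
move=> K0 cK [ o1 [ o2 [e1 [e2 [f1 [f2 [det h]]]]]]].
have val (u v : int) (x1 y1 l m : R) :
    x1 = o1%:~R + l * e1%:~R + m * f1%:~R -> y1 = o2%:~R + l * e2%:~R + m * f2%:~R ->
    u%:~R * x1 + v%:~R * y1 = (u * o1 + v * o2)%:~R + l * (u * e1 + v * e2)%:~R + m * (u * f1 + v * f2)%:~R.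
  by move=> -> ->; rewrite !rmorphD !rmorphM /=; ring.
pose ei : int := e1 * f2 - e2 * f1.
have ei2 : ei * ei = 1 by rewrite /ei; case: det => ->.
apply/eqP; rewrite eq_le; apply/andP; split.
  have u0 : row2 (ei * f2) (- (ei * f1)) != 0.
    apply/eqP => e; move: ei2; rewrite {2}/ei.
    have -> : ei * (e1 * f2 - e2 * f1) = e1 * (ei * f2) + e2 * (- (ei * f1)) by ring.
    have [] := row2E (ei * f2) (- (ei * f1)); rewrite e !mxE => <- <-.
    by rewrite !mulr0.
  apply: le_trans (lattice_width_le K0 cK u0) _.
  have [v [w [kv kw -> _]]] :=
    width_along_attained (lattice_vec R (row2 (ei * f2) (- (ei * f1)))) K0 cK.
  rewrite -[v]row2_eta in kv *; rewrite -[w]row2_eta in kw *.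
  rewrite row2_lattice !dotv2 !row2E.
  have [l [m [l0 m0 lm xE yE]]] := (h _ _).1 kv.
  have [l' [m' [l'0 m'0 lm' xE' yE']]] := (h _ _).1 kw.
  rewrite (val _ _ _ _ _ _ xE yE) (val _ _ _ _ _ _ xE' yE').
  have -> : ei * f2 * e1 + - (ei * f1) * e2 = 1 by rewrite -ei2 {3}/ei; ring.
  have -> : ei * f2 * f1 + - (ei * f1) * f2 = 0 by ring.
  lra.
apply: lb_le_inf => [|_ [u u0 <-]].
  exists (width_along K (lattice_vec R (row2 1 0))), (row2 1 0) => //=.
  by apply/eqP => /(congr1 (fun v : 'rV[int]_2 => v 0 0)); rewrite !mxE.
have [_ [_ [_ _ _ W]]] := width_along_attained (lattice_vec R u) K0 cK.
move: u0 W; rewrite -[u]row2_eta /= row2_lattice => u0 W.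
have vO := (h _ _).2 (ex_intro _ 0 (ex_intro _ 0 (And5 (lexx 0) (lexx 0) _ erefl erefl))).
have vE := (h _ _).2 (ex_intro _ 3 (ex_intro _ 0 (And5 _ (lexx 0) _ erefl erefl))).
have vF := (h _ _).2 (ex_intro _ 0 (ex_intro _ 3 (And5 (lexx 0) _ _ erefl erefl))).
have {}vO := vO ltac:(lra).
have {}vE := vE ltac:(lra) ltac:(lra).
have {}vF := vF ltac:(lra) ltac:(lra).
move: (W _ _ vE vO) (W _ _ vO vE) (W _ _ vF vO) (W _ _ vO vF).
rewrite !dotv2 !row2E !(val _ _ _ _ _ _ erefl erefl).
set A := u 0 0 * e1 + _; set B := u 0 0 * f1 + _ => w1 w2 w3 w4.
have AB : A != 0 \/ B != 0.
  apply/orP; rewrite -negb_and; apply: contraNN u0 => /andP[/eqP a0 /eqP b0]; apply/eqP.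
  have x0 : ei * u 0 0 = 0.
    have -> : ei * u 0 0 = f2 * A - e2 * B by rewrite /ei /A /B; ring.
    by rewrite a0 b0; ring.
  have y0 : ei * u 0 1 = 0.
    have -> : ei * u 0 1 = e1 * B - f1 * A by rewrite /ei /A /B; ring.
    by rewrite a0 b0; ring.
  have -> : u 0 0 = ei * (ei * u 0 0) by rewrite mulrA ei2 mul1r.
  have -> : u 0 1 = ei * (ei * u 0 1) by rewrite mulrA ei2 mul1r.
  by rewrite x0 y0 mulr0 -[RHS]row2_eta !mxE.
have big (C : int) (w : R) : C != 0 -> 3 * C%:~R <= w -> - (3 * C%:~R) <= w -> 3 <= w.
  move=> C0; have : (C <= -1) || (1 <= C) by lia.
  rewrite -!(ler_int R) rmorphN1 /=; lra.
by case: AB => /big; apply; lra.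
Qed.

Theorem theorem1p1 (R : realType) (K : set 'rV[R]_2) :
  convex_body K ->
  (interior_lattice_count K <= 1%:E)%E ->
  lattice_width K <= 3 /\
  (lattice_width K = 3 <-> unimodularly_equivalent K (dilate 3 (Delta2 R))).
Proof.
move=> bK c1; have [K0 cK _] := bK; split; last first.
  rewrite unimodular_big_triangle; split=> [w|]; last exact: big_triangle_width.
  by apply: wide_big_triangle; rewrite ?w.
(* A width above 3 would also make K a copy of the triangle, whose width is 3. *)
have [//|gt3] := leP (lattice_width K) 3.
by have := gt3; rewrite (big_triangle_width K0 cK (wide_big_triangle bK c1 (ltW gt3))) ltxx.
Qed.
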